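(* Let $a>0$ and $\alpha\ge -1/2$. For every $f\in L^2((0,\infty),d\mu_{a,\alpha})$, where $d\mu_{a,\alpha}(r)=r^{a\alpha+a-1}\,dr$, one has $$e^{(\alpha+1)\pi i/2}\,I_{a,\alpha;\frac{\pi i}{2}}(f)=H_{a,\alpha}(f),$$ where $I_{a,\alpha;z}=e^{-\frac{z}{a}L_{a,\alpha}}$ is the $a$-deformed Laguerre holomorphic semigroup and $H_{a,\alpha}$ is the $a$-deformed Hankel transform $$H_{a,\alpha}(f)(r)=\frac{1}{a^{\alpha}\Gamma(\alpha+1)}\int_0^\infty f(s)\,j_\alpha\!\left(\frac{2}{a}r^{a/2}s^{a/2}\right)s^{a\alpha+a-1}\,ds,\qquad j_\alpha(t)=2^\alpha\Gamma(\alpha+1)t^{-\alpha}J_\alpha(t).$$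
   Context: $J_\alpha$ is the Bessel function of the first kind of order $\alpha$. $a$-deformed Laguerre operator: for $a>0$, $\alpha\ge-1/2$, $$L_{a,\alpha}=-\frac{1}{r^{a-2}}\frac{d^2}{dr^2}+r^a-(a\alpha+1)\frac{1}{r^{a-1}}\frac{d}{dr}$$ on $L^2((0,\infty),d\mu_{a,\alpha})$, $d\mu_{a,\alpha}(r)=r^{a\alpha+a-1}dr$. Let $L_l^\alpha(t)=\sum_{j=0}^l\frac{(-1)^j\Gamma(\alpha+l+1)}{(l-j)!\,\Gamma(\alpha+j+1)}\frac{t^j}{j!}$ be the Laguerre polynomials and $$\widetilde\varphi_l^{a,\alpha}(r)=\left(\frac{2^{\alpha+1}\Gamma(l+1)}{a^\alpha\Gamma(\alpha+l+1)}\right)^{1/2}L_l^\alpha\!\left(\tfrac{2}{a}r^a\right)e^{-r^a/a},\qquad l=0,1,2,\dots$$ These functions form an orthonormal basis of $L^2((0,\infty),d\mu_{a,\alpha})$ and $L_{a,\alpha}\widetilde\varphi_l^{a,\alpha}=a(2l+\alpha+1)\widetilde\varphi_l^{a,\alpha}$. The operator $L_{a,\alpha}$ is taken as the self-adjoint operator diagonalized by this basis, and for $\Re z\ge0$ the semigroup $I_{a,\alpha;z}=e^{-\frac{z}{a}L_{a,\alpha}}$ is defined spectrally: $$I_{a,\alpha;z}f=\sum_{l=0}^\infty e^{-z(2l+\alpha+1)}\langle f,\widetilde\varphi_l^{a,\alpha}\rangle_{d\mu_{a,\alpha}}\widetilde\varphi_l^{a,\alpha}\quad\text{(convergence in }L^2).$$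 The integral defining $H_{a,\alpha}$ converges absolutely for $f\in L^1\cap L^2((0,\infty),d\mu_{a,\alpha})$; for general $f\in L^2((0,\infty),d\mu_{a,\alpha})$, $H_{a,\alpha}(f)$ is understood as the continuous extension to $L^2$. The identity is an equality in $L^2((0,\infty),d\mu_{a,\alpha})$. *)

(* Defs.v *)
From HB Require Import structures.
From mathcomp Require Import all_boot all_order all_algebra.
From mathcomp Require Import all_classical all_reals all_analysis.
From mathcomp Require Import measurable_realfun complex.

Set Implicit Arguments.
Unset Strict Implicit.
Unset Printing Implicit Defensive.

Import Order.TTheory GRing.Theory Num.Theory.
Import numFieldNormedType.Exports.
Import ComplexField.Normc.

Local Open Scope classical_set_scope.
Local Open Scope ring_scope.
Local Open Scope complex_scope.

Section complex_Lp.
Context d {T : measurableType d} {R : realType}.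
Variable mu : {measure set T -> \bar R}.
Implicit Types f g : T -> R[i].

Definition cmeasurable f :=
  measurable_fun setT (fun x => complex.Re (f x)) /\
  measurable_fun setT (fun x => complex.Im (f x)).

Definition cLnorm (p : \bar R) f : \bar R := 'N[mu]_p[EFin \o (@normc R) \o f].

Definition cLfun (p : \bar R) f := cmeasurable f /\ (cLnorm p f < +oo)%E.

Definition cintegral f : R[i] :=
  (\int[mu]_x complex.Re (f x)) +i* (\int[mu]_x complex.Im (f x)).

Definition cdot f g : R[i] := cintegral (fun x => f x * (g x)^*).

(* Elements of L^2 are handled through representatives. *)
Definition L2eq f g := [/\ cLfun 2%:E f, cLfun 2%:E g & f = g %[ae mu]].

Definition L2lim (u : nat -> T -> R[i]) : set (T -> R[i]) :=
  [set g | cLfun 2%:E g /\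
           (fun n => cLnorm 2%:E (fun x => u n x - g x)) @ \oo --> 0%E].

(* Values at f of the extension by continuity of an operator H given on
   L^1 `&` L^2. *)
Definition L2ext (H : (T -> R[i]) -> T -> R[i]) f : set (T -> R[i]) :=
  [set g | cLfun 2%:E g /\
    forall e : R, 0 < e -> exists2 delta : R, 0 < delta &
      forall h, cLfun 1%:E h -> cLfun 2%:E h ->
        (cLnorm 2%:E (fun x => h x - f x)%R < delta%:E)%E ->
        (cLnorm 2%:E (fun x => H h x - g x)%R < e%:E)%E].

(* The default value is not square integrable when mu is infinite, as is
   deformed_measure below, so L2eq never holds of a default value. *)
Definition L2the (P : set (T -> R[i])) : T -> R[i] := xget (cst 1) P.

End complex_Lp.

Section special_functions.
Context {R : realType}.
Implicit Types (alpha t x : R) (z : R[i]).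

Definition cexp z : R[i] :=
  (expR (complex.Re z) * cos (complex.Im z)) +i*
  (expR (complex.Re z) * sin (complex.Im z)).

(* Euler's integral, meant for 0 < x *)
Definition Gamma x : R :=
  \int[@lebesgue_measure R]_(t in `]0, +oo[) (t `^ (x - 1) * expR (- t)).

(* Meant for 0 < t, and for -1 < alpha, so that Gamma is only used on
   positive arguments. *)
Definition bessel_J alpha t : R :=
  limn (series (fun m : nat =>
    (-1) ^+ m / (m`!%:R * Gamma (m%:R + alpha + 1))
    * (t / 2) `^ (2 * m%:R + alpha))).

Definition bessel_j alpha t : R :=
  2 `^ alpha * Gamma (alpha + 1) * t `^ (- alpha) * bessel_J alpha t.

Definition laguerre alpha (l : nat) : {poly R} :=
  \poly_(j < l.+1) ((-1) ^+ j * Gamma (alpha + l%:R + 1)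
    / ((l - j)`!%:R * Gamma (alpha + j%:R + 1)) / j`!%:R).

End special_functions.

Section deformed_measure.
Context {R : realType}.
Variables a alpha : R.

(* A measure on the whole of R that does not charge ]-oo, 0]. *)
Definition deformed_measure (A : set (measurableTypeR R)) : \bar R :=
  (\int[@lebesgue_measure R]_(r in A `&` `]0%R, +oo[)
    (r `^ (a * alpha + a - 1))%:E)%E.

Let deformed_measure0 : deformed_measure set0 = 0%E.
Proof. by rewrite /deformed_measure set0I integral_set0. Qed.

Let deformed_measure_ge0 A : (0 <= deformed_measure A)%E.
Proof. by apply: integral_ge0 => r _; rewrite lee_fin powR_ge0. Qed.

Let deformed_measure_sigma_additive : semi_sigma_additive deformed_measure.
Proof.
move=> /= F mF tF mUF; rewrite /deformed_measure; apply: cvg_toP.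
  apply: ereal_nondecreasing_is_cvgn => m n mn.
  apply: lee_sum_nneg_natr => // k _ _; apply: integral_ge0 => r _.
  by rewrite lee_fin powR_ge0.
rewrite setI_bigcupl ge0_integral_bigcup//=.
- by move=> k; exact: measurableI.
- by apply/measurable_funTS/measurableT_comp.
- by move=> r _; rewrite lee_fin powR_ge0.
- exact: trivIset_setIr.
Qed.

HB.instance Definition _ := isMeasure.Build _ _ _ deformed_measure
  deformed_measure0 deformed_measure_ge0 deformed_measure_sigma_additive.

End deformed_measure.

Section deformed_operators.
Context {R : realType}.
Variables a alpha : R.
Local Notation mu := (deformed_measure a alpha).
Implicit Types (f : measurableTypeR R -> R[i]) (z : R[i]).

Definition laguerre_fun (l : nat) (r : measurableTypeR R) : R :=
  Num.sqrt (2 `^ (alpha + 1) * Gamma (l%:R + 1)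
            / (a `^ alpha * Gamma (alpha + l%:R + 1)))
  * (laguerre alpha l).[2 / a * r `^ a] * expR (- (r `^ a / a)).

(* Spectral definition of exp(-(z / a) L), where L is the self-adjoint operator
   on L^2(mu) with L (laguerre_fun l) = a * (2 l + alpha + 1) * laguerre_fun l *)
Definition laguerre_semigroup z f : measurableTypeR R -> R[i] :=
  L2the (L2lim mu (fun n r => \sum_(l < n)
    cexp (- z * (2 * l%:R + alpha + 1)%:C)
    * cdot mu f (fun s => (laguerre_fun l s)%:C) * (laguerre_fun l r)%:C)).

Definition hankel_integral f (r : measurableTypeR R) : R[i] :=
  (a `^ alpha * Gamma (alpha + 1))^-1%:C
  * cintegral mu (fun s =>
      f s * (bessel_j alpha (2 / a * r `^ (a / 2) * s `^ (a / 2)))%:C).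

Definition hankel_transform f : measurableTypeR R -> R[i] :=
  L2the (L2ext mu hankel_integral f).

End deformed_operators.

(* Main.v *)
(* The proof identifies both sides on the Laguerre basis [phi_l]. Write
   [X r = r ^ a / a]. On the semigroup side the phase makes every coefficient
   real, [e^{(alpha + 1) pi i / 2} e^{- (2 l + alpha + 1) pi i / 2} = (-1)^l], so
   that the left-hand side is the L^2 limit of [sum_l (-1)^l <f, phi_l> phi_l].
   On the Hankel side the kernel is [F (X r * X s)] with [F] the entire Bessel
   series, [|F| <= 1] on [0, +oo[; integrating it termwise against
   [X ^ k e^{- X}] yields a polynomial times [e^{- X}], and in this way
   [H phi_l = (-1)^l phi_l]. For [f] in L^1 and L^2, Fubini then shows that the
   difference [D] of the two sides satisfies [int D phi_l = 0] for every [l].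
   Since [D e^{- X / 2}] is integrable, [D] vanishes almost everywhere: all
   integrals [int D e^{- t X}], [t >= 1], are zero (expand [e^{- t X}] in steps
   of length at most [1 / 4], starting from [t = 1]), and
   [(1 - y ^ n) ^ (n 2 ^ n)] with [y = 2 ^ (- X / c)] tends to the indicator of
   [X > c]. Truncations of [f] to [X <= n] are dense in L^2 and the map
   [phi_l |-> (-1)^l phi_l] is bounded, which gives the general case. *)
From HB Require Import structures.
Require Import Defs.
From mathcomp Require Import all_boot all_order all_algebra.
From mathcomp Require Import all_classical all_reals all_analysis.
From mathcomp Require Import measurable_realfun complex zify ring lra.
Set Implicit Arguments.
Unset Strict Implicit.
Unset Printing Implicit Defensive.

Import Order.TTheory GRing.Theory Num.Theory.
Import numFieldNormedType.Exports.

Local Open Scope classical_set_scope.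
Local Open Scope ring_scope.

(** * Pochhammer symbols and Bessel series *)

(** The measure enters the computations only through a function [X >= 0] and its exponential
    moments: under [X] it becomes [a^alpha x^alpha dx], and orthonormality and
    [H phi_l = (-1)^l phi_l] turn into finite identities between Pochhammer symbols. The sign is
    that of [(1 - 2)^(l - j)], where [2] comes from the argument [2 X] of the Laguerre polynomials.
    The hypothesis [-1/2 <= alpha] is what gives [|F| <= 1], so that [H] maps L^1 to bounded
    functions and Fubini applies. But [H f] is then a priori only bounded, not square integrable:
    [D] is a bounded function minus a square integrable one, and completeness of the basis in L^2
    would say nothing about it. What both terms share is integrability against [e^{-X/2}], so
    completeness is proved for functions of that kind. The steps in [t] must stay short because
    expanding [e^{-eX}] costs a factor [e^{eX}], and [t - e] has to stay above [1/2]. The exponent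
    [n 2^n] is chosen since [n 2^n y^n = n (2 y)^n] tends to [0] for [y < 1/2] and to infinity
    otherwise. Density of the truncations serves twice: it also makes the extension by continuity
    unique, without which the value chosen for the Hankel transform would not be determined. *)

Section pochhammer.
Context {R : comRingType}.
Implicit Types (b : R) (l m n k : nat).
Definition poch b n : R := \prod_(0 <= i < n) (b + i%:R).

Lemma poch0 b : poch b 0 = 1.
Proof. by rewrite /poch big_geq. Qed.

Lemma pochS b n : poch b n.+1 = poch b n * (b + n%:R).
Proof. by rewrite /poch big_nat_recr. Qed.

Lemma pochSl b n : poch b n.+1 = b * poch (b + 1) n.
Proof.
rewrite /poch big_nat_recl// addr0; congr (_ * _).
by apply: eq_bigr => i _; rewrite -addrA -natr1 [1 + _]addrC.
Qed.

Lemma pochD b m n : poch b (m + n) = poch b m * poch (b + m%:R) n.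
Proof.
elim: n => [|n IH]; first by rewrite addn0 poch0 mulr1.
by rewrite addnS !pochS IH natrD addrA mulrA.
Qed.

(** The two products share the factor [poch (b + 1) m.-1]; what remains is [b] in one and [b + m] in
    the other. *)
Lemma poch_sub b m : poch b m - poch (b + 1) m = - m%:R * poch (b + 1) m.-1.
Proof.
case: m => [|m]; first by rewrite !poch0 subrr oppr0 mul0r.
by rewrite pochSl pochS/= -natr1; ring.
Qed.

(** Pascal's rule under the sum, the induction step of both [alt_sum_poch] and
    [poch_vandermonde]. *)
Lemma sum_binS (V : lmodType R) (u v : nat -> V) k :
  \sum_(j < k.+2) 'C(k.+1, j)%:R *: u j =
  \sum_(j < k.+1) 'C(k, j)%:R *: u j + \sum_(j < k.+1) 'C(k, j)%:R *: u j.+1.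
Proof.
rewrite big_ord_recl bin0 scale1r.
under eq_bigr do rewrite /= /bump/= add1n binS natrD scalerDl.
rewrite big_split/= addrA; congr (_ + _).
rewrite big_ord_recr/= bin_small// scale0r addr0.
by rewrite [in RHS]big_ord_recl bin0 scale1r.
Qed.

(* A finite difference of order [l] of the polynomial [b |-> poch b m]. *)
Lemma alt_sum_poch l b m :
  \sum_(j < l.+1) 'C(l, j)%:R * ((-1) ^+ j * poch (b + j%:R) m) =
  (-1) ^+ l * (m ^_ l)%:R * poch (b + l%:R) (m - l).
Proof.
elim: l b m => [|l IH] b m.
  by rewrite big_ord_recl big_ord0 bin0 ffactn0 subn0 !expr0 !mul1r !addr0.
have := @sum_binS R^o (fun j => (-1) ^+ j * poch (b + j%:R) m) (fun _ => 0) l.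
rewrite /GRing.scale/= => ->; rewrite -big_split/=.
transitivity (- m%:R * \sum_(j < l.+1) 'C(l, j)%:R *
    ((-1) ^+ j * poch (b + 1 + j%:R) m.-1)).
  rewrite mulr_sumr; apply: eq_bigr => j _.
  have -> : b + j.+1%:R = b + j%:R + 1 by rewrite -natr1 addrA.
  transitivity ('C(l, j)%:R * (-1) ^+ j *
      (poch (b + j%:R) m - poch (b + j%:R + 1) m)); first by rewrite exprS; ring.
  by rewrite poch_sub [b + 1 + _]addrAC; ring.
rewrite IH; case: m => [|m].
  by rewrite ffact0n oppr0 !mul0r !mulr0 mul0r.
have -> : b + l.+1%:R = b + 1 + l%:R by rewrite -addrA nat1r.
by rewrite ffactSS natrM subSS exprS/=; ring.
Qed.

(** Chu-Vandermonde. It expands in falling factorials of [m], whose sums against an exponential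
    series are explicit ([cvg_falling_exp]). *)
Lemma poch_vandermonde k b m :
  poch (b + m%:R) k =
  \sum_(j < k.+1) 'C(k, j)%:R * ((m ^_ j)%:R * poch (b + j%:R) (k - j)).
Proof.
elim: k b => [|k IH] b.
  by rewrite big_ord_recl big_ord0 bin0 !poch0 ffactn0; ring.
have := @sum_binS R^o (fun j => (m ^_ j)%:R * poch (b + j%:R) (k.+1 - j))
  (fun _ => 0) k.
rewrite /GRing.scale/= => ->; rewrite -big_split/= pochSl addrAC IH mulr_sumr.
apply: eq_bigr => -[j jk] _ /=.
rewrite subSS subSn// pochSl.
have -> : b + j.+1%:R = b + 1 + j%:R by rewrite -addrA nat1r.
have -> : b + j%:R + 1 = b + 1 + j%:R by rewrite addrAC.
have -> : (m ^_ j.+1)%:R = (m ^_ j)%:R * (m%:R - j%:R) :> R.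
  have [jm|mj] := leqP j m; first by rewrite ffactnSr natrM natrB.
  by rewrite !ffact_small ?mul0r// (ltn_trans mj).
ring.
Qed.

End pochhammer.

Section poch_num.
Context {R : realFieldType}.
Implicit Types (b : R) (n : nat).

Lemma poch_gt0 b n : 0 < b -> 0 < poch b n.
Proof.
by move=> b0; apply: prodr_gt0 => i _; rewrite ltr_pwDl.
Qed.

(** Each factor [b + i] is at least [(i + 1) / 2]. The Pochhammer symbol in the Bessel coefficients
    can thus be traded for a second factorial. *)
Lemma poch_ge_half b n : 1 / 2 <= b -> n`!%:R / 2 ^+ n <= poch b n.
Proof.
move=> b2; elim: n => [|n IH]; first by rewrite poch0 fact0 expr0 divr1.
rewrite pochS factS natrM exprS.
have -> : n.+1%:R * n`!%:R / (2 * 2 ^+ n) = n`!%:R / 2 ^+ n * (n.+1%:R / 2) :> R.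
  by field; rewrite expf_neq0.
apply: ler_pM => //; rewrite ?divr_ge0// ?exprn_ge0//.
by rewrite -natr1; have := ler0n R n; lra.
Qed.

End poch_num.

Section bessel_series.
Context {R : realType}.
Implicit Types (b x y : R) (n m k : nat).

(** Coefficients of the hypergeometric series [0F1(; b; -x)]. *)
Definition bessel_coef b m : R := (-1) ^+ m / (m`!%:R * poch b m).

(* [bessel_ser b (x ^+ 2 / 4)] is [bessel_j (b - 1) x]. *)
Definition bessel_ser b x : R := limn (pseries (bessel_coef b) x).

(** Both factorials are kept on the right: [hankel_expow] spends one of them on the growth in [y]
    and the other on the growth in [X]. *)
Lemma norm_bessel_coef b m x : 1 / 2 <= b ->
  `|bessel_coef b m * x ^+ m| <= (2 * `|x|) ^+ m / m`!%:R / m`!%:R.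
Proof.
move=> b2; have b0 : 0 < b by lra.
have p0 := poch_gt0 m b0.
rewrite normrM /bessel_coef normrM normrX normrN1 expr1n mul1r normfV.
rewrite [`|_ * poch _ _|]ger0_norm ?mulr_ge0// ?(ltW p0)// normrX exprMn.
rewrite mulrC [_ ^+ m * _]mulrC -!mulrA; apply: ler_wpM2l; first by rewrite exprn_ge0.
rewrite invfM mulrCA.
rewrite ler_wpM2l// -[leRHS]invrK invfM invrK lef_pV2 ?posrE//.
- by rewrite mulrC poch_ge_half.
Qed.

Lemma norm_bessel_coef_exp b m x : 1 / 2 <= b ->
  `|bessel_coef b m * x ^+ m| <= exp_coeff (2 * `|x|) m.
Proof.
move=> b2; apply: (le_trans (norm_bessel_coef m x b2)).
rewrite /exp_coeff/= ler_piMr ?divr_ge0 ?exprn_ge0 ?mulr_ge0//.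
by rewrite invf_le1 ?ltr0n ?fact_gt0// ler1n fact_gt0.
Qed.

Lemma is_cvg_bessel_ser b x : 1 / 2 <= b -> cvgn (pseries (bessel_coef b) x).
Proof.
move=> b2; apply: normed_cvg.
apply: (@series_le_cvg _ _ (exp_coeff (2 * `|x|))) => //.
- by move=> n /=.
- by move=> n; apply: exp_coeff_ge0; rewrite mulr_ge0.
- by move=> n; exact: norm_bessel_coef_exp.
- exact: is_cvg_series_exp_coeff.
Qed.

Lemma cvg_bessel_ser b x : 1 / 2 <= b ->
  pseries (bessel_coef b) x @ \oo --> bessel_ser b x.
Proof. exact: is_cvg_bessel_ser. Qed.

Lemma pseries_diffs_bessel_coef b : 0 < b ->
  pseries_diffs (bessel_coef b) = (fun m => - b^-1 * bessel_coef (b + 1) m).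
Proof.
move=> b0; apply/funext => m; rewrite /pseries_diffs /bessel_coef.
rewrite pochSl factS natrM exprS; field.
by rewrite !lt0r_neq0//= ?poch_gt0 ?ltr0n ?fact_gt0// ?addr_gt0// ltr0n.
Qed.

Lemma is_derive_bessel_ser b x : 1 / 2 <= b ->
  is_derive x (1 : R) (bessel_ser b) (- b^-1 * bessel_ser (b + 1) x).
Proof.
move=> b2; have b0 : 0 < b by lra.
have bb : 1 / 2 <= b + 1 by lra.
have bbb : 1 / 2 <= b + 1 + 1 by lra.
have pE c (k : R) y : pseries (fun m => k * bessel_coef c m) y =
    (fun n => k * pseries (bessel_coef c) y n).
  apply/funext => n; rewrite /pseries /series/= mulr_sumr.
  by apply: eq_bigr => i _; rewrite mulrA.
have -> : - b^-1 * bessel_ser (b + 1) x = limn (pseries (pseries_diffs (bessel_coef b)) x).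
  rewrite pseries_diffs_bessel_coef// pE; apply/esym/cvg_lim => //.
  by apply: cvgMr; exact: is_cvg_bessel_ser.
apply: (@pseries_snd_diffs _ _ (`|x| + 1)).
- exact: is_cvg_bessel_ser.
- rewrite pseries_diffs_bessel_coef// pE; apply: is_cvgMr.
  exact: is_cvg_bessel_ser.
- rewrite pseries_diffs_bessel_coef//.
  have -> : pseries_diffs (fun m => - b^-1 * bessel_coef (b + 1) m) =
      (fun m => - b^-1 * - (b + 1)^-1 * bessel_coef (b + 1 + 1) m).
    apply/funext => m; rewrite -[RHS]mulrA.
    have b1 : 0 < b + 1 by lra.
    have /(congr1 (@^~ m)) <- := pseries_diffs_bessel_coef b1.
    by rewrite /pseries_diffs mulrCA.
  by rewrite pE; apply: is_cvgMr; exact: is_cvg_bessel_ser.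
- by rewrite [ltRHS]ger0_norm ?addr_ge0// ltrDl.
Qed.

Lemma continuous_bessel_ser b : 1 / 2 <= b -> continuous (bessel_ser b).
Proof.
move=> b2 x; apply/differentiable_continuous/derivable1_diffP.
by have [] := is_derive_bessel_ser x b2.
Qed.

Lemma bessel_ser0 b : bessel_ser b 0 = 1.
Proof.
apply: lim_near_cst => //; near=> n.
 have n0 : (0 < n)%N by near: n; exists 1%N.
rewrite /pseries/= /series/= -(prednK n0).
rewrite big_nat_recl// big1 => [|i _].
  by rewrite /bessel_coef poch0 !expr0 mulr1 addr0 mulr1 fact0 divr1.
by rewrite exprS mul0r mulr0.
Unshelve. all: by end_near. Qed.

(** This is Bessel's equation [x F'' + b F' + F = 0], with the derivatives of [F] replaced by the
    series of parameters [b + 1] and [b + 2] according to [is_derive_bessel_ser]. *)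
Lemma bessel_ser_ode b x : 1 / 2 <= b ->
  x / (b * (b + 1)) * bessel_ser (b + 1 + 1) x = bessel_ser (b + 1) x - bessel_ser b x.
Proof.
move=> b2; have b0 : 0 < b by lra.
have bb : 1 / 2 <= b + 1 by lra.
have bbb : 1 / 2 <= b + 1 + 1 by lra.
have c0 := @cvg_bessel_ser b x b2; have c1 := @cvg_bessel_ser (b + 1) x bb.
have c2 := @cvg_bessel_ser (b + 1 + 1) x bbb.
have h : (pseries (bessel_coef (b + 1)) x - pseries (bessel_coef b) x) n
    @[n --> \oo] --> bessel_ser (b + 1) x - bessel_ser b x by exact: cvgB.
(* The constant terms of the two series on the right cancel; after a shift by one, the partial sums
   agree term by term. *)
rewrite -(cvg_lim _ h)//; apply/esym/cvg_lim => //; rewrite -cvg_shiftS/=.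
have -> : (fun n => (pseries (bessel_coef (b + 1)) x - pseries (bessel_coef b) x) n.+1)
   = (fun n => x / (b * (b + 1)) * pseries (bessel_coef (b + 1 + 1)) x n).
  apply/funext => n; rewrite /pseries /series/= fctE/= -sumrB mulr_sumr.
  rewrite big_nat_recl//= /bessel_coef !poch0 subrr add0r.
  apply: eq_bigr => i _.
  have p0 : poch (b + 1 + 1) i != 0 by rewrite lt0r_neq0// poch_gt0//; lra.
  have i0 : b + 1 + i%:R != 0 by rewrite lt0r_neq0// ltr_pwDl//; lra.
  have -> : poch b i.+1 = b * (b + 1) * poch (b + 1 + 1) i / (b + 1 + i%:R).
    have := pochSl (b + 1) i; rewrite pochS pochSl => h1.
    by apply: (mulIf i0); rewrite divfK// -!mulrA h1.
  rewrite pochSl factS natrM exprS -natr1.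
  rewrite exprS; field; rewrite i0 p0 !lt0r_neq0//= ?ltr_pwDr//; lra.
by apply: cvgMr.
Qed.

(* [bessel_ser b t ^+ 2 + t * bessel_ser (b + 1) t ^+ 2 / b ^+ 2] is the energy
   of the Bessel equation; it is nonincreasing exactly when [1 / 2 <= b]. *)
Lemma bessel_ser_le1 b x : 1 / 2 <= b -> 0 <= x -> `|bessel_ser b x| <= 1.
Proof.
move=> b2 x0; have b0 : 0 < b by lra.
have bb : 1 / 2 <= b + 1 by lra.
have bbb : 1 / 2 <= b + 1 + 1 by lra.
pose E (t : R) := bessel_ser b t ^+ 2 + t * (b^-1 * bessel_ser (b + 1) t) ^+ 2.
have dE t : is_derive t (1 : R) E (bessel_ser (b + 1) t ^+ 2 * (1 - 2 * b) / b ^+ 2).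
  have d1 := is_derive_bessel_ser t b2; have d2 := is_derive_bessel_ser t bb.
  apply: is_derive_eq.
  rewrite /GRing.scale/=.
  have ode := bessel_ser_ode t b2.
  have b1 : 0 < b + 1 by lra.
  set f := bessel_ser b t; set g := bessel_ser (b + 1) t.
  set h := bessel_ser (b + 1 + 1) t in ode *.
  transitivity (- (2 * f * g) / b - 2 * g / b * (t / (b * (b + 1)) * h) +
      g ^+ 2 / b ^+ 2); first by field; rewrite !lt0r_neq0.
  by rewrite ode -/f -/g; field; rewrite lt0r_neq0.
suff : E x <= E 0.
  rewrite /E bessel_ser0 mul0r addr0 expr1n -(real_normK (num_real _)) => h.
  rewrite -(@ler_pXn2r _ 2) ?nnegrE// expr1n (le_trans _ h)// lerDl.
  by rewrite mulr_ge0// sqr_ge0.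
apply: (@ler0_derive1_nincry _ E 0) => //.
- move=> t _; rewrite derive1E; have [_ ->] := dE t.
  rewrite -mulrA mulr_ge0_le0 ?sqr_ge0// mulr_le0_ge0 ?invr_ge0 ?sqr_ge0//; lra.
- apply: continuous_subspaceT => t.
  apply/differentiable_continuous/derivable1_diffP.
  by case: (dE t).
Qed.

(** This is [k!] times the Laguerre polynomial of degree [k] and order [b - 1], in the form in which
    [poch_vandermonde] produces it. *)
Definition laguerre_rising b k y : R :=
  \sum_(j < k.+1) 'C(k, j)%:R * ((- y) ^+ j * poch (b + j%:R) (k - j)).

(** The falling factorial kills the terms with [m < j] and cancels against [m!] in the others, which
    leaves the exponential series shifted by [j]. *)
Lemma cvg_falling_exp j y :
  series (fun m => (m ^_ j)%:R * exp_coeff y m) n @[n --> \oo] --> y ^+ j * expR y.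
Proof.
rewrite -(cvg_shiftn j)/=.
have -> : (fun n => series (fun m => (m ^_ j)%:R * exp_coeff y m) (n + j)%N) =
   (fun n => y ^+ j * series (exp_coeff y) n).
    apply/funext => n; rewrite /series/= mulr_sumr -{1}(add0n j).
  rewrite (big_cat_nat _ (n := j))//= ?leq_addl//.
  rewrite big_nat big1 ?add0r => [|i /andP[_ ij]]; last by rewrite ffact_small ?mul0r.
  rewrite -{1}(add0n j) big_addn addnK; apply: eq_bigr => i _.
  rewrite /exp_coeff/= exprD -(@ffact_fact (i + j) j) ?leq_addl// addnK natrM.
  have i0 : i`!%:R != 0 :> R by rewrite lt0r_neq0 ?ltr0n ?fact_gt0.
  have ij0 : ((i + j) ^_ j)%:R != 0 :> R.
    by rewrite lt0r_neq0 ?ltr0n ?ffact_gt0 ?leq_addl.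
  by field; rewrite ij0 i0.
by apply: cvgMr; exact: is_cvg_series_exp_coeff.
Qed.

(** By [poch_vandermonde] the series is a finite combination of those of [cvg_falling_exp]. It is
    what termwise integration of the Bessel kernel against [X^k e^{-X}] yields. *)
Lemma cvg_poch_exp b k y :
  series (fun m => exp_coeff (- y) m * poch (b + m%:R) k) n @[n --> \oo]
  --> laguerre_rising b k y * expR (- y).
Proof.
rewrite (_ : series _ = fun n => \sum_(j < k.+1) 'C(k, j)%:R *
   (poch (b + j%:R) (k - j) * series (fun m => (m ^_ j)%:R * exp_coeff (- y) m) n)).
  rewrite /laguerre_rising mulr_suml; apply: cvg_big => [|j _]; first exact: add_continuous.
  rewrite -mulrA; apply: cvgMr; rewrite [_ * poch _ _]mulrC -mulrA; apply: cvgMr.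
  exact: cvg_falling_exp.
apply/funext => n; rewrite /series/=.
under eq_bigr do rewrite poch_vandermonde mulr_sumr.
rewrite exchange_big/=; apply: eq_bigr => j _.
rewrite !mulr_sumr; apply: eq_bigr => m _; ring.
Qed.

End bessel_series.

(** * The Gamma function *)

Section half_line.
Context {R : realType}.
Local Notation mu := (@lebesgue_measure R).
Implicit Types (f F : R -> R) (u v : R^nat).
Lemma itv_oy_bigcup u v :
  (forall n, 0 < u n) -> u @ \oo --> 0 -> v @ \oo --> +oo ->
  `]0%R, +oo[%classic = \bigcup_n `[u n, v n]%classic.
Proof.
move=> u0 cu cv; apply/seteqP; split=> [x|x [n _]]/=.
  rewrite in_itv/= andbT => x0.
  suff : \forall n \near \oo, u n <= x <= v n.
    by move=> [N _ /(_ N (leqnn _))] h; exists N => //=; rewrite in_itv.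
  near=> n; apply/andP; split; near: n.
    by move/cvgr_le : cu; apply.
  by move/cvgryPge : cv; exact.
by rewrite !in_itv/= andbT => /andP[+ _]; exact: lt_le_trans.
Unshelve. all: by end_near. Qed.

Lemma measurable_continuous_oy f : {in `]0, +oo[, continuous f} ->
  measurable_fun (`]0%R, +oo[ : set R) (EFin \o f).
Proof.
move=> cf; apply/measurable_EFinP; apply: open_continuous_measurable_fun; first exact: rray_open.
by move=> x; rewrite inE/=; exact: cf.
Qed.

(** Monotone convergence along compact intervals inside the open half-line; integration by parts and
    substitution are carried out on these intervals, away from the singularity of [t ^ p] at [0]. *)
Lemma cvg_integral_oy f u v :
  {in `]0, +oo[, continuous f} -> (forall x, 0 < x -> 0 <= f x) ->
  (forall n, 0 < u n) -> nonincreasing_seq u -> nondecreasing_seq v ->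
  u @ \oo --> 0 -> v @ \oo --> +oo ->
  (\int[mu]_(x in `[u n, v n]) (f x)%:E)%E @[n --> \oo] -->
  (\int[mu]_(x in `]0%R, +oo[) (f x)%:E)%E.
Proof.
move=> cf f0 u0 ndu ndv cu cv.
have mf : measurable_fun (`]0%R, +oo[ : set R) (EFin \o f).
  exact: measurable_continuous_oy.
rewrite (itv_oy_bigcup u0 cu cv); apply: ge0_nondecreasing_set_cvg_integral.
- move=> m n mn; apply/subsetPset => x/=; rewrite !in_itv/= => /andP[ux xv].
  by rewrite (le_trans (ndu _ _ mn) ux) (le_trans xv (ndv _ _ mn)).
- by [].
- move=> n; apply: measurable_funS mf => // x/=.
  by rewrite !in_itv/= andbT => /andP[+ _]; exact: lt_le_trans.
- move=> n x/=; rewrite in_itv/= => /andP[ux _].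
  by rewrite lee_fin f0// (lt_le_trans (u0 n)).
Qed.

Lemma derivable_LRcontinuous F a b : a < b ->
  {in `[a, b], forall x, derivable F x 1} -> derivable_oo_LRcontinuous F a b.
Proof.
move=> ab dF; have cF x : x \in `[a, b] -> F y @[y --> x] --> F x.
  by move=> /dF /derivable1_diffP/differentiable_continuous.
split.
- by move=> x xab; apply: dF; exact: subset_itv_oo_cc.
- by apply/cvg_at_right_filter/cF; rewrite in_itv/= lexx ltW.
- by apply/cvg_at_left_filter/cF; rewrite in_itv/= lexx ltW.
Qed.

Lemma continuous_itvcc_within (df : R -> R) (a b : R) :
  {in `[a, b], continuous df} -> {within `[a, b], continuous df}.
Proof.
by move=> c; apply: continuous_in_subspaceT => x; rewrite inE; exact: c.
Qed.

Lemma derivable_powRr p (x : R) : 0 < x -> derivable (fun t : R => t `^ p) x 1.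
Proof. by move=> x0; have [] := is_derive1_powR p x0. Qed.

Lemma continuous_powRr p (x : R) : 0 < x -> {for x, continuous (fun t : R => t `^ p)}.
Proof.
by move=> x0; apply/differentiable_continuous/derivable1_diffP/derivable_powRr.
Qed.

End half_line.

Section Gamma_theory.
Context {R : realType}.
Local Notation mu := (@lebesgue_measure R).
Implicit Types (p t x : R).

Let Gamma_fun p t := t `^ (p - 1) * expR (- t).
Let eGamma p := (\int[mu]_(t in `]0%R, +oo[) (Gamma_fun p t)%:E)%E.

Lemma Gamma_fun_ge0 p t : 0 <= Gamma_fun p t.
Proof. by rewrite mulr_ge0 ?powR_ge0 ?expR_ge0. Qed.

Lemma continuous_expRN t : {for t, continuous (fun t : R => expR (- t))}.
Proof.
apply: (@continuous_comp _ _ _ -%R expR); first exact: opp_continuous.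
exact: continuous_expR.
Qed.

Lemma continuous_Gamma_fun p t : 0 < t -> {for t, continuous (Gamma_fun p)}.
Proof.
move=> t0; apply: continuousM; first exact: continuous_powRr.
exact: continuous_expRN.
Qed.

Lemma continuous_expRNM c t : {for t, continuous (fun t : R => expR (- (c * t)))}.
Proof.
apply: (@continuous_comp _ _ _ ( *%R c) (fun t => expR (- t))).
  exact: mulrl_continuous.
exact: continuous_expRN.
Qed.

Let mGamma_fun p : measurable_fun (`]0%R, +oo[ : set R) (EFin \o Gamma_fun p).
Proof.
apply: measurable_continuous_oy => x.
by rewrite in_itv/= andbT; exact: continuous_Gamma_fun.
Qed.

Lemma eGamma_ge0 p : (0 <= eGamma p)%E.
Proof. by apply: integral_ge0 => t _; rewrite lee_fin Gamma_fun_ge0. Qed.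

Lemma cvg_powR_expRN p : 0 < p -> (n.+1%:R `^ p * expR (- n.+1%:R)) @[n --> \oo] --> (0 : R).
Proof.
move=> p0; pose N := Num.bound p.
apply: (@squeeze_cvgr _ _ _ _ (cst 0) (fun n : nat => N.+1`!%:R * n.+1%:R^-1)).
- near=> n; rewrite mulr_ge0 ?powR_ge0 ?expR_ge0//= expRN.
  rewrite ler_pdivrMr ?expR_gt0// mulrAC ler_pdivlMr//.
  have := @expR_ge1Dxn _ n.+1%:R N (ler0n _ _) => h.
  have {}h : n.+1%:R ^+ N.+1 <= N.+1`!%:R * expR n.+1%:R :> R.
    rewrite mulrC -ler_pdivrMr ?ltr0n ?fact_gt0//.
    by apply: le_trans (h R); rewrite lerDr.
  apply: le_trans h; rewrite exprSr ler_wpM2r// -powR_mulrn// ler_powR//.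
    by rewrite ler1n.
  by rewrite ltW// archi_boundP// ltW.
- exact: cvg_cst.
- rewrite -[X in _ --> X](mulr0 (N.+1`!%:R)); apply: cvgMr.
  exact: cvg_harmonic.
Unshelve. all: by end_near. Qed.

Lemma cvg_nat_pinfty : n.+1%:R @[n --> \oo] --> (+oo : set_system R).
Proof. by rewrite cvg_shiftS; exact: cvgr_idn. Qed.

(** Stated for extended reals, so that finiteness is not presupposed: [eGamma_lty] deduces
    finiteness at [p] from finiteness at [p + 1]. *)
Lemma eGammaS p : 0 < p -> eGamma (p + 1) = (p%:E * eGamma p)%E.
Proof.
move=> p0.
(* The endpoints lie on either side of [1] for every [n], which makes each interval nondegenerate;
   the boundary terms vanish at both ends. *)
pose u (n : nat) : R := n.+2%:R^-1; pose v (n : nat) : R := n.+1%:R + 1.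
have u0 n : 0 < u n by rewrite invr_gt0.
have uv n : u n < v n.
  apply: (@le_lt_trans _ _ 1); first by rewrite invf_le1// ler1n.
  by rewrite ltrDr.
have ndu : nonincreasing_seq u.
  by move=> m n mn; rewrite lef_pV2 ?posrE// ler_nat.
have ndv : nondecreasing_seq v.
  by move=> m n mn; rewrite lerD2r ler_nat.
have cu : u @ \oo --> 0 by rewrite (cvg_shiftS (@harmonic R : R^nat)); exact: cvg_harmonic.
have cv : v @ \oo --> +oo.
  have -> : v = (fun n : nat => n.+2%:R) by apply/funext => n; rewrite /v natr1.
  by rewrite (cvg_shiftS (fun n : nat => n.+1%:R : R)); exact: cvg_nat_pinfty.
have dexp (x : R) : is_derive x (1 : R) (fun t => - expR (- t)) (expR (- x)).
  apply: is_derive_eq; rewrite /GRing.scale/=; ring.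
have itv0 n x : x \in `[u n, v n] -> 0 < x.
  by rewrite in_itv/= => /andP[+ _]; exact: lt_le_trans.
have c1 q : (\int[mu]_(x in `[u n, v n]) (Gamma_fun q x)%:E)%E @[n --> \oo] -->
    eGamma q.
  apply: cvg_integral_oy => // [x|x _]; last exact: Gamma_fun_ge0.
  by rewrite in_itv/= andbT; exact: continuous_Gamma_fun.
have parts n : (\int[mu]_(x in `[u n, v n]) (Gamma_fun (p + 1) x)%:E =
    (u n `^ p * expR (- u n) - v n `^ p * expR (- v n))%:E +
    p%:E * \int[mu]_(x in `[u n, v n]) (Gamma_fun p x)%:E)%E.
  rewrite /Gamma_fun addrK.
  rewrite (@integration_by_parts R (fun t => t `^ p) (fun t => - expR (- t))
    (fun t => p * t `^ (p - 1)) (fun t => expR (- t)) (u n) (v n) (uv n)) => //.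
  - rewrite !mulrN opprK [(- _ + _)%R]addrC; congr (_ + _)%E.
    under eq_integral do rewrite mulrN -mulrA EFinN EFinM.
    have m1 : measurable_fun (`[u n, v n] : set R) (EFin \o Gamma_fun p).
      by apply: measurable_funS (mGamma_fun p) => // x/= /itv0; rewrite in_itv/= andbT.
    rewrite integral_ge0N => [|x _]; last first.
      by rewrite -EFinM lee_fin mulr_ge0 ?(ltW p0)// Gamma_fun_ge0.
    rewrite oppeK ge0_integralZl_EFin// ?ltW// => x _.
    by rewrite lee_fin Gamma_fun_ge0.
  - apply: continuous_itvcc_within => x /itv0 x0.
    by apply: cvgMr; exact: continuous_powRr.
  - by apply: derivable_LRcontinuous => // x /itv0; exact: derivable_powRr.
  - move=> x /subset_itv_oo_cc /itv0 x0.
    by rewrite derive1E; have [_ ->] := is_derive1_powR p x0.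
  - by apply: continuous_subspaceT => x; exact: continuous_expRN.
  - apply: derivable_LRcontinuous; first exact: uv.
    by move=> x _; have [] := dexp x.
  - by move=> x _; rewrite derive1E; have [_ ->] := dexp x.
have c2 : (u n `^ p * expR (- u n) - v n `^ p * expR (- v n))%:E @[n --> \oo] --> 0%:E.
  apply: cvg_EFin; first by near=> n.
  rewrite -[X in _ --> X](subr0 0); apply: cvgB.
    rewrite -[X in _ --> X](mul0r 1); apply: cvgM.
      have h := @powR_cvg0 R p p0.
      move/cvg_at_rightP : h; apply; split => //.
    rewrite -expR0 -oppr0.
    apply: (@cvg_comp _ _ _ u (fun t : R => expR (- t)) _ (nbhs (0 : R))).
      exact: cu.
    exact: (@continuous_expRN 0).
  have -> : (fun n => v n `^ p * expR (- v n)) =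
    (fun n => n.+2%:R `^ p * expR (- n.+2%:R)).
    by apply/funext => n; rewrite /v natr1.
  by rewrite (cvg_shiftS (fun n => n.+1%:R `^ p * expR (- n.+1%:R) : R)); exact: cvg_powR_expRN.
have c3 := c1 (p + 1).
have c4 : (p%:E * \int[mu]_(x in `[u n, v n]) (Gamma_fun p x)%:E)%E @[n --> \oo] -->
    (p%:E * eGamma p)%E by apply: cvgeZl.
apply: (cvg_unique _ c3) => //.
have -> : (fun n => \int[mu]_(x in `[u n, v n]) (Gamma_fun (p + 1) x)%:E)%E =
  (fun n => (u n `^ p * expR (- u n) - v n `^ p * expR (- v n))%:E +
    p%:E * \int[mu]_(x in `[u n, v n]) (Gamma_fun p x)%:E)%E.
  by apply/funext => n; exact: parts.
rewrite -(add0e (p%:E * eGamma p)%E).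
by apply: (cvgeD _ c2 c4); rewrite fin_num_adde_defr.
Unshelve. all: by end_near. Qed.

Lemma integral_expRN (c : R) : 0 < c ->
  (\int[mu]_(t in `]0%R, +oo[) (expR (- (c * t)))%:E = c^-1%:E)%E.
Proof.
move=> c0.
have ce x := @continuous_expRNM c x.
rewrite integral_itv_obnd_cbnd; last first.
  by apply: measurable_continuous_oy => x _; exact: ce.
have de x : is_derive x (1 : R) (fun t : R => - c^-1 * expR (- (c * t))) (expR (- (c * x))).
  apply: is_derive_eq; rewrite /GRing.scale/=; field; exact: lt0r_neq0.
rewrite (@ge0_continuous_FTC2y _ _ (fun t : R => - c^-1 * expR (- (c * t))) _ 0).
- by rewrite mulr0 oppr0 expR0 mulr1 -EFinB sub0r opprK.
- by move=> x _; exact: expR_ge0.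
- exact: continuous_subspaceT.
- rewrite -[X in _ --> X](mulr0 (- c^-1)); apply: cvgMr.
  apply: (cvg_comp (fun t => c * t) (fun t => expR (- t))); last exact: cvgr_expR.
  by apply: gt0_cvgMry.
- by move=> x _; apply: ex_derive.
- by apply: cvg_at_right_filter; apply: cvgMr; exact: ce.
- by move=> x _; rewrite derive1E; have [_ ->] := de x.
Qed.

Lemma eGamma_lty p : 0 < p -> (eGamma p < +oo)%E.
Proof.
suff h q : 1 <= q -> (eGamma q < +oo)%E.
  move=> p0; have := h (p + 1); rewrite lerDr ltW// eGammaS// => /(_ isT).
  have := eGamma_ge0 p; case: (eGamma p) => // [r|] _; first by move=> _; exact: ltry.
  by rewrite mulry gtr0_sg// mul1e.
move=> q1; pose N := Num.bound q.
(* The summand [1] bounds [t^(q-1)] for [t <= 1]. For [t > 1] one has [t^(q-1) <= t^(N+1)], and the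
   other summand times [e^{t/2}] bounds this power; half of the exponential decay is left for the
   integral. *)
pose C : R := 1 + N.+1`!%:R * 2 ^+ N.+1.
have C0 : 0 <= C by rewrite addr_ge0// mulr_ge0// exprn_ge0.
apply: (@le_lt_trans _ _ (\int[mu]_(t in `]0%R, +oo[) (C%:E * (expR (- (2^-1 * t)))%:E))%E).
  apply: ge0_le_integral => //.
  - by move=> t _; rewrite lee_fin Gamma_fun_ge0.
  - exact: mGamma_fun.
  - apply: measurable_funeM; apply: measurable_continuous_oy => x _.
    exact: continuous_expRNM.
  move=> t/=; rewrite in_itv/= andbT => t0; rewrite -EFinM lee_fin /Gamma_fun.
  have -> : expR (- t) = expR (- (2^-1 * t)) * expR (- (2^-1 * t)).
    by rewrite -expRD; congr expR; field.
  rewrite mulrA ler_wpM2r ?expR_ge0//.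
  rewrite expRN ler_pdivrMr ?expR_gt0//.
  have e2 : 0 <= 2 ^+ N.+1 :> R by exact: exprn_ge0.
  have e1 : 1 <= expR (2^-1 * t) by rewrite -expR0 ler_expR mulr_ge0// ltW.
  have [t1|t1] := leP t 1.
    apply: (@le_trans _ _ 1).
      apply: (@le_trans _ _ (1 `^ (q - 1))); last by rewrite powR1.
      by rewrite ge0_ler_powR ?nnegrE ?subr_ge0// ltW.
    by rewrite mulr_ege1// /C lerDl mulr_ge0// exprn_ge0.
  apply: (@le_trans _ _ (t `^ N.+1%:R)).
    rewrite ler_powR ?(ltW t1)// lerBlDr (le_trans (ltW (archi_boundP _)))//.
      exact: le_trans q1.
    by rewrite natr1 ler_nat -addn2 leq_addr.
  rewrite powR_mulrn ?(ltW t0)//.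
  have := @expR_ge1Dxn R (2^-1 * t) N; rewrite mulr_ge0 ?(ltW t0)// => /(_ isT) h.
  apply: (@le_trans _ _ (N.+1`!%:R * 2 ^+ N.+1 * expR (2^-1 * t))).
    apply: (@le_trans _ _ (N.+1`!%:R * 2 ^+ N.+1 * ((2^-1 * t) ^+ N.+1 / N.+1`!%:R))).
      rewrite exprMn exprVn le_eqVlt; apply/orP; left; apply/eqP; field.
      by rewrite lt0r_neq0 ?ltr0n ?fact_gt0// lt0r_neq0 ?exprn_gt0.
    apply: ler_wpM2l; first exact: mulr_ge0.
    by apply: le_trans h; rewrite lerDr.
  by rewrite ler_wpM2r ?expR_ge0// /C lerDr.
have eh : (0 : R) < 2^-1 by [].
rewrite ge0_integralZl_EFin//.
- by rewrite integral_expRN// -EFinM ltry.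
- apply: measurable_continuous_oy => x _.
  exact: continuous_expRNM.
Qed.

Lemma EFin_Gamma p : 0 < p ->
  ((Gamma p)%:E = \int[mu]_(t in `]0%R, +oo[) (t `^ (p - 1) * expR (- t))%:E)%E.
Proof.
by move=> p0; rewrite /Gamma /Rintegral fineK// ge0_fin_numE ?eGamma_ge0// eGamma_lty.
Qed.

Lemma GammaS p : 0 < p -> Gamma (p + 1) = p * Gamma p.
Proof.
move=> p0; apply: EFin_inj; rewrite EFinM !EFin_Gamma ?addr_gt0//; exact: eGammaS.
Qed.

Lemma Gamma1 : Gamma (1 : R) = 1.
Proof.
apply: EFin_inj; rewrite EFin_Gamma// subrr.
under eq_integral do rewrite powRr0 mul1r -[X in - X]mul1r.
by rewrite integral_expRN// invr1.
Qed.

Lemma Gamma_gt0 p : 0 < p -> 0 < Gamma p.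
Proof.
move=> p0; rewrite -lte_fin EFin_Gamma//.
(* A lower bound of the integrand on [[1, 2]], where [0 <= ln t <= 1] and [t <= 2]. *)
pose c := expR (- (`|p - 1| + 2)).
apply: (@lt_le_trans _ _ (\int[mu]_(t in `[1%R, 2%R]) (cst c%:E t))%E).
  rewrite integral_cst//= lebesgue_measure_itv/= lte_fin ltr1n -EFinB -EFinM lte_fin.
  by rewrite mulr_gt0 ?expR_gt0//; lra.
have s12 : `[1%R, 2%R] `<=` (`]0%R, +oo[ : set R).
  by move=> t/=; rewrite !in_itv/= andbT => /andP[+ _]; exact: lt_le_trans.
apply: (@le_trans _ _ (\int[mu]_(t in `[1%R, 2%R]) (Gamma_fun p t)%:E)%E); last first.
  apply: ge0_subset_integral => //; first exact: mGamma_fun.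
  by move=> t _; rewrite lee_fin; exact: Gamma_fun_ge0.
apply: ge0_le_integral => //.
- by move=> t _; rewrite lee_fin expR_ge0.
- exact: measurable_funS (mGamma_fun p).
move=> t/=; rewrite in_itv/= => /andP[t1 t2].
have t0 : 0 < t by exact: lt_le_trans t1.
rewrite lee_fin /Gamma_fun /powR gt_eqF// -expRD ler_expR opprD lerD ?lerN2//.
rewrite -normrN -lerN2 opprK; apply: (@le_trans _ _ (`|- (p - 1)| * ln t)).
  by rewrite -mulNr ler_wpM2r ?ln_ge0// ler_norm.
rewrite ler_piMr//; have := @le_ln1Dx R (t - 1); rewrite addrCA subrr addr0 => h.
by apply: le_trans (h _) _; lra.
Qed.

Lemma Gamma_nat n : Gamma (n.+1%:R : R) = n`!%:R.
Proof.
elim: n => [|n IH]; first by rewrite Gamma1.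
by rewrite -[n.+2%:R]natr1 GammaS// IH factS natrM.
Qed.

End Gamma_theory.

(** * Orthonormal series in L^2 *)

Section square_integrable.
Context d (T : measurableType d) (R : realType) (mu : {measure set T -> \bar R}).
Implicit Types (f g h : T -> R) (c : R).
Definition sqint f :=
  measurable_fun setT f /\ (\int[mu]_x (f x ^+ 2)%:E < +oo)%E.

Definition ip f g : R := \int[mu]_x (f x * g x).

Lemma sqint_mul f g : sqint f -> sqint g ->
  mu.-integrable setT (EFin \o (fun x => f x * g x)).
Proof.
move=> [mf f2] [mg g2].
have h : mu.-integrable setT (fun x => (f x ^+ 2)%:E + (g x ^+ 2)%:E)%E.
  apply: integrableD => //; apply/integrableP; split.
  - by apply/measurable_EFinP; exact: measurable_funX.
  - by under eq_integral do rewrite gee0_abs ?lee_fin ?sqr_ge0//.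
  - by apply/measurable_EFinP; exact: measurable_funX.
  - by under eq_integral do rewrite gee0_abs ?lee_fin ?sqr_ge0//.
apply: le_integrable h => //; first by apply/measurable_EFinP; exact: measurable_funM.
move=> x _; rewrite /= lee_fin.
rewrite [leRHS]ger0_norm ?addr_ge0 ?sqr_ge0//; rewrite ler_norml; apply/andP; split.
  by have := sqr_ge0 (f x + g x); have := sqr_ge0 (f x); have := sqr_ge0 (g x); nra.
by have := sqr_ge0 (f x - g x); have := sqr_ge0 (f x); have := sqr_ge0 (g x); nra.
Qed.

Lemma sqint_integrable f : sqint f -> mu.-integrable setT (EFin \o (fun x => f x ^+ 2)).
Proof. by move=> hf; exact: (sqint_mul hf hf). Qed.

Lemma integrable_sqint f : measurable_fun setT f ->
  mu.-integrable setT (EFin \o (fun x => f x ^+ 2)) -> sqint f.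
Proof.
move=> mf /integrableP[_ h]; split=> //; move: h.
by under eq_integral do rewrite /= ger0_norm ?sqr_ge0//.
Qed.

Lemma sqint0 : sqint (fun=> 0).
Proof.
split; first exact: measurable_cst.
by under eq_integral do rewrite expr0n/=; rewrite integral0.
Qed.

Lemma sqintZ c f : sqint f -> sqint (fun x => c * f x).
Proof.
move=> hf; apply: integrable_sqint; first by apply: measurable_funM => //; case: hf.
have -> : EFin \o (fun x => (c * f x) ^+ 2) = (fun x => (c ^+ 2)%:E * (f x ^+ 2)%:E)%E.
  by apply/funext => x /=; rewrite exprMn EFinM.
by apply: integrableZl => //; exact: sqint_integrable.
Qed.

Lemma sqintD f g : sqint f -> sqint g -> sqint (fun x => f x + g x).
Proof.
move=> hf hg; apply: integrable_sqint; first by apply: measurable_funD; [case: hf|case: hg].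
have -> : EFin \o (fun x => (f x + g x) ^+ 2) =
   (fun x => (f x ^+ 2)%:E + ((g x ^+ 2)%:E + 2%:E * (f x * g x)%:E))%E.
  by apply/funext => x /=; rewrite -!EFinD; congr EFin; ring.
apply: integrableD => //; first exact: sqint_integrable.
apply: integrableD => //; first exact: sqint_integrable.
by apply: integrableZl => //; exact: sqint_mul.
Qed.

Lemma sqintB f g : sqint f -> sqint g -> sqint (fun x => f x - g x).
Proof.
move=> hf hg; have := sqintD hf (sqintZ (-1) hg).
by rewrite (_ : (fun x => _ + -1 * _) = (fun x => f x - g x))//; apply/funext => x; rewrite mulN1r.
Qed.

Lemma sqint_sum (F : nat -> T -> R) n : (forall i, sqint (F i)) ->
  sqint (fun x => \sum_(i < n) F i x).
Proof.
move=> hF; elim: n => [|n IH].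
  by under eq_fun do rewrite big_ord0; exact: sqint0.
by under eq_fun do rewrite big_ord_recr/=; exact: sqintD.
Qed.

Lemma ipC f g : ip f g = ip g f.
Proof. by rewrite /ip; congr fine; apply: eq_integral => x _; rewrite mulrC. Qed.

Lemma ipZl c f g : sqint f -> sqint g -> ip (fun x => c * f x) g = c * ip f g.
Proof.
move=> hf hg; rewrite /ip; under eq_Rintegral do rewrite -mulrA.
by rewrite RintegralZl//; exact: sqint_mul.
Qed.

Lemma ipDl f g h : sqint f -> sqint g -> sqint h ->
  ip (fun x => f x + g x) h = ip f h + ip g h.
Proof.
move=> hf hg hh; rewrite /ip; under eq_Rintegral do rewrite mulrDl.
by rewrite RintegralD//; exact: sqint_mul.
Qed.

Lemma ipBl f g h : sqint f -> sqint g -> sqint h ->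
  ip (fun x => f x - g x) h = ip f h - ip g h.
Proof.
move=> hf hg hh; rewrite -mulN1r -ipZl// -ipDl//; last exact: sqintZ.
by congr ip; apply/funext => x; rewrite mulN1r.
Qed.

Lemma ipDr f g h : sqint f -> sqint g -> sqint h ->
  ip h (fun x => f x + g x) = ip h f + ip h g.
Proof. by move=> hf hg hh; rewrite ipC ipDl// !(ipC h). Qed.

Lemma ipBr f g h : sqint f -> sqint g -> sqint h ->
  ip h (fun x => f x - g x) = ip h f - ip h g.
Proof. by move=> hf hg hh; rewrite ipC ipBl// !(ipC h). Qed.

Lemma ip_suml (F : nat -> T -> R) n g : (forall i, sqint (F i)) -> sqint g ->
  ip (fun x => \sum_(i < n) F i x) g = \sum_(i < n) ip (F i) g.
Proof.
move=> hF hg; elim: n => [|n IH].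
  rewrite big_ord0 /ip; under eq_Rintegral do rewrite big_ord0 mul0r.
  by rewrite /Rintegral integral0.
under [X in ip X _]eq_fun do rewrite big_ord_recr/=.
by rewrite big_ord_recr/= ipDl ?IH//; exact: sqint_sum.
Qed.

Lemma ipE f : sqint f -> (ip f f)%:E = (\int[mu]_x (f x ^+ 2)%:E)%E.
Proof.
move=> hf; rewrite /ip /Rintegral fineK//.
by apply: integrable_fin_num => //; exact: sqint_integrable.
Qed.

Lemma ip_ge0 f : 0 <= ip f f.
Proof. by apply: Rintegral_ge0 => x _; rewrite -expr2 sqr_ge0. Qed.

Lemma ip_norm2D f g : sqint f -> sqint g ->
  ip (fun x => f x + g x) (fun x => f x + g x) <= 2 * ip f f + 2 * ip g g.
Proof.
move=> hf hg; have := ip_ge0 (fun x => f x - g x).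
rewrite ipBl//; last exact: sqintB.
rewrite ipDl//; last exact: sqintD.
by rewrite !ipBr// !ipDr// (ipC g f); lra.
Qed.

Lemma ip_norm2B f g : sqint f -> sqint g ->
  ip (fun x => f x - g x) (fun x => f x - g x) <= 2 * ip f f + 2 * ip g g.
Proof.
move=> hf hg; have := ip_norm2D hf (sqintZ (-1) hg).
rewrite ipZl//; last exact: sqintZ.
rewrite (ipC g) ipZl// !mulN1r opprK.
by rewrite (_ : (fun x => _ + -1 * _) = (fun x => f x - g x))//; apply/funext => x; rewrite mulN1r.
Qed.

(** Fatou's lemma applied to the squares; it replaces a norm limit by a pointwise one in
    [riesz_fischer]. *)
Lemma sqint_limit (u : nat -> T -> R) g : (forall x, (u n x) @[n --> \oo] --> g x) ->
  (forall n, sqint (u n)) -> forall l : R,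
  (ip (u n) (u n)) @[n --> \oo] --> l -> sqint g /\ ip g g <= l.
Proof.
move=> ug hu l ul.
have mg : measurable_fun setT g.
  by apply: (@measurable_fun_cvg _ _ _ setT u g) => // n; case: (hu n).
have : (\int[mu]_x (g x ^+ 2)%:E <= l%:E)%E.
  have -> : (\int[mu]_x (g x ^+ 2)%:E = \int[mu]_x limn_einf (fun n => (u n x ^+ 2)%:E))%E.
    apply: eq_integral => x _; apply/esym.
    have h : (u n x ^+ 2)%:E @[n --> \oo] --> (g x ^+ 2)%:E.
      by apply: cvg_EFin; [near=> n|apply: cvgM; exact: ug].
    by rewrite is_cvg_limn_einfE; [exact/cvg_lim|apply/cvg_ex; exists (g x ^+ 2)%:E].
  apply: (@le_trans _ _ (limn_einf (fun n => \int[mu]_x (u n x ^+ 2)%:E)%E)).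
    apply: fatou => //.
    by move=> n; apply/measurable_EFinP; apply: measurable_funX; case: (hu n).
    by move=> n x _; rewrite lee_fin sqr_ge0.
  have h : (\int[mu]_x (u n x ^+ 2)%:E)%E @[n --> \oo] --> l%:E.
    under eq_fun do rewrite -ipE//.
    by apply: cvg_EFin; [near=> n|exact: ul].
  rewrite is_cvg_limn_einfE; first by rewrite (cvg_lim _ h).
  by apply/cvg_ex; exists l%:E.
move=> gl; have hg : sqint g by split=> //; apply: le_lt_trans gl _; rewrite ltry.
by split=> //; rewrite -lee_fin ipE.
Unshelve. all: by end_near. Qed.

End square_integrable.

Section orthonormal_series.
Context d (T : measurableType d) (R : realType) (mu : {measure set T -> \bar R}).
Variable phi : nat -> T -> R.
Hypothesis phi2 : forall l, sqint mu (phi l).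
Hypothesis phi_orth : forall l m, ip mu (phi l) (phi m) = (l == m)%:R.
Implicit Types (c : nat -> R) (f : T -> R).

Definition psum c n (x : T) : R := \sum_(l < n) c l * phi l x.

Lemma sqint_psum c n : sqint mu (psum c n).
Proof.
by apply: (@sqint_sum _ _ _ _ (fun l x => c l * phi l x)) => i; exact: sqintZ.
Qed.

Lemma ip_psum_phi c n l : ip mu (psum c n) (phi l) = c l *+ (l < n).
Proof.
rewrite (@ip_suml _ _ _ _ (fun l x => c l * phi l x))//; last first.
  by move=> i; exact: sqintZ.
under eq_bigr do rewrite ipZl// phi_orth.
have [ln|nl] := ltnP l n.
  rewrite (bigD1 (Ordinal ln))//= eqxx mulr1 big1 ?addr0//.
  by move=> i /negP il; case: eqP => [e|]; rewrite ?mulr0//; case: il; apply/eqP/val_inj.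
by rewrite big1// => i _; rewrite (ltn_eqF (leq_trans (ltn_ord i) nl)) mulr0.
Qed.

Lemma ip_psum c n f : sqint mu f ->
  ip mu (psum c n) f = \sum_(l < n) c l * ip mu f (phi l).
Proof.
move=> hf; rewrite (@ip_suml _ _ _ _ (fun l x => c l * phi l x))//; last first.
  by move=> i; exact: sqintZ.
by apply: eq_bigr => i _; rewrite ipZl// ipC.
Qed.

Lemma ip_psum_psum c m n :
  ip mu (psum c m) (psum c n) = \sum_(l < minn m n) c l ^+ 2.
Proof.
wlog mn : m n / (m <= n)%N => [hw|].
  have [/hw//|] := boolP (m <= n)%N; rewrite -ltnNge => /ltnW/hw h.
  by rewrite ipC h minnC.
rewrite (minn_idPl mn) ip_psum; last exact: sqint_psum.
apply: eq_bigr => l _; rewrite ip_psum_phi expr2.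
by rewrite (leq_trans (ltn_ord l) mn).
Qed.

Lemma ip_psumB c m n : (m <= n)%N ->
  ip mu (fun x => psum c n x - psum c m x) (fun x => psum c n x - psum c m x) =
  \sum_(l < n) c l ^+ 2 - \sum_(l < m) c l ^+ 2.
Proof.
move=> mn; have hp k := sqint_psum c k.
rewrite ipBl// ?ipBr//; last exact: sqintB.
by rewrite !ip_psum_psum minnn (minn_idPr mn) (minn_idPl mn) minnn subrr subr0.
Qed.

Lemma ip_psumB_norm c m n :
  ip mu (fun x => psum c n x - psum c m x) (fun x => psum c n x - psum c m x) =
  `|\sum_(l < n) c l ^+ 2 - \sum_(l < m) c l ^+ 2|.
Proof.
wlog mn : m n / (m <= n)%N => [hw|].
  have [/hw//|/ltnW/hw h] := leqP m n; rewrite distrC -h /ip.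
  by apply: eq_Rintegral => x _; rewrite -!expr2 sqrrB; ring.
by rewrite -ip_psumB// ger0_norm// ip_ge0.
Qed.

Lemma bessel_inequality f n : sqint mu f ->
  \sum_(l < n) ip mu f (phi l) ^+ 2 <= ip mu f f.
Proof.
move=> hf; set c := fun l => ip mu f (phi l).
have hp := sqint_psum c n.
have := ip_ge0 mu (fun x => f x - psum c n x).
rewrite ipBl//; last exact: sqintB.
rewrite !ipBr// (ipC mu f (psum c n)) ip_psum_psum minnn ip_psum//.
have -> : \sum_(l < n) c l * ip mu f (phi l) = \sum_(l < n) c l ^+ 2.
  by apply: eq_bigr => l _; rewrite expr2.
by rewrite subrr subr0 subr_ge0.
Qed.

Lemma ip_phi_le f l : sqint mu f -> ip mu f (phi l) ^+ 2 <= ip mu f f.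
Proof.
move=> hf; apply: le_trans (bessel_inequality l.+1 hf).
by rewrite big_ord_recr/= lerDr sumr_ge0// => i _; rewrite sqr_ge0.
Qed.

(** Completeness of L^2 for orthonormal series. A subsequence of partial sums whose increments
    decrease geometrically in norm converges almost everywhere, and Fatou's lemma shows that its
    pointwise limit is the norm limit of the full sequence. *)
Lemma riesz_fischer c (M : R) : (forall n, \sum_(l < n) c l ^+ 2 <= M) ->
  exists g, sqint mu g /\
    (ip mu (fun x => psum c n x - g x) (fun x => psum c n x - g x)) @[n --> \oo] --> (0 : R).
Proof.
move=> cM; pose s n := \sum_(l < n) c l ^+ 2.
have nds : nondecreasing_seq s.
  move=> m n mn; rewrite /s -(subnKC mn) big_split_ord/= lerDl sumr_ge0// => i _.
  exact: sqr_ge0.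
have cs : cvgn s by apply: nondecreasing_is_cvgn => //; exists M => _ [n _ <-]; exact: cM.
set S := limn s in cs.
have sS n : s n <= S by exact: nondecreasing_cvgn_le.
have /choice[N NP] k : exists N, forall n, (N <= n)%N -> S - s n <= (2 ^+ k)^-1 ^+ 2.
  have e0 : 0 < ((2 : R) ^+ k)^-1 ^+ 2 by rewrite exprn_gt0// invr_gt0 exprn_gt0.
  have := cs; move=> /cvgrPdist_le/(_ _ e0)[N _ h]; exists N => n Nn.
  by apply: le_trans (h n Nn); exact: ler_norm.
(* Adding up the ranks makes [nk] nondecreasing while keeping it above [N]. *)
pose nk k := (\sum_(i < k.+1) N i)%N.
have nkN k : (N k <= nk k)%N by rewrite /nk big_ord_recr/= leq_addl.
have nkS k : (nk k <= nk k.+1)%N by rewrite /nk [in leqRHS]big_ord_recr/= leq_addr.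
pose D k x := psum c (nk k.+1) x - psum c (nk k) x.
have hD k : sqint mu (D k) by apply: sqintB; exact: sqint_psum.
have ipD k : ip mu (D k) (D k) <= (2 ^+ k)^-1 ^+ 2.
  rewrite /D ip_psumB// (le_trans _ (NP k (nk k) (nkN k)))// lerD2r.
  exact: sS.
(* The squared norm of [D k] is at most [4^-k], so the weight [2^k] still leaves a convergent series
   of integrals; finiteness of [h x] then forces absolute convergence of the increments at [x]. *)
pose h x := (\sum_(k <oo) (2 ^+ k * D k x ^+ 2)%:E)%E.
have w0 k x : 0 <= 2 ^+ k * D k x ^+ 2 by rewrite mulr_ge0 ?sqr_ge0 ?exprn_ge0.
have mD k : measurable_fun setT (fun x => (2 ^+ k * D k x ^+ 2)%:E).
  apply/measurable_EFinP; apply: measurable_funM => //.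
  by apply: measurable_funX; case: (hD k).
have mh : measurable_fun setT h.
  by apply: ge0_emeasurable_sum => // k x _ _; rewrite lee_fin.
have h0 x : (0 <= h x)%E by apply: nneseries_ge0 => k _ _; rewrite lee_fin.
have ih : (\int[mu]_x h x < +oo)%E.
  rewrite integral_nneseries//; last by move=> k x _; rewrite lee_fin.
  apply: (@le_lt_trans _ _ (\sum_(0 <= k <oo) (2^-1 ^+ k)%:E)%E).
    apply: lee_nneseries => [k _ _|k _].
      by apply: integral_ge0 => x _; rewrite lee_fin.
    under eq_integral do rewrite EFinM.
    rewrite ge0_integralZl_EFin ?exprn_ge0//.
    - rewrite -ipE// -EFinM lee_fin -ler_pdivlMl ?exprn_gt0//.
      by rewrite (le_trans (ipD k))// expr2 exprVn.
    - by move=> x _; rewrite lee_fin sqr_ge0.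
    - by apply/measurable_EFinP; apply: measurable_funX; case: (hD k).
  have cg : series (geometric 1 (2^-1 : R)) @ \oo --> (1 / (1 - 2^-1) : R).
    by apply: cvg_geometric_series; rewrite ger0_norm// invf_lt1// ltr1n.
  rewrite (_ : (\sum_(0 <= k <oo) _)%E = (1 / (1 - 2^-1) : R)%:E) ?ltry//.
  apply/cvg_lim => //; apply: cvg_EFin; first by near=> n; rewrite sumEFin.
  apply: cvg_trans cg; apply: near_eq_cvg; near=> n.
  by rewrite /= sumEFin/= /series/=; apply: eq_bigr => i _; rewrite mul1r.
pose E : set T := [set x | (h x < +oo)%E].
have mE : measurable E.
  by rewrite -[E]setTI; exact: emeasurable_fun_infty_o.
(* Cutting down to [E] changes the partial sums only on a null set and makes them converge at every
   point, as [sqint_limit] requires. *)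
pose t k x := psum c (nk k) x * \1_E x.
have hB x n : E x -> \sum_(0 <= k < n) (2 ^+ k * D k x ^+ 2) <= fine (h x).
  move=> Ex; rewrite -lee_fin fineK ?ge0_fin_numE// -sumEFin.
  by apply: nneseries_lim_ge => k _; rewrite lee_fin.
have cD x : E x -> cvgn (series (D ^~ x)).
  move=> Ex; apply: normed_cvg; apply: nondecreasing_is_cvgn.
    by apply: nondecreasing_series => k _ _; exact: normr_ge0.
  exists (2 + fine (h x)) => _ [n _ <-].
  (* Arithmetic-geometric mean inequality: expand [q (1/q - |D k x|)^2 >= 0] with [q = 2^k]. *)
  apply: (@le_trans _ _ (\sum_(0 <= k < n) (2^-1 ^+ k + 2 ^+ k * D k x ^+ 2))).
    apply: ler_sum => k _; rewrite exprVn.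
    set q : R := 2 ^+ k; have q0 : 0 < q by rewrite exprn_gt0.
    have : 0 <= q * (q^-1 - `|D k x|) ^+ 2 by rewrite mulr_ge0 ?sqr_ge0// ltW.
    rewrite sqrrB real_normK ?num_real// mulrDr mulrBr expr2 mulVKf ?gt_eqF//.
    rewrite mulrnAr mulrA mulfV ?gt_eqF// mul1r => h1.
    by have := normr_ge0 (D k x); rewrite mulr2n in h1; rewrite /=; lra.
  rewrite big_split/= lerD// ?hB//.
  have := @geometric_seriesE R 1 2^-1 => /(_ _)/(congr1 (@^~ n)).
  rewrite /series/= /geometric/=; under eq_bigr do rewrite mul1r.
  move=> ->; last by rewrite lt_eqF// invf_lt1// ltr1n.
  rewrite mul1r ler_pdivrMr; last by lra.
  have : 0 <= (2^-1 : R) ^+ n by rewrite exprn_ge0.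
  by lra.
have tel x k : psum c (nk k) x = psum c (nk 0%N) x + series (D ^~ x) k.
  by rewrite /series/= telescope_sumr// addrC subrK.
have ct x : cvgn (t ^~ x).
  have [Ex|nEx] := pselect (E x).
    rewrite (_ : t ^~ x = (fun k => psum c (nk 0%N) x + series (D ^~ x) k)).
      by apply: is_cvgD; [exact: is_cvg_cst|exact: cD].
    by apply/funext => k; rewrite /t indicE mem_set// mulr1.
  rewrite (_ : t ^~ x = cst 0); first exact: is_cvg_cst.
  by apply/funext => k; rewrite /t indicE memNset// mulr0.
pose g x := limn (t ^~ x).
have aeE : {ae mu, forall x, E x}.
  have : mu.-integrable setT h.
    apply/integrableP; split=> //.
    by under eq_integral do rewrite gee0_abs//.
  move=> /integrable_ae => /(_ measurableT); apply: filterS => x /(_ I).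
  by rewrite ge0_fin_numE.
have ht k : sqint mu (t k).
  apply: (integrable_sqint (mu := mu)).
    apply: measurable_funM; first by case: (sqint_psum c (nk k)).
    exact: measurable_indic.
  apply: le_integrable (sqint_integrable (sqint_psum c (nk k))) => //.
    apply/measurable_EFinP; apply: measurable_funX; apply: measurable_funM.
      by case: (sqint_psum c (nk k)).
    exact: measurable_indic.
  move=> x _ /=; rewrite lee_fin !ger0_norm ?sqr_ge0// /t exprMn.
  rewrite ler_piMr ?sqr_ge0// indicE; case: (_ \in _); by rewrite ?expr1n ?expr0n.
(* With [n] fixed and [k] going to infinity, the squared distance from [psum c n] to [t k] is
   [|s n - s (nk k)|], which tends to [S - s n]. *)
have key n : sqint mu (fun x => psum c n x - g x) /\
    ip mu (fun x => psum c n x - g x) (fun x => psum c n x - g x) <= S - s n.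
  apply: (@sqint_limit _ _ _ _ (fun k x => psum c n x - t k x)).
  - by move=> x; apply: cvgB; [exact: cvg_cst|exact: ct].
  - by move=> k; apply: sqintB => //; exact: sqint_psum.
  rewrite (_ : (fun k => _) = (fun k => `|s n - s (nk k)|)).
    have sk : (s \o nk) @ \oo --> S.
      have h1 : (S - (s \o nk) k) @[k --> \oo] --> (0 : R).
        apply: (@squeeze_cvgr _ _ _ _ (cst 0) (fun k => 2^-1 ^+ k)).
        - near=> k; rewrite subr_ge0 sS/= (le_trans (NP k (nk k) (nkN k)))//.
          rewrite expr2 exprVn ler_piMr ?invr_ge0 ?exprn_ge0//.
          by rewrite invf_le1 ?exprn_gt0// exprn_ege1// ler1n.
        - exact: cvg_cst.
        - by apply: cvg_expr; rewrite ger0_norm// invf_lt1// ltr1n.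
      rewrite (_ : s \o nk = fun k => S - (S - (s \o nk) k)); last first.
        by apply/funext => k; rewrite subKr.
      by rewrite -[X in _ --> X]subr0; apply: cvgB => //; exact: cvg_cst.
    have -> : S - s n = `|s n - S| by rewrite distrC ger0_norm// subr_ge0.
    apply: cvg_norm; apply: cvgB => //; exact: cvg_cst.
  apply/funext => k; rewrite -ip_psumB_norm /ip /Rintegral; congr fine.
  apply: ae_eq_integral => //.
  - by apply/measurable_EFinP; apply: measurable_funM;
      case: (sqintB (sqint_psum c n) (ht k)).
  - by apply/measurable_EFinP; apply: measurable_funM;
      case: (sqintB (sqint_psum c n) (sqint_psum c (nk k))).
  by apply: filterS aeE => x Ex _; rewrite /t indicE mem_set// mulr1.
exists g; split.
  have := sqintB (sqint_psum c 0) (key 0%N).1.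
  by congr sqint; apply/funext => x; rewrite opprB addrC subrK.
apply: (@squeeze_cvgr _ _ _ _ (cst 0) (fun n => S - s n)).
- by near=> n; rewrite ip_ge0/=; have [] := key n.
- exact: cvg_cst.
- rewrite -[X in _ --> X](subrr S); apply: cvgB => //; exact: cvg_cst.
Unshelve. all: by end_near. Qed.

End orthonormal_series.

(** * Moments of the deformed measure *)

Section density.
Context d (T : measurableType d) (R : realType).
Variables (mu nu : {measure set T -> \bar R}) (D : set T) (w : T -> R).
Hypotheses (mD : measurable D) (mw : measurable_fun D w) (w0 : forall x, D x -> 0 <= w x).
Hypothesis nuE : forall A, measurable A ->
  nu A = (\int[mu]_(x in A `&` D) (w x)%:E)%E.
Local Open Scope ereal_scope.

Import HBNNSimple.

Lemma ge0_integral_density (f : T -> \bar R) : measurable_fun setT f ->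
  (forall x, 0 <= f x) ->
  \int[nu]_x f x = \int[mu]_(x in D) (f x * (w x)%:E).
Proof.
move=> mf f0; pose f_ := nnsfun_approx measurableT mf.
have mEw : measurable_fun D (EFin \o w) by exact/measurable_EFinP.
transitivity (limn (fun n => \int[nu]_x (f_ n x)%:E)).
  rewrite -monotone_convergence//.
  - apply: eq_integral => y _; apply/esym/cvg_lim => //.
    by apply: cvg_nnsfun_approx.
  - by move=> n; exact/measurable_EFinP/measurable_funP.
  - by move=> n y _; rewrite lee_fin.
  - by move=> y _ m n mn; rewrite lee_fin; exact/lefP/nd_nnsfun_approx.
rewrite [X in limn X](_ : _ =
    (fun n => \int[mu]_(x in D) ((f_ n x)%:E * (w x)%:E))).
  rewrite -monotone_convergence//; last 3 first.
    - move=> n /=; apply: emeasurable_funM => //.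
      by apply/measurable_EFinP/measurable_funTS/measurable_funP.
    - by move=> n x Dx /=; rewrite -EFinM lee_fin mulr_ge0 ?w0.
    - move=> x Dx m n mn; rewrite -!EFinM lee_fin ler_wpM2r ?w0//.
      exact/lefP/nd_nnsfun_approx.
  apply: eq_integral => x /[!inE] Dx /=; apply/cvg_lim => //.
  apply: cvgeZr => //; apply: cvg_nnsfun_approx => //.
apply/funext => n.
have mfr r : measurable (f_ n @^-1` [set r]) by [].
transitivity (\sum_(k \in range (f_ n))
    \int[mu]_(x in D) (k%:E * (\1_(f_ n @^-1` [set k]) x * w x)%:E)).
  under eq_integral do rewrite fimfunE -fsumEFin//.
  rewrite ge0_integral_fsum//; last 2 first.
  - by move=> y; exact/measurable_EFinP/measurable_funM.
  - by move=> y x _; rewrite nnfun_muleindic_ge0.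
  apply: eq_fsbigr => r /[!inE] -[y _ fyr]; have r0 : (0 <= r)%R by rewrite -fyr.
  rewrite integralZl_indic_nnsfun// integral_indic// setIT nuE//.
  rewrite ge0_integralZl_EFin//; last 2 first.
  - by move=> x Dx; rewrite lee_fin mulr_ge0 ?w0.
  - by apply/measurable_EFinP; apply: measurable_funM.
  congr (_ * _); rewrite setIC integral_mkcondr.
  apply: eq_integral => x _; rewrite patchE indicE.
  by case: (x \in _); rewrite ?mul1r ?mul0r.
rewrite -ge0_integral_fsum//.
- apply: eq_integral => x _; rewrite [in RHS]fimfunE -fsumEFin//.
  rewrite ge0_mule_fsuml => [|k]; last by rewrite nnfun_muleindic_ge0.
  by apply: eq_fsbigr => k _; rewrite -!EFinM mulrA.
- move=> r; apply: measurable_funeM; apply/measurable_EFinP; exact: measurable_funM.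
- move=> r x Dx; rewrite -EFinM lee_fin mulrA mulr_ge0 ?w0//.
  by have := nnfun_muleindic_ge0 (f_ n) r x; rewrite -EFinM lee_fin.
Qed.

End density.

Section substitution.
Context {R : realType}.
Local Notation mu := (@lebesgue_measure R).

(** The change of variables is made on compact intervals of []0, +oo[], since [x ^ a] need not be
    derivable at [0]; both sides then pass to the limit monotonically. *)
Lemma integration_by_substitution_powR (c a : R) (G : R -> R) : 0 < c -> 0 < a ->
  {in `]0, +oo[, continuous G} -> (forall x, 0 < x -> 0 <= G x) ->
  (\int[mu]_(x in `]0%R, +oo[) (G x)%:E =
   \int[mu]_(x in `]0%R, +oo[) (G (c * x `^ a) * (c * (a * x `^ (a - 1))))%:E)%E.
Proof.
move=> c0 a0 cG G0.
pose F (x : R) := c * x `^ a; pose dF (x : R) := c * (a * x `^ (a - 1)).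
have F0 x : 0 < x -> 0 < F x by move=> x0; rewrite mulr_gt0// powR_gt0.
have ndF x y : 0 <= x -> x < y -> F x < F y.
  move=> x0 xy; rewrite ltr_pM2l// gt0_ltr_powR ?nnegrE//.
  exact/ltW/(le_lt_trans x0 xy).
have isF (x : R) : 0 < x -> is_derive x (1 : R) F (dF x).
  move=> x0; have := is_derive1_powR a x0 => h; exact: is_deriveZ.
have FE x : 0 < x -> F^`()%classic x = dF x.
  by move=> x0; rewrite derive1E; have [_ ->] := isF _ x0.
have cdF x : 0 < x -> {for x, continuous dF}.
  by move=> x0; apply: cvgMr; apply: cvgMr; exact: continuous_powRr.
have cF' x : 0 < x -> {for x, continuous F^`()%classic}.
  move=> x0; rewrite /prop_for /continuous_at FE//.
  apply: cvg_trans (cdF _ x0); apply: near_eq_cvg.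
  near=> y; apply/esym/FE; near: y; exact: lt_nbhsr.
pose u (n : nat) : R := n.+2%:R^-1; pose v (n : nat) : R := n.+2%:R.
have u0 n : 0 < u n by rewrite invr_gt0.
have uv n : u n < v n.
  by apply: (@lt_trans _ _ 1); rewrite ?invf_lt1// ltr1n.
have ndu : nonincreasing_seq u by move=> m n mn; rewrite lef_pV2 ?posrE// ler_nat.
have ndv : nondecreasing_seq v by move=> m n mn; rewrite ler_nat.
have cu : u @ \oo --> 0.
  by rewrite (cvg_shiftS (@harmonic R : R^nat)); exact: cvg_harmonic.
have cv : v @ \oo --> +oo.
  rewrite (cvg_shiftS (fun n : nat => n.+1%:R : R)); exact: cvg_nat_pinfty.
have cFu : (F \o u) @ \oo --> 0.
  rewrite -[X in _ --> X](mulr0 c); apply: cvgMr.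
  have /cvg_at_rightP h := @powR_cvg0 R a a0; exact: h.
have cFv : (F \o v) @ \oo --> +oo.
  apply/cvgryPge => A; pose B := (`|A| + 1) / c.
  have B0 : 0 <= B by rewrite divr_ge0 ?addr_ge0// ltW.
  near=> n; have vA : B `^ a^-1 <= v n by near: n; move/cvgryPge : cv; exact.
  have : (B `^ a^-1) `^ a <= v n `^ a.
    by rewrite ge0_ler_powR ?nnegrE ?powR_ge0// ltW.
  rewrite -powRrM mulVf ?gt_eqF// powRr1// ler_pdivrMr// mulrC => h.
  by apply: le_trans h; rewrite (le_trans (ler_norm A))// lerDl.
have c1 : (\int[mu]_(x in `[(F \o u) n, (F \o v) n]) (G x)%:E)%E @[n --> \oo] -->
    (\int[mu]_(x in `]0%R, +oo[) (G x)%:E)%E.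
  apply: cvg_integral_oy => //.
  - by move=> n; exact: F0.
  - move=> m n mn /=; have := ndu _ _ mn; rewrite le_eqVlt => /predU1P[->//|h].
    by apply/ltW/ndF => //; exact: ltW.
  - move=> m n mn /=; have := ndv _ _ mn; rewrite le_eqVlt => /predU1P[->//|h].
    by apply/ltW/ndF.
have c2 : (\int[mu]_(x in `[u n, v n]) (G (F x) * dF x)%:E)%E @[n --> \oo] -->
    (\int[mu]_(x in `]0%R, +oo[) (G (F x) * dF x)%:E)%E.
  apply: cvg_integral_oy => //.
  - move=> x; rewrite in_itv/= andbT => x0.
    apply: continuousM; last exact: cdF.
    apply: continuous_comp; last by apply: cG; rewrite in_itv/= andbT F0.
    by apply: cvgMr; exact: continuous_powRr.
  - by move=> x x0; rewrite mulr_ge0 ?G0 ?F0// !mulr_ge0 ?powR_ge0// ltW.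
apply: (cvg_unique _ c1) => //.
rewrite (_ : (fun n => _) = (fun n => \int[mu]_(x in `[u n, v n]) (G (F x) * dF x)%:E)%E)//.
apply/funext => n /=.
have itv0 x : x \in `[u n, v n] -> 0 < x.
  by rewrite in_itv/= => /andP[+ _]; exact: lt_le_trans.
have un : u n \in `[u n, v n] by rewrite in_itv/= lexx ltW.
have vn : v n \in `[u n, v n] by rewrite in_itv/= lexx ltW.
rewrite (@integration_by_substitution_increasing _ F G (u n) (v n)).
- apply: eq_integral => x; rewrite inE => /itv0 x0.
  by rewrite -(FE x x0).
- exact: ltW.
- by move=> x y /itv0 x0 _; apply: ndF; exact: ltW.
- by move=> x /subset_itv_oo_cc /itv0; exact: cF'.
- by apply/cvg_ex; exists (F^`()%classic (u n)); apply: cvg_at_right_filter; exact/cF'/itv0.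
- by apply/cvg_ex; exists (F^`()%classic (v n)); apply: cvg_at_left_filter; exact/cF'/itv0.
- apply: derivable_LRcontinuous => // x /itv0 x0; by have [] := isF _ x0.
- apply: continuous_itvcc_within => x; rewrite in_itv/= => /andP[+ _] => Fx.
  by apply: cG; rewrite in_itv/= andbT (lt_le_trans _ Fx)// F0.
Unshelve. all: by end_near. Qed.

End substitution.

Section deformed_measure_theory.
Context {R : realType} (a alpha : R).
Hypotheses (a0 : 0 < a) (alpha1 : -1 < alpha).
Local Notation mu := (deformed_measure a alpha).
Local Notation X := (fun r : measurableTypeR R => r `^ a / a).

Lemma measurable_deformed_var : measurable_fun setT X.
Proof. by apply: measurable_funM => //; exact: measurable_powR. Qed.

(** The substitution [u = t X r] gives Euler's integral: the density [r^(a alpha + a - 1)] equals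
    [a^alpha (X r)^alpha] times the derivative [r^(a - 1)] of [X]. *)
Lemma deformed_moment (k : nat) (t : R) : 0 < t ->
  (\int[mu]_r (X r ^+ k * expR (- (t * X r)))%:E =
   (a `^ alpha * Gamma (alpha + 1 + k%:R) / t `^ (alpha + 1 + k%:R))%:E)%E.
Proof.
move=> t0; have mX := measurable_deformed_var.
pose p := alpha + 1 + k%:R.
have p0 : 0 < p by rewrite ltr_pwDl// -ltrBlDr sub0r.
rewrite (@ge0_integral_density _ _ _ lebesgue_measure _ `]0%R, +oo[ (fun r => r `^ (a * alpha + a - 1)))//.
- pose C := a `^ alpha / t `^ p.
  have C0 : 0 <= C by rewrite divr_ge0 ?powR_ge0.
  transitivity (C%:E * \int[lebesgue_measure]_(x in `]0%R, +oo[)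
      ((t / a * x `^ a) `^ (p - 1) * expR (- (t / a * x `^ a)) *
       (t / a * (a * x `^ (a - 1))))%:E)%E; last first.
    rewrite -(@integration_by_substitution_powR R (t / a) a
      (fun u => u `^ (p - 1) * expR (- u)))//.
    + by rewrite -EFin_Gamma// -EFinM /C mulrAC.
    + by rewrite divr_gt0.
    + by move=> x; rewrite in_itv/= andbT; exact: continuous_Gamma_fun.
    + by move=> x _; exact: Gamma_fun_ge0.
  rewrite -ge0_integralZl_EFin//; last 2 first.
    + move=> x _; rewrite lee_fin mulr_ge0 ?Gamma_fun_ge0//.
      by rewrite !mulr_ge0 ?powR_ge0 ?invr_ge0// ltW.
    + apply/measurable_EFinP/measurable_funTS.
      have mp q : measurable_fun setT (fun x : R => x `^ q) by exact: measurable_powR.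
      apply: measurable_funM; last by do 2 apply: measurable_funM => //.
      have m1 : measurable_fun setT (fun x : R => t / a * x `^ a) by exact: measurable_funM.
      apply: measurable_funM; first exact: (measurableT_comp (mp _)).
      by apply: measurableT_comp => //; exact: measurableT_comp.
  apply: eq_integral => x; rewrite inE/= in_itv/= andbT => x0.
  rewrite -!EFinM; congr EFin.
  pose y := x `^ a / a.
  have xa0 : 0 < x `^ a by rewrite powR_gt0.
  have y0 : 0 < y by rewrite divr_gt0.
  have -> : t / a * x `^ a = t * y by rewrite /y; ring.
  rewrite -/y.
  have -> : p - 1 = alpha + k%:R by rewrite /p; ring.
  have -> : x `^ (a * alpha + a - 1) = a `^ alpha * y `^ alpha * x `^ (a - 1).
    rewrite -addrA [LHS]powRD; last by rewrite (gt_eqF x0) implybT.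
    rewrite powRrM -powRM ?ltW//; congr (_ `^ _ * _).
    by rewrite /y mulrC divfK// gt_eqF.
  have -> : C = a `^ alpha / (t `^ (alpha + k%:R) * t).
    rewrite /C /p addrAC [X in _ / X]powRD; last by rewrite (gt_eqF t0) implybT.
    by rewrite powRr1 ?ltW.
  have yk : y `^ (alpha + k%:R) = y `^ alpha * y ^+ k.
    by rewrite powRD ?powR_mulrn ?(ltW y0)// (gt_eqF y0) implybT.
  rewrite powRM ?ltW// yk.
  by field; rewrite !gt_eqF// powR_gt0.
- by apply/measurable_funTS; exact: measurable_powR.
- by move=> x _; rewrite powR_ge0.
- apply/measurable_EFinP; apply: measurable_funM; first exact: measurable_funX.
  by apply: measurableT_comp => //; apply: measurableT_comp => //; exact: measurable_funM.
- move=> x; rewrite lee_fin mulr_ge0 ?expR_ge0// exprn_ge0// divr_ge0 ?powR_ge0// ltW//.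
Qed.

End deformed_measure_theory.

(** * Laguerre functions *)

Section lincomb.
Context d (T : measurableType d) (R : realType) (mu : {measure set T -> \bar R}).
Lemma integrable_lincomb (F : nat -> T -> R) (c : nat -> R) n :
  (forall j, mu.-integrable setT (EFin \o F j)) ->
  mu.-integrable setT (EFin \o (fun x => \sum_(j < n) c j * F j x)).
Proof.
move=> hF; elim: n => [|n IH].
  rewrite (_ : _ \o _ = cst 0%E); first exact: integrable0.
  by apply/funext => x /=; rewrite big_ord0.
rewrite (_ : _ \o _ = (fun x => (\sum_(j < n) c j * F j x)%:E + (c n)%:E * (F n x)%:E)%E).
  by apply: integrableD => //; apply: integrableZl => //; exact: hF.
by apply/funext => x /=; rewrite big_ord_recr/= EFinD.
Qed.

Lemma Rintegral_lincomb (F : nat -> T -> R) (c : nat -> R) n :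
  (forall j, mu.-integrable setT (EFin \o F j)) ->
  \int[mu]_x (\sum_(j < n) c j * F j x) = \sum_(j < n) c j * \int[mu]_x F j x.
Proof.
move=> hF; elim: n => [|n IH].
  rewrite big_ord0; under eq_Rintegral do rewrite big_ord0.
  by rewrite /Rintegral integral0.
under eq_Rintegral do rewrite big_ord_recr/=.
rewrite RintegralD//; [|exact: integrable_lincomb|]; last first.
  by rewrite (_ : _ \o _ = (fun x => (c n)%:E * (F n x)%:E)%E)//; apply: integrableZl => //; exact: hF.
by rewrite IH big_ord_recr/= RintegralZl.
Qed.

Lemma Rintegral_dominated (f : nat -> T -> R) (F G : T -> R) :
  (forall n, measurable_fun setT (f n)) -> (forall x, f n x @[n --> \oo] --> F x) ->
  mu.-integrable setT (EFin \o G) -> (forall n x, `|f n x| <= G x) ->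
  mu.-integrable setT (EFin \o F) /\
  (\int[mu]_x f n x) @[n --> \oo] --> \int[mu]_x F x.
Proof.
move=> mf fF iG fG.
have mF : measurable_fun setT F by apply: (@measurable_fun_cvg _ _ _ setT f F).
have [] := @dominated_convergence _ _ _ mu setT measurableT (fun n => EFin \o f n)
  (EFin \o F) (EFin \o G).
- by move=> n; apply/measurable_EFinP.
- exact/measurable_EFinP.
- by apply: aeW => x _; apply: cvg_EFin; [near=> n|exact: fF].
- by [].
- by apply: aeW => x n _; rewrite lee_fin fG.
move=> iF _ cI; split=> //; rewrite /Rintegral.
apply: fine_cvg; rewrite fineK//; exact: integrable_fin_num.
Unshelve. all: by end_near. Qed.

End lincomb.

Section laguerre_coefficients.
Context {R : realType} (alpha : R).
Hypothesis alpha1 : -1 < alpha.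
Local Notation b := (alpha + 1).

Lemma Gamma_poch n : Gamma (b + n%:R) = Gamma b * poch b n.
Proof.
have b0 : 0 < b by rewrite -ltrBlDr sub0r.
elim: n => [|n IH]; first by rewrite poch0 mulr1 addr0.
have bn : 0 < b + n%:R by rewrite ltr_pwDl.
by rewrite -natr1 addrA (GammaS bn) IH pochS; ring.
Qed.

Definition lag_coef l j : R :=
  (-1) ^+ j * Gamma (b + l%:R) / ((l - j)`!%:R * Gamma (b + j%:R)) / j`!%:R.

Lemma laguerreE l y : (laguerre alpha l).[y] = \sum_(j < l.+1) lag_coef l j * y ^+ j.
Proof.
rewrite horner_poly; apply: eq_bigr => j _; rewrite /lag_coef.
by rewrite ![alpha + _ + 1]addrAC.
Qed.

Let g0 n : Gamma (b + n%:R) != 0.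
Proof. by rewrite gt_eqF// Gamma_gt0// ltr_pwDl// -ltrBlDr sub0r. Qed.

Let f0 n : n`!%:R != 0 :> R.
Proof. by rewrite pnatr_eq0 -lt0n fact_gt0. Qed.

Let binE l j : (j <= l)%N -> 'C(l, j)%:R = l`!%:R / (j`!%:R * (l - j)`!%:R) :> R.
Proof.
move=> jl; rewrite -(bin_fact jl) !natrM; field; by rewrite !f0.
Qed.

Let GammaD m n : Gamma (b + (m + n)%:R) = Gamma (b + m%:R) * poch (b + m%:R) n.
Proof. by rewrite !Gamma_poch pochD mulrA. Qed.

(** The quotient of [Gamma (b + (j + m))] by [Gamma (b + j)] is [poch (b + j) m], and what is left
    of [lag_coef] is a signed binomial: the sum is the finite difference of [alt_sum_poch]. The
    factor [m ^_ l] vanishes for [m < l], and this is the orthogonality of the Laguerre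
    polynomials. *)
Lemma sum_lag_coef_Gamma l m :
  \sum_(j < l.+1) lag_coef l j * Gamma (b + (j + m)%:R) =
  Gamma (b + l%:R) / l`!%:R * ((-1) ^+ l * (m ^_ l)%:R * poch (b + l%:R) (m - l)).
Proof.
rewrite -alt_sum_poch mulr_sumr; apply: eq_bigr => -[j jl] _ /=.
rewrite GammaD binE// /lag_coef.
move: (f0 l) (f0 j) (f0 (l - j)%N) (g0 j) (g0 l) (poch _ _).
by move: (Gamma _) (Gamma _) => ? ? h1 h2 h3 h4 h5 ?; field; rewrite h1 h2 h3 h4.
Qed.

Lemma lag_coef_diag l : lag_coef l l = (-1) ^+ l / l`!%:R.
Proof. by rewrite /lag_coef subnn fact0 mul1r; field; rewrite f0 g0. Qed.

(** Once the sums are exchanged, the coefficient of [(-y)^j] contains the binomial expansion of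
    [(1 - 2)^(l - j)]. This is the source of the eigenvalue [(-1)^l]. *)
Lemma sum_laguerre_rising l y :
  \sum_(k < l.+1) lag_coef l k * 2 ^+ k * laguerre_rising b k y =
  (-1) ^+ l * (laguerre alpha l).[2 * y].
Proof.
have wide k : (k < l.+1)%N -> laguerre_rising b k y =
    \sum_(j < l.+1) 'C(k, j)%:R * ((- y) ^+ j * poch (b + j%:R) (k - j)).
  move=> kl; rewrite /laguerre_rising (big_ord_widen l.+1 (fun j =>
    'C(k, j)%:R * ((- y) ^+ j * poch (b + j%:R) (k - j))))//.
  rewrite [RHS](bigID (fun j : 'I_l.+1 => (j < k.+1)%N))/=.
  rewrite [X in _ = _ + X](_ : _ = 0) ?addr0//; apply: big1 => j.
  by rewrite -leqNgt => kj; rewrite bin_small// mul0r.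
transitivity (\sum_(j < l.+1) \sum_(k < l.+1) lag_coef l k * 2 ^+ k *
    ('C(k, j)%:R * ((- y) ^+ j * poch (b + j%:R) (k - j)))).
  rewrite exchange_big/=; apply: eq_bigr => k _.
  by rewrite wide// mulr_sumr.
rewrite laguerreE mulr_sumr; apply: eq_bigr => -[j jl] _ /=.
transitivity ((- y) ^+ j * (Gamma (b + l%:R) / (Gamma (b + j%:R) * j`!%:R)) * (-2) ^+ j /
    (l - j)`!%:R * (1 + -2) ^+ (l - j)); last first.
  have -> : (1 + -2 : R) = -1 by lra.
  rewrite (_ : (-1) ^+ l = (-1) ^+ j * (-1) ^+ (l - j)); last by rewrite -exprD subnKC.
  rewrite (exprNn y) (exprNn 2) exprMn /lag_coef.
  move: (f0 l) (f0 j) (f0 (l - j)%N) (g0 j).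
  by move: (Gamma _) (Gamma _) => ? ? h1 h2 h3 h4; field; rewrite h2 h3 h4.
rewrite exprDn !mulr_sumr -(big_mkord xpredT (fun k => lag_coef l k * 2 ^+ k *
    ('C(k, j)%:R * ((- y) ^+ j * poch (b + j%:R) (k - j))))).
rewrite (big_cat_nat _ (n := j))//=; last exact: ltnW.
rewrite big_nat big1 ?add0r; last first.
  by move=> k /andP[_ kj]; rewrite bin_small// mul0r mulr0.
rewrite -{1}(add0n j) big_addn big_mkord subSn//; apply: eq_bigr => -[i il] _ /=.
have ijl : (i + j <= l)%N by rewrite -leq_subRL// ?addnC; lia.
have ilj : (i <= l - j)%N by [].
rewrite addnK /lag_coef (binE (leq_addl i j)) -[X in _ = _ * X]mulr_natl (binE ilj).
have -> : (l - (i + j) = l - j - i)%N by lia.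
have p0 : poch (b + j%:R) i != 0.
  by have := g0 (j + i); rewrite GammaD mulf_eq0 negb_or => /andP[].
rewrite addnK [(i + j)%N]addnC GammaD expr1n mul1r !exprD !(exprNn 2).
move: (f0 (l - j - i)%N) (f0 (j + i)%N) (f0 j) (f0 i) (f0 (l - j)%N) (g0 j) p0.
move: (Gamma _) (Gamma _) (poch _ _) => ? ? ? h1 h2 h3 h4 h5 h6 h7.
by field; rewrite h1 h2 h3 h4 h5 h6 h7.
Qed.

End laguerre_coefficients.

(** * Laguerre functions of a variable [X] known through its exponential moments *)

Section laguerre_abstract.
Context d (T : measurableType d) (R : realType) (mu : {measure set T -> \bar R}).
Variables (X : T -> R) (A alpha : R).
Hypotheses (mX : measurable_fun setT X) (X0 : forall x, 0 <= X x).
Hypotheses (A0 : 0 < A) (alpha2 : - (1 / 2) <= alpha).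
Local Notation b := (alpha + 1).
Hypothesis moment : forall k t, 0 < t ->
  (\int[mu]_x (X x ^+ k * expR (- (t * X x)))%:E =
   (A * Gamma (b + k%:R) / t `^ (b + k%:R))%:E)%E.

Let alpha1 : -1 < alpha. Proof. by apply: lt_le_trans alpha2; lra. Qed.
Let b2 : 1 / 2 <= b. Proof. by rewrite -lerBlDr; apply: le_trans alpha2; lra. Qed.
Let b0 : 0 < b. Proof. by apply: lt_le_trans b2. Qed.
Let bk0 k : 0 < b + k%:R. Proof. by rewrite ltr_pwDl. Qed.

Definition expow t k x := X x ^+ k * expR (- (t * X x)).

Lemma measurable_expow t k : measurable_fun setT (expow t k).
Proof.
apply: measurable_funM; first exact: measurable_funX.
by apply: measurableT_comp => //; apply: measurableT_comp => //; exact: measurable_funM.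
Qed.

Lemma expow_ge0 t k x : 0 <= expow t k x.
Proof. by rewrite mulr_ge0 ?expR_ge0// exprn_ge0. Qed.

Lemma integrable_expow t k : 0 < t -> mu.-integrable setT (EFin \o expow t k).
Proof.
move=> t0; apply/integrableP; split.
  by apply/measurable_EFinP; exact: measurable_expow.
under eq_integral do rewrite /= ger0_norm ?expow_ge0//.
by rewrite moment// ltry.
Qed.

Lemma Rintegral_expow t k : 0 < t ->
  \int[mu]_x expow t k x = A * Gamma (b + k%:R) / t `^ (b + k%:R).
Proof. by move=> t0; rewrite /Rintegral moment. Qed.

Lemma integrable_poly_exp (p : {poly R}) t : 0 < t ->
  mu.-integrable setT (EFin \o (fun x => p.[X x] * expR (- (t * X x)))).
Proof.
move=> t0; rewrite (_ : (fun x => _) = (fun x => \sum_(j < size p) p`_j * expow t j x)).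
  by apply: integrable_lincomb => j; exact: integrable_expow.
apply/funext => x; rewrite horner_coef mulr_suml; apply: eq_bigr => j _.
by rewrite /expow mulrA.
Qed.

Lemma laguerre_orthogonal l m : (m <= l)%N ->
  \int[mu]_x ((laguerre alpha l).[2 * X x] * (2 * X x) ^+ m * expR (- (2 * X x))) =
  (A / 2 `^ b * Gamma (b + l%:R) * (-1) ^+ l) *+ (m == l).
Proof.
move=> ml; transitivity (\int[mu]_x (\sum_(j < l.+1)
    (lag_coef alpha l j * 2 ^+ (j + m)) * expow 2 (j + m) x)).
  apply: eq_Rintegral => x _; rewrite laguerreE !mulr_suml; apply: eq_bigr => j _.
  by rewrite /expow !exprMn !exprD; ring.
rewrite (@Rintegral_lincomb _ _ _ _ (fun j => expow 2 (j + m)) (fun j => lag_coef alpha l j * 2 ^+ (j + m))); last first.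
  by move=> j; exact: integrable_expow.
transitivity (A / 2 `^ b * \sum_(j < l.+1) lag_coef alpha l j * Gamma (b + (j + m)%:R)).
  rewrite mulr_sumr; apply: eq_bigr => j _; rewrite Rintegral_expow//.
  rewrite powRD; last by rewrite pnatr_eq0 implybT.
  rewrite powR_mulrn//; field.
  by rewrite !gt_eqF ?powR_gt0// exprn_gt0.
rewrite sum_lag_coef_Gamma//; have [->|] := eqVneq m l.
  rewrite subnn poch0 ffactnn mulr1n; field.
  by rewrite pnatr_eq0 -lt0n fact_gt0/= gt_eqF// powR_gt0.
move=> ne; rewrite ffact_small; last by rewrite ltn_neqAle ne ml.
by rewrite !mulr0 mul0r !mulr0.
Qed.

Definition lag_norm l : R :=
  Num.sqrt (2 `^ b * Gamma (l%:R + 1) / (A * Gamma (alpha + l%:R + 1))).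

Definition lag_fun l (x : T) : R :=
  lag_norm l * (laguerre alpha l).[2 * X x] * expR (- X x).

Lemma lag_norm_sqr l :
  lag_norm l ^+ 2 * (A / 2 `^ b * Gamma (b + l%:R)) / l`!%:R = 1.
Proof.
have g1 : 0 < Gamma (b + l%:R) by exact: Gamma_gt0.
have p1 : 0 < 2 `^ b :> R by rewrite powR_gt0.
rewrite /lag_norm addrAC natr1 Gamma_nat sqr_sqrtr; last first.
  by rewrite divr_ge0 ?mulr_ge0// ltW.
by field; rewrite !gt_eqF// ltr0n fact_gt0.
Qed.

Lemma measurable_horner_comp (p : {poly R}) c : measurable_fun setT (fun x => p.[c * X x]).
Proof.
under eq_fun do rewrite horner_coef.
apply: measurable_sum => j; apply: measurable_funM => //.
by apply: measurable_funX; exact: measurable_funM.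
Qed.

Lemma measurable_lag_fun l : measurable_fun setT (lag_fun l).
Proof.
apply: measurable_funM.
  by apply: measurable_funM => //; exact: measurable_horner_comp.
by apply: measurableT_comp => //; exact: measurableT_comp.
Qed.

Lemma sqint_lag_fun l : sqint mu (lag_fun l).
Proof.
apply: integrable_sqint; first exact: measurable_lag_fun.
pose p := (lag_norm l *: (laguerre alpha l \Po (2 *: 'X))) ^+ 2.
rewrite (_ : (fun x => _) = (fun x => p.[X x] * expR (- (2 * X x)))).
  exact: integrable_poly_exp.
apply/funext => x; rewrite /p /lag_fun horner_exp hornerZ horner_comp hornerZ hornerX.
rewrite exprMn -expRM_natl; congr (_ * expR _); ring.
Qed.

(** Only the polynomial of smaller degree is expanded in powers. By [laguerre_orthogonal] at most
    its leading term survives, and that only when the degrees agree. *)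
Lemma lag_fun_orthonormal l m : ip mu (lag_fun l) (lag_fun m) = (l == m)%:R.
Proof.
wlog ml : l m / (m <= l)%N => [hw|].
  have [/hw//|] := boolP (m <= l)%N; rewrite -ltnNge => /ltnW/hw h.
  by rewrite ipC h eq_sym.
pose F k x := (laguerre alpha l).[2 * X x] * (2 * X x) ^+ k * expR (- (2 * X x)).
transitivity (\int[mu]_x (\sum_(k < m.+1) (lag_norm l * lag_norm m * lag_coef alpha m k) * F k x)).
  apply: eq_Rintegral => x _; rewrite /lag_fun (laguerreE _ m).
  have eE : expR (- (2 * X x)) = expR (- X x) * expR (- X x).
    by rewrite -expRD; congr expR; ring.
  set e := expR _; set L := _.[_].
  transitivity (lag_norm l * lag_norm m * L * e * e * \sum_(j < m.+1) lag_coef alpha m j * (2 * X x) ^+ j).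
    by move: (lag_norm l) (lag_norm m) L e (bigop _ _ _) => ? ? ? ? ?; ring.
  rewrite mulr_sumr; apply: eq_bigr => j _; rewrite /F eE -/e -/L.
  by move: (lag_norm l) (lag_norm m) L e (lag_coef _ _ _) (_ ^+ j) => ? ? ? ? ? ?; ring.
have iF k : mu.-integrable setT (EFin \o F k).
  rewrite (_ : F k = (fun x => ((laguerre alpha l \Po (2 *: 'X)) * (2 *: 'X) ^+ k).[X x] * expR (- (2 * X x)))).
    exact: integrable_poly_exp.
  by apply/funext => x; rewrite hornerM horner_comp horner_exp !hornerZ hornerX.
rewrite (Rintegral_lincomb (fun k => lag_norm l * lag_norm m * lag_coef alpha m k) _ iF).
rewrite big_ord_recr/= big1 ?add0r; last first.
  move=> [k km] _ /=; rewrite laguerre_orthogonal ?(ltn_eqF (leq_trans km ml)) ?mulr0//.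
  exact: (leq_trans (ltnW km)).
rewrite laguerre_orthogonal// eq_sym; have [->|_] := eqVneq m l; last by rewrite mulr0.
rewrite lag_coef_diag// mulr1n -[RHS](lag_norm_sqr l).
transitivity (lag_norm l ^+ 2 * (A / 2 `^ b * Gamma (b + l%:R)) / l`!%:R *
  ((-1) ^+ l * (-1) ^+ l)); last by rewrite -expr2 sqrr_sign mulr1.
by move: (lag_norm l) (Gamma _) (2 `^ b)^-1 (l`!%:R^-1) => ? ? ? ?; ring.
Qed.

(** For [y = X r] its value at [s] is that of [bessel_j alpha] at [2 sqrt(X r X s)]; see
    [bessel_kernelE]. *)
Definition hankel_kernel y : T -> R := fun x => bessel_ser b (y * X x).

Lemma measurable_hankel_kernel y : measurable_fun setT (hankel_kernel y).
Proof.
apply: (@measurableT_comp _ _ _ _ _ _ (bessel_ser b)).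
  by apply: continuous_measurable_fun; exact: continuous_bessel_ser.
exact: measurable_funM.
Qed.

(** Termwise integration: the moment [Gamma (b + (m + k))] divided by [poch b m] is
    [Gamma b * poch (b + m) k], so the series becomes that of [cvg_poch_exp]. *)
Lemma hankel_expow y k : 0 <= y ->
  \int[mu]_x (hankel_kernel y x * expow 1 k x) =
  A * Gamma b * (laguerre_rising b k y * expR (- y)).
Proof.
move=> y0.
pose f n x := \sum_(m < n) (bessel_coef b m * y ^+ m) * expow 1 (m + k) x.
(* Writing [2 y X = (4 y) (X / 2)] and giving one factorial to each factor bounds the partial Bessel
   sums by [e^{4y} e^{X/2}]; half of the decay of [e^{-X}] remains. *)
pose g x := expR (4 * y) * expow 2^-1 k x.
have fE n x : f n x = pseries (bessel_coef b) (y * X x) n * expow 1 k x.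
  rewrite /f /pseries /series/= big_mkord mulr_suml; apply: eq_bigr => m _.
  by rewrite /expow exprD exprMn; ring.
have cf x : f n x @[n --> \oo] --> hankel_kernel y x * expow 1 k x.
  under eq_fun do rewrite fE.
  by apply: cvgM; [exact: cvg_bessel_ser|exact: cvg_cst].
have exp_le (z : R) n : 0 <= z -> series (exp_coeff z) n <= expR z.
  move=> z0; apply: nondecreasing_cvgn_le; last exact: is_cvg_series_exp_coeff.
  by apply: nondecreasing_series => m _ _; exact: exp_coeff_ge0.
have coef_le (z : R) n : 0 <= z -> z ^+ n / n`!%:R <= expR z.
  move=> z0; apply: le_trans (exp_le z n.+1 z0).
  rewrite /series/= big_nat_recr//= lerDr sumr_ge0// => m _.
  exact: exp_coeff_ge0.
have fg n x : `|f n x| <= g x.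
  have yX : 0 <= y * X x by rewrite mulr_ge0.
  rewrite fE normrM [`|expow _ _ _|]ger0_norm ?expow_ge0//.
  rewrite /g /expow (_ : - (1 * X x) = - (2^-1 * X x) + - (2^-1 * X x)); last by field.
  have hX : 0 <= 2^-1 * X x by rewrite mulr_ge0.
  suff h : `|pseries (bessel_coef b) (y * X x) n| <= expR (4 * y) * expR (2^-1 * X x).
    rewrite expRD mulrCA [leRHS]mulrCA ler_wpM2l ?exprn_ge0//.
    rewrite mulrA ler_wpM2r ?expR_ge0// expRN ler_pdivrMr ?expR_gt0//.
  rewrite /pseries/series/=; apply: (le_trans (ler_norm_sum _ _ _)).
  apply: (@le_trans _ _ (expR (4 * y) * series (exp_coeff (2^-1 * X x)) n)); last first.
    by rewrite ler_wpM2l ?expR_ge0// exp_le.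
  rewrite /series/= mulr_sumr; apply: ler_sum => m _.
  apply: (le_trans (norm_bessel_coef _ _ b2)).
  rewrite ger0_norm// (_ : 2 * (y * X x) = (4 * y) * (2^-1 * X x)); last by field.
  have ay : 0 <= 4 * y by rewrite mulr_ge0.
  rewrite (_ : _ / _ / _ = ((4 * y) ^+ m / m`!%:R) * exp_coeff (2^-1 * X x) m).
    by rewrite ler_wpM2r ?coef_le// exp_coeff_ge0.
  by rewrite exprMn /exp_coeff/=; ring.
have mf n : measurable_fun setT (f n).
  apply: measurable_sum => m; apply: measurable_funM => //.
  exact: measurable_expow.
have ig : mu.-integrable setT (EFin \o g).
  rewrite (_ : _ \o _ = (fun x => (expR (4 * y))%:E * (expow 2^-1 k x)%:E)%E)//.
  by apply: integrableZl => //; apply: integrable_expow.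
have [_ cI] := Rintegral_dominated mf cf ig fg.
rewrite -(cvg_lim _ cI)//; apply/cvg_lim => //.
rewrite (_ : (fun n => _) = (fun n => A * Gamma b *
    series (fun m => exp_coeff (- y) m * poch (b + m%:R) k) n)).
  by apply: cvgMr; exact: cvg_poch_exp.
apply/funext => n; rewrite (@Rintegral_lincomb _ _ _ _ (fun m => expow 1 (m + k))
  (fun m => bessel_coef b m * y ^+ m)); last by move=> m; exact: integrable_expow.
rewrite /series/= big_mkord mulr_sumr; apply: eq_bigr => m _.
rewrite Rintegral_expow// powR1 divr1 Gamma_poch// pochD /bessel_coef /exp_coeff/= (exprNn y).
have p0 : poch b m != 0 by rewrite gt_eqF// poch_gt0.
by field; rewrite p0 pnatr_eq0 -lt0n fact_gt0.
Qed.

Lemma integrable_hankel_expow y k t : 0 <= y -> 0 < t ->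
  mu.-integrable setT (EFin \o (fun x => hankel_kernel y x * expow t k x)).
Proof.
move=> y0 t0; apply: le_integrable (integrable_expow k t0) => //.
  apply/measurable_EFinP; apply: measurable_funM; last exact: measurable_expow.
  exact: measurable_hankel_kernel.
move=> x _ /=; rewrite lee_fin normrM ler_piMl// bessel_ser_le1//.
by rewrite mulr_ge0.
Qed.

(** For [y = X r] the right-hand side is [A * Gamma b] times [(-1)^l lag_fun l r]: the Laguerre
    functions are eigenfunctions of the transform. *)
Lemma hankel_lag_fun l y : 0 <= y ->
  \int[mu]_x (hankel_kernel y x * lag_fun l x) =
  A * Gamma b * ((-1) ^+ l * (lag_norm l * (laguerre alpha l).[2 * y] * expR (- y))).
Proof.
move=> y0; transitivity (\int[mu]_x (\sum_(k < l.+1) (lag_norm l * lag_coef alpha l k * 2 ^+ k) *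
    (hankel_kernel y x * expow 1 k x))).
  apply: eq_Rintegral => x _; rewrite /lag_fun laguerreE.
  transitivity (hankel_kernel y x * lag_norm l * expR (- X x) *
    \sum_(j < l.+1) lag_coef alpha l j * (2 * X x) ^+ j); first by ring.
  rewrite mulr_sumr; apply: eq_bigr => j _; rewrite /expow mul1r exprMn; ring.
rewrite (@Rintegral_lincomb _ _ _ _ (fun k x => hankel_kernel y x * expow 1 k x)
  (fun k => lag_norm l * lag_coef alpha l k * 2 ^+ k)); last first.
  by move=> k; exact: integrable_hankel_expow.
transitivity (A * Gamma b * expR (- y) * lag_norm l *
    \sum_(k < l.+1) lag_coef alpha l k * 2 ^+ k * laguerre_rising b k y).
  by rewrite mulr_sumr; apply: eq_bigr => k _; rewrite hankel_expow//; ring.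
by rewrite sum_laguerre_rising//; ring.
Qed.

End laguerre_abstract.

(** * Completeness of the Laguerre functions *)

Section exponential_bounds.
Context {R : realType}.
Implicit Types (x z h : R) (n : nat).

Lemma series_exp_coeff_le z n : 0 <= z -> series (exp_coeff z) n <= expR z.
Proof.
move=> z0; apply: nondecreasing_cvgn_le; last exact: is_cvg_series_exp_coeff.
by apply: nondecreasing_series => m _ _; exact: exp_coeff_ge0.
Qed.

Lemma expr_fact_le z n : 0 <= z -> z ^+ n / n`!%:R <= expR z.
Proof.
move=> z0; apply: le_trans (series_exp_coeff_le n.+1 z0).
rewrite /series/= big_nat_recr//= lerDr sumr_ge0// => m _.
exact: exp_coeff_ge0.
Qed.

Lemma bernoulli_1B z n : 0 <= z <= 1 -> 1 - n%:R * z <= (1 - z) ^+ n.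
Proof.
move=> /andP[z0 z1]; elim: n => [|n IH]; first by rewrite mul0r subr0.
rewrite exprS; apply: (@le_trans _ _ ((1 - z) * (1 - n%:R * z))); last first.
  by rewrite ler_wpM2l// subr_ge0.
have : 0 <= n%:R * z * z by rewrite !mulr_ge0.
by rewrite -natr1; lra.
Qed.

(* The functions [thr n], applied to [h = ln 2 / c * (X - c)], are polynomials in
   [2 ^ (- X / c)] which converge boundedly to the indicator of [X > c]. *)
Let thr n h : R := (1 - (expR (- h) / 2) ^+ n) ^+ (n * 2 ^ n).

Let thr01 n h : - ln 2 <= h -> 0 <= (expR (- h) / 2) ^+ n <= 1.
Proof.
move=> h2; rewrite exprn_ge0 ?divr_ge0 ?expR_ge0//=.
rewrite exprn_ile1 ?divr_ge0 ?expR_ge0// ler_pdivrMr// mul1r.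
by rewrite -[leRHS](@lnK R) ?posrE// ler_expR lerNl.
Qed.

Lemma threshold_bound n h : - ln 2 <= h -> `|thr n h| <= 1.
Proof.
move=> h2; have /andP[z0 z1] := thr01 n h2.
by rewrite /thr ger0_norm ?exprn_ge0 ?subr_ge0// exprn_ile1 ?subr_ge0// gerBl.
Qed.

Let thrE n h : (n * 2 ^ n)%:R * (expR (- h) / 2) ^+ n = n%:R * expR (- h) ^+ n.
Proof.
by rewrite natrM natrX exprMn exprVn; field; rewrite expf_neq0.
Qed.

(** With [z = (e^{-h} / 2)^n] and [M = n 2^n], the power [(1 - z)^M] lies between [1 - M z] and
    [e^{-M z}]. By [thrE], [M z = n e^{-n h}], which tends to [0] for [h > 0] and is at least [n]
    for [h <= 0]. *)
Lemma cvg_threshold h : - ln 2 <= h ->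
  thr n h @[n --> \oo] --> ((0 < h)%R%:R : R).
Proof.
move=> h2; have [h0|h0] := ltP 0 h.
  apply: (@squeeze_cvgr _ _ _ _ (fun n => 1 - 2 / h ^+ 2 * n%:R^-1) (cst 1)).
  - near=> n; have /andP[z0 z1] := thr01 n h2; apply/andP; split; last first.
      by rewrite exprn_ile1 ?subr_ge0// gerBl.
    apply: le_trans (bernoulli_1B _ _); last by rewrite z0.
    rewrite lerD2l lerN2 thrE -expRM_natl mulrN expRN.
    have n0 : 0 < n%:R :> R by rewrite ltr0n; near: n; exists 1%N.
    have nh : 0 <= n%:R * h by rewrite mulr_ge0// ltW.
    have e1 : (n%:R * h) ^+ 2 / 2 <= expR (n%:R * h) := @expr_fact_le (n%:R * h) 2 nh.
    rewrite ler_pdivrMr ?expR_gt0//.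
    apply: (@le_trans _ _ (2 / h ^+ 2 / n%:R * ((n%:R * h) ^+ 2 / 2))).
      by rewrite le_eqVlt; apply/orP; left; apply/eqP; field; rewrite !gt_eqF.
    by rewrite ler_wpM2l// !divr_ge0// sqr_ge0.
  - rewrite -[X in _ --> X]subr0; apply: cvgB; first exact: cvg_cst.
    rewrite -[X in _ --> X](mulr0 (2 / h ^+ 2)); apply: cvgMr.
    apply/gtr0_cvgV0; first by near=> n; rewrite ltr0n; near: n; exists 1%N.
    exact: cvgr_idn.
  - exact: cvg_cst.
apply: (@squeeze_cvgr _ _ _ _ (cst 0) (fun n => (n.+1%:R)^-1)).
- near=> n; have /andP[z0 z1] := thr01 n h2.
  rewrite exprn_ge0 ?subr_ge0//=.
  apply: (@le_trans _ _ (expR (- ((n * 2 ^ n)%:R * (expR (- h) / 2) ^+ n)))).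
    rewrite -mulrN expRM_natl lerXn2r ?nnegrE ?subr_ge0 ?expR_ge0//.
    exact: expR_ge1Dx.
  rewrite expRN lef_pV2 ?posrE ?expR_gt0// thrE.
  apply: le_trans (expR_ge1Dx _); rewrite -natr1 addrC lerD2l ler_peMr//.
  by rewrite exprn_ege1// -expR0 ler_expR oppr_ge0.
- exact: cvg_cst.
- exact: cvg_harmonic.
Unshelve. all: by end_near. Qed.

End exponential_bounds.

Section laguerre_complete.
Context d (T : measurableType d) (R : realType) (mu : {measure set T -> \bar R}).
Variables (X : T -> R) (A alpha : R).
Hypotheses (mX : measurable_fun setT X) (X0 : forall x, 0 <= X x).
Hypotheses (A0 : 0 < A) (alpha2 : - (1 / 2) <= alpha).
Local Notation expow := (expow X).
Local Notation lag_fun := (lag_fun X A alpha).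

Variable D : T -> R.
Hypothesis mD : measurable_fun setT D.
Hypothesis iD : mu.-integrable setT (EFin \o (fun x => D x * expow 2^-1 0 x)).
Hypothesis D_orth : forall l, \int[mu]_x (D x * lag_fun l x) = 0.

Let norm_Dexpow t k x : `|D x * expow t k x| = `|D x| * expow t k x.
Proof. by rewrite normrM (ger0_norm (expow_ge0 X0 t k x)). Qed.

(** The excess [e = t - 1/2] of the exponent absorbs the power, through
    [X^k <= k! e^{e X} / e^k]. *)
Let iDe t k : 2^-1 < t -> mu.-integrable setT (EFin \o (fun x => D x * expow t k x)).
Proof.
move=> t2; pose e := t - 2^-1; have e0 : 0 < e by rewrite subr_gt0.
pose C := k`!%:R / e ^+ k.
have iCD : mu.-integrable setT (EFin \o (fun x => C * (D x * expow 2^-1 0 x))).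
  rewrite (_ : _ \o _ = (fun x => C%:E * (D x * expow 2^-1 0 x)%:E)%E)//.
  exact: integrableZl.
apply: (le_integrable _ _ _ iCD) => //.
  by apply/measurable_EFinP; apply: measurable_funM => //; exact: measurable_expow.
move=> x _; rewrite /= lee_fin [`|C * _|]normrM !norm_Dexpow [leRHS]mulrCA ler_wpM2l//.
rewrite ger0_norm ?divr_ge0 ?exprn_ge0 ?(ltW e0)//.
rewrite /expow expr0 mul1r.
have -> : - (t * X x) = - (e * X x) + - (2^-1 * X x) by rewrite /e; ring.
rewrite expRD mulrA ler_wpM2r ?expR_ge0// expRN ler_pdivrMr ?expR_gt0//.
have := @expr_fact_le R (e * X x) k; rewrite mulr_ge0 ?(ltW e0)// => /(_ isT) h.
rewrite /C mulrAC ler_pdivlMr ?exprn_gt0// mulrC -exprMn.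
by rewrite -ler_pdivrMl ?ltr0n ?fact_gt0// mulrC.
Qed.

Let vanish t := forall k, \int[mu]_x (D x * expow t k x) = 0.

Let half1 : (2^-1 : R) < 1. Proof. by lra. Qed.

(** Each Laguerre polynomial has a nonzero leading coefficient, so orthogonality to [lag_fun k] and
    the induction hypothesis for the lower powers isolate the integral with [X^k]. *)
Let vanish1 : vanish 1.
Proof.
move=> k; elim/ltn_ind: k => k IH.
have alpha1 : -1 < alpha by apply: lt_le_trans alpha2; lra.
pose c j := lag_norm A alpha k * lag_coef alpha k j * 2 ^+ j.
have : \int[mu]_x (\sum_(j < k.+1) c j * (D x * expow 1 j x)) = 0.
  rewrite -[RHS](D_orth k); apply: eq_Rintegral => x _.
  rewrite /lag_fun laguerreE//.
  transitivity (lag_norm A alpha k * D x * expR (- X x) *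
      \sum_(j < k.+1) lag_coef alpha k j * (2 * X x) ^+ j); last first.
    by move: (lag_norm _ _ _) (bigop _ _ _) => ? ?; ring.
  rewrite mulr_sumr; apply: eq_bigr => j _; rewrite /c /expow mul1r exprMn.
  by move: (lag_norm _ _ _) (lag_coef _ _ _) => ? ?; ring.
rewrite (@Rintegral_lincomb _ _ _ _ (fun j x => D x * expow 1 j x) c); last first.
  by move=> j; exact: iDe.
rewrite big_ord_recr/= big1 ?add0r; last by move=> j _; rewrite IH// mulr0.
move=> /eqP; rewrite mulf_eq0 => /orP[|/eqP//].
rewrite /c lag_coef_diag// 2!mulf_eq0 => /orP[/orP[/eqP n0|]|].
- have := lag_norm_sqr A0 alpha2 k; rewrite n0 expr0n/= !mul0r => /eqP.
  by rewrite eq_sym oner_eq0.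
- by rewrite mulf_eq0 signr_eq0 invr_eq0 pnatr_eq0 -leqn0 leqNgt fact_gt0.
- by rewrite expf_eq0 pnatr_eq0 andbF.
Qed.

(** The partial sums of [e^{-eX}] are bounded by [e^{eX}], so [|D| X^k e^{-(t-e)X}] dominates. It is
    integrable because [t - e >= 3/4 > 1/2]. As [vanish] speaks of all powers of [X], every term of
    the expansion integrates to zero and the step can be repeated. *)
Let vanishD t e : 1 <= t -> 0 <= e <= 4^-1 -> vanish t -> vanish (t + e).
Proof.
move=> t1 /andP[e0 e4] vt k.
pose f n x := \sum_(j < n) ((- e) ^+ j / j`!%:R) * (D x * expow t (k + j) x).
have fE n x : f n x = series (exp_coeff (- (e * X x))) n * (D x * expow t k x).
  rewrite /f /series/= big_mkord mulr_suml; apply: eq_bigr => j _.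
  have -> : exp_coeff (- (e * X x)) j = (- e) ^+ j * X x ^+ j / j`!%:R.
    by rewrite /exp_coeff/= -mulNr exprMn.
  rewrite /expow exprD.
  by move: (expR _) => ?; ring.
have mf n : measurable_fun setT (f n).
  apply: measurable_sum => j; apply: measurable_funM => //.
  by apply: measurable_funM => //; exact: measurable_expow.
have cf x : f n x @[n --> \oo] --> D x * expow (t + e) k x.
  have -> : D x * expow (t + e) k x = expR (- (e * X x)) * (D x * expow t k x).
    rewrite /expow (_ : - ((t + e) * X x) = - (e * X x) + - (t * X x)); last by ring.
    by rewrite expRD; ring.
  under eq_fun do rewrite fE.
  apply: cvgM; last exact: cvg_cst.
  exact: is_cvg_series_exp_coeff.
have te : 2^-1 < t - e by lra.
have [] := @Rintegral_dominated _ _ _ mu f (fun x => D x * expow (t + e) k x)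
  (fun x => `|D x * expow (t - e) k x|) mf cf.
- rewrite (_ : _ \o _ = (fun x => `|(D x * expow (t - e) k x)%:E|)%E)//.
  by apply: integrable_abse; exact: iDe.
- move=> n x; rewrite fE normrM !norm_Dexpow.
  have eX : 0 <= e * X x by rewrite mulr_ge0.
  rewrite mulrCA ler_wpM2l// /expow.
  rewrite (_ : - ((t - e) * X x) = e * X x + - (t * X x)); last by ring.
  rewrite expRD mulrCA ler_wpM2l ?exprn_ge0// ler_wpM2r ?expR_ge0//.
  apply: le_trans (series_exp_coeff_le n eX).
  rewrite /series/=; apply: (le_trans (ler_norm_sum _ _ _)); apply: ler_sum => j _.
  by rewrite /exp_coeff/= normrM normrX normrN (ger0_norm eX) normfV normr_nat.
move=> _ cI; rewrite -(cvg_lim _ cI)//; apply/cvg_lim => //.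
rewrite (_ : (fun n => _) = cst 0); first exact: cvg_cst.
apply/funext => n; rewrite (@Rintegral_lincomb _ _ _ _ (fun j x => D x * expow t (k + j) x)
  (fun j => (- e) ^+ j / j`!%:R)); last by move=> j; apply: iDe; lra.
by rewrite big1// => j _; rewrite vt mulr0.
Qed.

Let vanish_ge1 t : 1 <= t -> vanish t.
Proof.
move=> t1; pose N := (Num.bound (4 * (t - 1))).+1.
pose e := (t - 1) / N%:R.
have N0 : 0 < N%:R :> R by rewrite ltr0n.
have e0 : 0 <= e by rewrite divr_ge0// subr_ge0.
have e4 : e <= 4^-1.
  rewrite ler_pdivrMr// ler_pdivlMl//.
  rewrite (le_trans (ltW (archi_boundP _)))//; first by rewrite mulr_ge0// subr_ge0.
  by rewrite ler_nat.
have h n : vanish (1 + n%:R * e).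
  elim: n => [|n IH]; first by rewrite mul0r addr0.
  rewrite -natr1 mulrDl mul1r addrA; apply: vanishD => //; last by rewrite e0.
  by rewrite lerDl mulr_ge0.
have -> : t = 1 + N%:R * e by rewrite /e mulrC divfK ?gt_eqF// addrC subrK.
exact: h.
Qed.

Lemma laguerre_complete_total : \int[mu]_x (D x * expow 1 0 x) = 0.
Proof. exact: vanish1. Qed.

Lemma laguerre_complete_ray c : 0 < c ->
  \int[mu]_x (D x * expow 1 0 x * (c < X x)%R%:R) = 0.
Proof.
move=> c0; pose h x := ln 2 / c * (X x - c).
have l20 : 0 < ln 2 :> R by rewrite ln_gt0// ltr1n.
have hge x : - ln 2 <= h x.
  by rewrite /h mulrBr divfK ?gt_eqF// lerBrDr addrC subrr mulr_ge0// divr_ge0 ?ltW.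
have hE x : (0 < h x) = (c < X x).
  by rewrite /h pmulr_rgt0 ?divr_gt0// subr_gt0.
pose f n x := D x * expow 1 0 x * (1 - (expR (- h x) / 2) ^+ n) ^+ (n * 2 ^ n).
have yE x : expR (- h x) / 2 = expR (- (ln 2 / c * X x)).
  by rewrite /h mulrBr divfK ?gt_eqF// opprB expRD lnK ?posrE//; field.
have mh : measurable_fun setT h.
  by apply: measurable_funM => //; exact: measurable_funB.
have me : measurable_fun setT (fun x => D x * expow 1 0 x).
  by apply: measurable_funM => //; exact: measurable_expow.
have mf n : measurable_fun setT (f n).
  apply: measurable_funM => //; apply: measurable_funX; apply: measurable_funB => //.
  apply: measurable_funX; apply: measurable_funM => //.
  by apply: measurableT_comp => //; exact: measurableT_comp.
have cf x : f n x @[n --> \oo] --> D x * expow 1 0 x * (c < X x)%R%:R.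
  by apply: cvgM; [exact: cvg_cst|rewrite -hE; exact: cvg_threshold].
have [] := @Rintegral_dominated _ _ _ mu f (fun x => D x * expow 1 0 x * (c < X x)%R%:R)
  (fun x => `|D x * expow 1 0 x|) mf cf.
- rewrite (_ : _ \o _ = (fun x => `|(D x * expow 1 0 x)%:E|)%E)//.
  by apply: integrable_abse; exact: iDe.
- by move=> n x; rewrite normrM ler_piMr// threshold_bound.
move=> _ cI; rewrite -(cvg_lim _ cI)//; apply/cvg_lim => //.
rewrite (_ : (fun n => _) = cst 0); first exact: cvg_cst.
apply/funext => n; pose N := (n * 2 ^ n)%N.
(* With [y = e^{-(ln 2 / c) X}], the term [e^{-X} y^(n i)] of the binomial expansion is
   [e^{-s_i X}], and [s_i >= 1] is in the range of [vanish_ge1]. *)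
pose s i : R := 1 + i%:R * n%:R * (ln 2 / c).
have s1 i : 1 <= s i by rewrite lerDl !mulr_ge0 ?invr_ge0// ltW.
transitivity (\int[mu]_x (\sum_(i < N.+1) ((-1) ^+ i * 'C(N, i)%:R) * (D x * expow (s i) 0 x))).
  apply: eq_Rintegral => x _; rewrite /f yE -/N exprBn mulr_sumr.
  apply: eq_bigr => i _; rewrite expr1n mulr1 -mulr_natr /expow !expr0 !mul1r.
  have -> : - (s i * X x) = - X x + i%:R * (n%:R * - (ln 2 / c * X x)) by rewrite /s; ring.
  by rewrite expRD -!expRM_natl; move: (expR _) (expR _) => ? ?; ring.
rewrite (@Rintegral_lincomb _ _ _ _ (fun i x => D x * expow (s i) 0 x)
  (fun i => (-1) ^+ i * 'C(N, i)%:R)); last first.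
  by move=> i; apply: iDe; apply: lt_le_trans (s1 i).
by rewrite big1// => i _; rewrite vanish_ge1// mulr0.
Qed.

End laguerre_complete.

(** * Functions whose integrals over all rays vanish *)

Section ae_zero.
Context {R : realType}.
Variable mu : {measure set (measurableTypeR R) -> \bar R}.

(** Dynkin's theorem: the rays are stable under intersection and generate the Borel sets, and the
    sets on which the integral of [H] vanishes form a Dynkin system. The integral over the whole
    line handles complements. *)
Lemma ae_eq0_ray (H : measurableTypeR R -> R) :
  mu.-integrable setT (EFin \o H) -> \int[mu]_x H x = 0 ->
  (forall c : R, \int[mu]_(x in `]c, +oo[) H x = 0) ->
  {ae mu, forall x, H x = 0}.
Proof.
move=> iH H0 Hc.
have iHE (E : set (measurableTypeR R)) : measurable E -> mu.-integrable E (EFin \o H).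
  by move=> mE; exact: integrableS iH.
have key (E : set (measurableTypeR R)) : measurable E -> \int[mu]_(x in E) H x = 0.
  move=> mE.
  have mG : (@measurable _ (measurableTypeR R)) = <<s (@RGenOInfty.G R) >>.
    exact: RGenOInfty.measurableE.
  have := @dynkin_induction _ _ (@RGenOInfty.G R) (fun E => \int[mu]_(x in E) H x = 0) mG.
  move=> /(_ _ _ _ _ _ E); apply.
  - move=> _ _ [a ->] [b ->]; exists (Num.max a b); apply/seteqP; split => x/=;
      by rewrite !in_itv/= !andbT gt_max => /andP.
  - exact: H0.
  - by move=> _ [c ->]; exact: Hc.
  - move=> S mS HS.
    have := @Rintegral_setU _ _ _ mu S (~` S) H mS (measurableC mS).
    rewrite setUv H0 HS add0r => <-//.
    by apply/disj_setPS => x [].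
  - move=> F mF tF HF; rewrite /Rintegral integral_bigcup//; last first.
      by apply: iHE; exact: bigcupT_measurable.
    rewrite eseries0// => n _ _.
    have : \int[mu]_(x in F n) H x = 0 := HF n.
    rewrite /Rintegral => h; rewrite -(@fineK _ (\int[mu]_(x in F n) _)%E) ?h//.
    exact: (@integrable_fin_num _ _ _ mu (F n) (mF n) _ (iHE _ (mF n))).
  - by rewrite -mG.
have := @integral_ae_eq _ _ _ mu setT measurableT (cst 0%E) (EFin \o H) iH.
move=> /(_ _ _)[//|E _ mE|].
  rewrite integral0 -(@fineK _ (\int[mu]_(x in E) _)%E).
    by have := key E mE; rewrite /Rintegral => ->.
  exact: (@integrable_fin_num _ _ _ mu E mE _ (iHE _ mE)).
move=> N NP; exists N; move: NP => [mN N0 NS]; split => // x /= Hx; apply: NS => /= h.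
by apply: Hx; have := h I => -[].
Qed.

End ae_zero.

(** * Action of the Hankel transform on the Laguerre basis *)

Section laguerre_transform.
Context d (T : measurableType d) (R : realType).
Variables (mu : {sigma_finite_measure set T -> \bar R}).
Variables (X : T -> R) (A alpha : R).
Hypotheses (mX : measurable_fun setT X) (X0 : forall x, 0 <= X x).
Hypotheses (A0 : 0 < A) (alpha2 : - (1 / 2) <= alpha).
Local Notation b := (alpha + 1).
Hypothesis moment : forall k t, 0 < t ->
  (\int[mu]_x (X x ^+ k * expR (- (t * X x)))%:E =
   (A * Gamma (b + k%:R) / t `^ (b + k%:R))%:E)%E.
Local Notation phi := (lag_fun X A alpha).
Local Notation K r := (hankel_kernel X alpha (X r)).
Implicit Types (f g h psi : T -> R).

Let b2 : 1 / 2 <= b. Proof. by rewrite -lerBlDr; apply: le_trans alpha2; lra. Qed.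
Let b0 : 0 < b. Proof. by apply: lt_le_trans b2. Qed.
Let phi2 l : sqint mu (phi l).
Proof. exact: (@sqint_lag_fun _ _ _ mu X A alpha mX X0 moment). Qed.
Let phi_orth l m : ip mu (phi l) (phi m) = (l == m)%:R.
Proof. exact: (lag_fun_orthonormal mX X0 A0 alpha2 moment). Qed.

Let integrable_phi l : mu.-integrable setT (EFin \o phi l).
Proof.
have := integrable_poly_exp mX X0 moment
  (lag_norm A alpha l *: (laguerre alpha l \Po (2 *: 'X))) ltr01.
apply: eq_integrable => // x _ /=.
by rewrite /lag_fun hornerZ horner_comp hornerZ hornerX (mul1r (X x)).
Qed.

Lemma hankel_kernel_le1 r s : `|K r s| <= 1.
Proof. by rewrite bessel_ser_le1// mulr_ge0. Qed.

Lemma integrable_mul_kernel h r : mu.-integrable setT (EFin \o h) ->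
  mu.-integrable setT (EFin \o (fun s => h s * K r s)).
Proof.
move=> ih; have mh : measurable_fun setT h by case/integrableP : ih => /measurable_EFinP.
apply: (le_integrable _ _ _ ih) => //.
  apply/measurable_EFinP; apply: measurable_funM => //.
  exact: measurable_hankel_kernel.
by move=> s _; rewrite /= lee_fin normrM ler_piMr// hankel_kernel_le1.
Qed.

(** The kernel is bounded by [1], so the integrable product [h(s) psi(r)] dominates. *)
Lemma integrable_kernel_prod h psi :
  mu.-integrable setT (EFin \o h) -> mu.-integrable setT (EFin \o psi) ->
  (mu \x mu)%E.-integrable setT (fun z => (h z.2 * K z.1 z.2 * psi z.1)%:E).
Proof.
move=> ih ip.
have mh : measurable_fun setT h by case/integrableP : ih => /measurable_EFinP.
have mp : measurable_fun setT psi by case/integrableP : ip => /measurable_EFinP.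
have mh2 : measurable_fun setT (fun z : T * T => h z.2) by exact: measurableT_comp.
have mp1 : measurable_fun setT (fun z : T * T => psi z.1) by exact: measurableT_comp.
have mX1 : measurable_fun setT (fun z : T * T => X z.1) by exact: measurableT_comp.
have mX2 : measurable_fun setT (fun z : T * T => X z.2) by exact: measurableT_comp.
have mK : measurable_fun setT (fun z : T * T => K z.1 z.2).
  apply: (@measurableT_comp _ _ _ _ _ _ (bessel_ser b)); last exact: measurable_funM.
  by apply: continuous_measurable_fun; exact: continuous_bessel_ser.
have i1 : (mu \x mu)%E.-integrable setT (fun z => (h z.2 * psi z.1)%:E).
  apply/integrable12ltyP; first by apply/measurable_EFinP; exact: measurable_funM.
  under eq_integral => x _.
    under eq_integral do rewrite /= normrM mulrC EFinM.
    rewrite ge0_integralZl_EFin//; last first.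
      by apply/measurable_EFinP; exact: measurableT_comp.
    over.
  have ihf : (\int[mu]_y `|h y|%:E \is a fin_num)%E.
    by apply: integrable_fin_num => //; exact: (integrable_abse ih).
  rewrite -(fineK ihf); under eq_integral do rewrite muleC.
  rewrite ge0_integralZl_EFin//.
  - case/integrableP : ip => _ hp; rewrite -ge0_fin_numE; last first.
      by rewrite mule_ge0 ?integral_ge0// lee_fin fine_ge0// integral_ge0.
    rewrite fin_numM// ge0_fin_numE// integral_ge0//.
  - by apply/measurable_EFinP; exact: measurableT_comp.
  - by rewrite fine_ge0// integral_ge0.
apply: (le_integrable _ _ _ i1) => //.
  by apply/measurable_EFinP; apply: measurable_funM => //; exact: measurable_funM.
move=> z _ /=; rewrite lee_fin !normrM ler_wpM2r// ler_piMr//; exact: hankel_kernel_le1.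
Qed.

(** Fubini, followed by the symmetry of the kernel, which presents the inner integral on the right
    as a transform of [psi], ready for [hankel_lag_fun]. *)
Lemma kernel_fubini h psi :
  mu.-integrable setT (EFin \o h) -> mu.-integrable setT (EFin \o psi) ->
  \int[mu]_r ((\int[mu]_s (h s * K r s)) * psi r) =
  \int[mu]_s (h s * \int[mu]_r (K s r * psi r)).
Proof.
move=> ih ipsi; have iz := integrable_kernel_prod ih ipsi.
have := Fubini iz; rewrite /Rintegral => /(congr1 fine) /=.
move=> h1; transitivity (fine (\int[mu]_x \int[mu]_y (h y * K x y * psi x)%:E)%E).
  congr fine; apply: eq_integral => x _.
  have -> : (\int[mu]_y (h y * K x y * psi x)%:E)%E = ((\int[mu]_y (h y * K x y)) * psi x)%:E.
    rewrite EFinM /Rintegral fineK; last first.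
      by apply: integrable_fin_num => //; exact: integrable_mul_kernel.
    under [in LHS]eq_integral do rewrite EFinM.
    by rewrite integralZr//; exact: integrable_mul_kernel.
  by [].
rewrite h1; congr fine; apply: eq_integral => y _.
have -> : (\int[mu]_x (h y * K x y * psi x)%:E)%E = (h y * \int[mu]_x (K y x * psi x))%:E.
  have KC x : h y * K x y * psi x = h y * (psi x * K y x).
    by rewrite /hankel_kernel (mulrC (X x)); ring.
  under eq_integral do rewrite KC EFinM.
  rewrite integralZl//; last exact: integrable_mul_kernel.
  rewrite EFinM /Rintegral; congr (_ * _)%E.
  under [in RHS]eq_integral do rewrite mulrC.
  by rewrite fineK//; apply: integrable_fin_num => //; exact: integrable_mul_kernel.
by [].
Qed.

Definition htrans h r : R := (A * Gamma b)^-1 * \int[mu]_s (h s * K r s).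

Lemma htrans_bounded h r : mu.-integrable setT (EFin \o h) ->
  `|htrans h r| <= (A * Gamma b)^-1 * \int[mu]_s `|h s|.
Proof.
move=> ih; have g0 : 0 < Gamma b by exact: Gamma_gt0.
have AG : 0 <= (A * Gamma b)^-1 by rewrite invr_ge0 mulr_ge0 ?(ltW A0) ?(ltW g0).
rewrite normrM (ger0_norm AG); apply: ler_wpM2l => //.
have ihK := integrable_mul_kernel r ih.
apply: (le_trans (le_normr_Rintegral _ ihK)) => //.
apply: le_Rintegral => //.
- exact: (integrable_norm ihK).
- exact: (integrable_norm ih).
- by move=> s _; rewrite normrM ler_piMr// hankel_kernel_le1.
Qed.

Lemma measurable_htrans h : mu.-integrable setT (EFin \o h) ->
  measurable_fun setT (htrans h).
Proof.
(* The measure may be infinite, so [h(s) K r s] need not be integrable on the product. Measurability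
   is obtained after multiplication by [e^{-X r}], which is then divided out. *)
move=> ih; have ie : mu.-integrable setT (EFin \o expow X 1 0).
  by apply: (integrable_expow _ _ moment).
have := measurable_fubini_F (integrable_kernel_prod ih ie).
rewrite /fubini_F /= => mF; apply: measurable_funM => //.
have -> : (fun r => \int[mu]_s (h s * K r s)) =
   (fun r => fine (\int[mu]_y (h y * K r y * expow X 1 0 r)%:E)%E * expR (X r)).
  apply/funext => r; under eq_integral do rewrite EFinM.
  rewrite integralZr//; last exact: integrable_mul_kernel.
  rewrite fineM//; last by apply: integrable_fin_num => //; exact: integrable_mul_kernel.
  rewrite /= -[LHS]mulr1 -mulrA; congr (_ * _).
  by rewrite /expow expr0 !mul1r mulrC expRxMexpNx_1.
apply: measurable_funM; first exact: measurableT_comp.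
exact: measurableT_comp.
Qed.

Lemma integrable_htransM h psi : mu.-integrable setT (EFin \o h) ->
  mu.-integrable setT (EFin \o psi) ->
  mu.-integrable setT (EFin \o (fun r => htrans h r * psi r)).
Proof.
move=> ih ipsi.
have mp : measurable_fun setT psi by case/integrableP : ipsi => /measurable_EFinP.
pose C := (A * Gamma b)^-1 * \int[mu]_s `|h s|.
have C0 : 0 <= C by rewrite mulr_ge0 ?invr_ge0 ?mulr_ge0 ?(ltW A0) ?(ltW (Gamma_gt0 b0))//;
  apply: Rintegral_ge0.
have iC : mu.-integrable setT (EFin \o (fun r => C * psi r)).
  rewrite (_ : _ \o _ = (fun r => C%:E * (psi r)%:E)%E)//; exact: integrableZl.
apply: (le_integrable _ _ _ iC) => //.
  by apply/measurable_EFinP; apply: measurable_funM => //; exact: measurable_htrans.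
move=> r _; rewrite /= lee_fin [`|C * _|]normrM [`|htrans _ _ * _|]normrM ler_wpM2r// (ger0_norm C0).
exact: htrans_bounded.
Qed.

Lemma htrans_ip h l : mu.-integrable setT (EFin \o h) -> sqint mu h ->
  \int[mu]_r (htrans h r * phi l r) = (-1) ^+ l * ip mu h (phi l).
Proof.
move=> ih sh; have iphi := integrable_phi l; have g0 : 0 < Gamma b by exact: Gamma_gt0.
have AG : A * Gamma b != 0 by rewrite mulf_neq0 ?gt_eqF.
under eq_Rintegral do rewrite /htrans -mulrA.
rewrite RintegralZl//; last first.
  have := integrable_htransM ih iphi; rewrite /htrans => i1.
  have := @integrableZl _ _ _ mu setT measurableT (A * Gamma b) _ i1.
  apply: eq_integrable => // x _; rewrite /= -EFinM; congr EFin.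
  by rewrite mulrA mulVKf.
rewrite kernel_fubini// /ip.
under eq_Rintegral do rewrite (hankel_lag_fun mX X0 alpha2 moment)//.
transitivity ((A * Gamma b)^-1 *
    \int[mu]_s ((A * Gamma b * (-1) ^+ l) * (h s * phi l s))).
  congr (_ * _); apply: eq_Rintegral => s _; rewrite /lag_fun.
  by move: (lag_norm _ _ _) (Gamma _) (h s) (expR _) (_.[_]) ((-1) ^+ l) => *; ring.
rewrite RintegralZl//; last exact: sqint_mul.
by rewrite -mulrA mulKf.
Qed.

Definition reflected_sum f n := psum phi (fun l => (-1) ^+ l * ip mu f (phi l)) n.

(* [g] is the image of [f] under [phi_l |-> (-1)^l phi_l]. *)
Definition is_reflection f g := sqint mu g /\
  (fun n => ip mu (fun x => reflected_sum f n x - g x)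
                  (fun x => reflected_sum f n x - g x)) @ \oo --> (0 : R).

Let sqint_rsum f n : sqint mu (reflected_sum f n). Proof. exact: sqint_psum. Qed.

Lemma reflection_exists f : sqint mu f -> exists g, is_reflection f g.
Proof.
move=> sf.
apply: (riesz_fischer phi2 phi_orth (M := ip mu f f)) => n.
under eq_bigr do rewrite exprMn sqrr_sign mul1r.
exact: (bessel_inequality phi2 phi_orth).
Qed.

(** Partial sums obey Bessel's inequality, and [g] is a partial sum minus an error tending to zero.
    The crude constant [2] of [ip_norm2B] suffices for the continuity wanted in
    [creflection_L2ext]. *)
Lemma reflection_le f g : sqint mu f -> is_reflection f g -> ip mu g g <= 2 * ip mu f f.
Proof.
move=> sf [sg fg].
have h1 : (fun n => 2 * ip mu f f + 2 * ip mu (fun x => reflected_sum f n x - g x)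
      (fun x => reflected_sum f n x - g x)) @ \oo --> 2 * ip mu f f + 2 * 0.
  by apply: cvgD; [exact: cvg_cst|exact: cvgMl_tmp].
rewrite mulr0 addr0 in h1; apply: (cvgr_to_ge h1); apply: nearW => n.
have -> : ip mu g g = ip mu (fun x => reflected_sum f n x - (reflected_sum f n x - g x))
                     (fun x => reflected_sum f n x - (reflected_sum f n x - g x)).
  by apply: eq_Rintegral => x _; rewrite subKr.
apply: (le_trans (ip_norm2B (sqint_rsum f n) (sqintB (sqint_rsum f n) sg))).
rewrite lerD2r ler_wpM2l// (ip_psum_psum phi2 phi_orth) minnn.
under eq_bigr do rewrite exprMn sqrr_sign mul1r.
exact: (bessel_inequality phi2 phi_orth).
Qed.

Lemma reflectionB f1 f2 g1 g2 : sqint mu f1 -> sqint mu f2 ->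
  is_reflection f1 g1 -> is_reflection f2 g2 ->
  is_reflection (fun x => f1 x - f2 x) (fun x => g1 x - g2 x).
Proof.
move=> s1 s2 [sg1 h1] [sg2 h2]; split; first exact: sqintB.
have h3 : (fun n => 2 * ip mu (fun x => reflected_sum f1 n x - g1 x)
      (fun x => reflected_sum f1 n x - g1 x) +
      2 * ip mu (fun x => reflected_sum f2 n x - g2 x)
      (fun x => reflected_sum f2 n x - g2 x)) @ \oo --> 2 * (0 : R) + 2 * 0.
  by apply: cvgD; exact: cvgMl_tmp.
rewrite !mulr0 addr0 in h3; apply: (squeeze_cvgr _ (cvg_cst 0) h3).
apply: nearW => n; rewrite ip_ge0/=.
set u := (X in ip mu X X <= _).
have -> : u = fun x => (reflected_sum f1 n x - g1 x) - (reflected_sum f2 n x - g2 x).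
  apply/funext => x; rewrite /u /reflected_sum /psum.
  under eq_bigr do rewrite ipBl// mulrBr mulrBl.
  by rewrite sumrB; ring.
exact: ip_norm2B (sqintB (sqint_rsum f1 n) sg1) (sqintB (sqint_rsum f2 n) sg2).
Qed.

(** For [n > l] the coefficient of [reflected_sum f n] at [phi l] no longer changes, and its
    distance to that of [g] is bounded by the vanishing norm of the error. *)
Lemma reflection_ip f g l : is_reflection f g ->
  ip mu g (phi l) = (-1) ^+ l * ip mu f (phi l).
Proof.
move=> [sg fg]; set c := _ * _.
have le0 : (c - ip mu g (phi l)) ^+ 2 <= 0.
  apply: (cvgr_to_ge fg); exists l.+1 => // n /= ln.
  have := ip_phi_le phi2 phi_orth l (sqintB (sqint_rsum f n) sg).
  by rewrite ipBl// (ip_psum_phi phi2 phi_orth) ln mulr1n.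
by apply/esym/eqP; rewrite -subr_eq0 -sqrf_eq0 eq_le le0 sqr_ge0.
Qed.

Let sqint_expow t : 0 < t -> sqint mu (expow X t 0).
Proof.
move=> t0; apply: integrable_sqint; first exact: measurable_expow.
rewrite (_ : _ \o _ = EFin \o expow X (2 * t) 0).
  by apply: (integrable_expow mX X0 moment); rewrite mulr_gt0.
apply/funext => x /=; rewrite /expow !expr0 !mul1r expr2 -expRD; congr (expR _)%:E.
by ring.
Qed.

(** The difference of a bounded and a square integrable function is integrable against [e^{-X/2}];
    by [htrans_ip] and [reflection_ip] it is orthogonal to every [phi l], so the completeness
    results apply to it. *)
Lemma htrans_reflection h g : mu.-integrable setT (EFin \o h) -> sqint mu h ->
  is_reflection h g ->
  [/\ mu.-integrable setT (EFin \o (fun x => (htrans h x - g x) * expow X 1 0 x)),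
   \int[mu]_x ((htrans h x - g x) * expow X 1 0 x) = 0 &
   forall c, 0 < c ->
     \int[mu]_x ((htrans h x - g x) * expow X 1 0 x * (c < X x)%R%:R) = 0].
Proof.
move=> ih sh hg; have [sg _] := hg.
have mD : measurable_fun setT (fun x => htrans h x - g x).
  by apply: measurable_funB; [exact: measurable_htrans|case: sg].
have iD psi : sqint mu psi -> mu.-integrable setT (EFin \o psi) ->
    mu.-integrable setT (EFin \o (fun x => (htrans h x - g x) * psi x)).
  move=> sp ip.
  rewrite (_ : _ \o _ = (EFin \o (fun x => htrans h x * psi x)%R) \-
     (EFin \o (fun x => g x * psi x)%R))%E.
    apply: integrableB => //; [exact: integrable_htransM|exact: sqint_mul].
  by apply/funext => x; rewrite /= mulrBl EFinB.
have iX t : 0 < t -> mu.-integrable setT (EFin \o expow X t 0).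
  by move=> t0; apply: (integrable_expow mX X0 moment).
have orth l : \int[mu]_x ((htrans h x - g x) * phi l x) = 0.
  under eq_Rintegral do rewrite mulrBl.
  rewrite RintegralB//.
  - by rewrite htrans_ip// -(reflection_ip l hg) subrr.
  - by apply: integrable_htransM => //; exact: integrable_phi.
  - exact: sqint_mul.
split.
- by apply: iD; [exact: sqint_expow|exact: iX].
- apply: (laguerre_complete_total mX X0 A0 alpha2 mD _ orth).
  by apply: iD; [apply: sqint_expow|apply: iX]; rewrite invr_gt0.
- apply: (laguerre_complete_ray mX X0 A0 alpha2 mD _ orth).
  by apply: iD; [apply: sqint_expow|apply: iX]; rewrite invr_gt0.
Qed.

End laguerre_transform.

(** * Sigma-finiteness of the deformed measure, for Fubini *)

Section deformed_sigma_finite.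
Context {R : realType} (a alpha : R).

Let deformed_sigma_finite : sigma_finite setT (deformed_measure a alpha).
Proof.
pose p := a * alpha + a - 1.
have mp : measurable_fun setT (fun r : R => r `^ p) by exact: measurable_powR.
(* The instance is declared for arbitrary [a] and [alpha], so the density may fail to be integrable
   near [0]; the sets therefore bound the density as well as the variable. *)
exists (fun n : nat => `[- n%:R, n%:R] `&` [set r | r `^ p <= n%:R]).
  apply/seteqP; split=> // r _.
  pose N := maxn (Num.bound r) (Num.bound (r `^ p)).
  exists N => //=; rewrite in_itv/= -ler_norml; split.
    rewrite (le_trans (ltW (archi_boundP (normr_ge0 r))))// ler_nat /N /Num.bound normr_id.
    exact: leq_maxl.
  rewrite (le_trans (ltW (archi_boundP (powR_ge0 _ _))))// ler_nat.
  exact: leq_maxr.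
move=> n; have mE : measurable (`[- n%:R, n%:R] `&` [set r | r `^ p <= n%:R] : set (measurableTypeR R)).
  apply: measurableI => //.
  rewrite (_ : [set _ | _] = setT `&` (fun r : R => r `^ p) @^-1` `]-oo, n%:R]).
    exact: mp.
  by rewrite setTI; apply/seteqP; split => x /=; rewrite in_itv.
split=> //; rewrite /deformed_measure.
set E := (X in integral _ X _).
have mE' : measurable E by exact: measurableI.
pose J := `[- (n%:R : R), n%:R]%classic.
apply: (@le_lt_trans _ _ (\int[lebesgue_measure]_(r in E) (cst n%:R%:E r))%E).
  apply: ge0_le_integral => //.
  - by move=> r _; rewrite lee_fin powR_ge0.
  - by apply/measurable_EFinP/measurable_funTS.
  - by move=> r [[_ /=]]; rewrite lee_fin.
rewrite integral_cst//; apply: (@le_lt_trans _ _ (n%:R%:E * lebesgue_measure J)%E).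
  apply: lee_wpmul2l => //; apply: le_measure; rewrite ?inE//.
    exact: measurable_itv.
  by move=> r [[]].
rewrite /= lebesgue_measure_itv/=; case: ifP => _; last by rewrite mule0 ltry.
by rewrite -EFinB -EFinM ltry.
Qed.

HB.instance Definition _ := @Measure_isSigmaFinite.Build _ _ _
  (deformed_measure a alpha) deformed_sigma_finite.

End deformed_sigma_finite.

(** * Complex-valued functions *)

Section complex_square_integrable.
Context d (T : measurableType d) (R : realType).
Variable mu : {measure set T -> \bar R}.
Implicit Types (f g h : T -> R[i]).
Local Notation re f := (fun x => complex.Re (f x)).
Local Notation im f := (fun x => complex.Im (f x)).

Definition csqint f := sqint mu (re f) /\ sqint mu (im f).

(** The square of the L^2 norm ([cLnorm2E]); estimates are made on this real number rather than on
    an extended real root. *)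
Definition cip f : R := ip mu (re f) (re f) + ip mu (im f) (im f).

Lemma normc_ge0 (z : R[i]) : 0 <= ComplexField.Normc.normc z.
Proof. by case: z => x y; rewrite sqrtr_ge0. Qed.

Lemma sqr_normc (z : R[i]) :
  ComplexField.Normc.normc z ^+ 2 = complex.Re z ^+ 2 + complex.Im z ^+ 2.
Proof. by case: z => x y /=; rewrite sqr_sqrtr// addr_ge0 ?sqr_ge0. Qed.

Lemma measurable_sqr (u : T -> R) : measurable_fun setT u ->
  measurable_fun setT (fun x => (u x ^+ 2)%:E).
Proof. by move=> mu0; apply/measurable_EFinP; exact: measurable_funX. Qed.

Lemma measurable_normc f : cmeasurable f ->
  measurable_fun setT (fun x => ComplexField.Normc.normc (f x)).
Proof.
move=> [mr mi].
rewrite (_ : (fun x => _) = (fun x => Num.sqrt (complex.Re (f x) ^+ 2 + complex.Im (f x) ^+ 2))).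
  apply: measurableT_comp; last by apply: measurable_funD; exact: measurable_funX.
  by apply: continuous_measurable_fun; exact: sqrt_continuous.
by apply/funext => x; rewrite -sqr_normc sqrtr_sqr ger0_norm// normc_ge0.
Qed.

Lemma integral_sqr_normc f : cmeasurable f ->
  (\int[mu]_x `|(ComplexField.Normc.normc (f x))%:E| `^ 2 =
   \int[mu]_x (complex.Re (f x) ^+ 2)%:E + \int[mu]_x (complex.Im (f x) ^+ 2)%:E)%E.
Proof.
move=> [mr mi]; rewrite -ge0_integralD//.
- apply: eq_integral => x _; rewrite abse_EFin poweR_EFin ger0_norm ?normc_ge0//.
  by rewrite powR_mulrn ?normc_ge0// sqr_normc EFinD.
- by move=> x _; rewrite lee_fin sqr_ge0.
- exact: measurable_sqr.
- by move=> x _; rewrite lee_fin sqr_ge0.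
- exact: measurable_sqr.
Qed.

Lemma csqint_measurable f : csqint f -> cmeasurable f.
Proof. by move=> [[? _] [? _]]. Qed.

Lemma cip_ge0 f : 0 <= cip f.
Proof. by rewrite addr_ge0// ip_ge0. Qed.

Lemma cLnorm2E f : csqint f -> cLnorm mu 2%:E f = (Num.sqrt (cip f))%:E.
Proof.
move=> sf; have [sr si] := sf.
rewrite /cLnorm unlock /= integral_sqr_normc; last exact: csqint_measurable.
by rewrite -!ipE// -EFinD poweR_EFin powR12_sqrt// cip_ge0.
Qed.

Lemma cLfun2P f : cLfun mu 2%:E f <-> csqint f.
Proof.
split => [[mf]|sf]; last first.
  by split; [exact: csqint_measurable|rewrite cLnorm2E// ltry].
rewrite /cLnorm unlock /= => /lty_poweRy; rewrite integral_sqr_normc// => h.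
have [mr mi] := mf.
have {}h : (\int[mu]_x (complex.Re (f x) ^+ 2)%:E +
            \int[mu]_x (complex.Im (f x) ^+ 2)%:E < +oo)%E by apply: h; rewrite invr_neq0.
have ge (u : T -> R) : (0 <= \int[mu]_x (u x ^+ 2)%:E)%E.
  by apply: integral_ge0 => x _; rewrite lee_fin sqr_ge0.
split; split => //; apply: le_lt_trans h.
- exact: leeDl (ge (im f)).
- exact: leeDr (ge (re f)).
Qed.

Lemma cLnorm2_lt f (e : R) : csqint f -> 0 < e ->
  (cLnorm mu 2%:E f < e%:E)%E = (cip f < e ^+ 2).
Proof.
move=> sf e0; rewrite cLnorm2E// lte_fin -[in LHS](ger0_norm (ltW e0)) -sqrtr_sqr.
by rewrite ltr_sqrt// exprn_gt0.
Qed.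

Lemma cLfun1P f : cLfun mu 1%:E f <->
  mu.-integrable setT (EFin \o re f) /\ mu.-integrable setT (EFin \o im f).
Proof.
have le (z : R[i]) : `|complex.Re z| <= ComplexField.Normc.normc z /\
    `|complex.Im z| <= ComplexField.Normc.normc z.
  case: z => x y /=; rewrite -[`|x|]sqrtr_sqr -[`|y|]sqrtr_sqr.
  by rewrite !ler_sqrt ?addr_ge0 ?sqr_ge0// lerDl lerDr !sqr_ge0.
have ge (z : R[i]) : ComplexField.Normc.normc z <= `|complex.Re z| + `|complex.Im z|.
  rewrite -(@ler_pXn2r _ 2)// ?nnegrE ?normc_ge0 ?addr_ge0// sqr_normc.
  rewrite -(real_normK (num_real (complex.Re z))) -(real_normK (num_real (complex.Im z))).
  rewrite sqrrD -addrA lerD2l lerDr mulrn_wge0// mulr_ge0//.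
split.
  move=> [mf]; rewrite /cLnorm Lnorm1 => hf; have [mr mi] := mf.
  have ic : mu.-integrable setT (EFin \o (fun x => ComplexField.Normc.normc (f x))).
    by apply/integrableP; split => //; apply/measurable_EFinP; exact: measurable_normc.
  split; apply: (le_integrable _ _ _ ic) => //; try exact/measurable_EFinP.
    by move=> x _; rewrite /= lee_fin (ger0_norm (normc_ge0 _)); have [] := le (f x).
  by move=> x _; rewrite /= lee_fin (ger0_norm (normc_ge0 _)); have [] := le (f x).
move=> [ir ii]; have mf : cmeasurable f.
  by split; [case/integrableP : ir => /measurable_EFinP|
             case/integrableP : ii => /measurable_EFinP].
split => //; rewrite /cLnorm Lnorm1.
have : mu.-integrable setT (EFin \o (fun x => ComplexField.Normc.normc (f x))).
  apply: (le_integrable _ _ _ (integrableD measurableT (integrable_abse ir) (integrable_abse ii))) => //.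
    by apply/measurable_EFinP; exact: measurable_normc.
  move=> x _; rewrite /= lee_fin (ger0_norm (normc_ge0 _)) ger0_norm ?addr_ge0//.
by case/integrableP.
Qed.

Lemma csqintB f g : csqint f -> csqint g -> csqint (fun x => f x - g x).
Proof.
move=> [fr fi] [gr gi]; split.
  rewrite (_ : (fun x => _) = fun x => complex.Re (f x) - complex.Re (g x)); first exact: sqintB.
  by apply/funext => x; case: (f x) (g x) => ? ? [].
rewrite (_ : (fun x => _) = fun x => complex.Im (f x) - complex.Im (g x)); first exact: sqintB.
by apply/funext => x; case: (f x) (g x) => ? ? [].
Qed.

Lemma cipBE f g : cip (fun x => f x - g x) =
  ip mu (fun x => complex.Re (f x) - complex.Re (g x)) (fun x => complex.Re (f x) - complex.Re (g x)) +
  ip mu (fun x => complex.Im (f x) - complex.Im (g x)) (fun x => complex.Im (f x) - complex.Im (g x)).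
Proof.
rewrite /cip; congr (ip mu _ _ + ip mu _ _);
  by apply/funext => x; case: (f x) (g x) => ? ? [].
Qed.

Lemma cipC f g : cip (fun x => f x - g x) = cip (fun x => g x - f x).
Proof.
by rewrite !cipBE; congr (_ + _); apply: eq_Rintegral => x _; rewrite -mulrNN !opprB.
Qed.

Lemma cip_triangle f g h : csqint f -> csqint g -> csqint h ->
  cip (fun x => f x - h x) <= 2 * cip (fun x => f x - g x) + 2 * cip (fun x => g x - h x).
Proof.
move=> sf sg sh.
have [h1 h1'] := csqintB sf sg; have [h2 h2'] := csqintB sg sh.
have E : (fun x => f x - h x) = (fun x => (f x - g x) + (g x - h x)).
  by apply/funext => x; rewrite addrA subrK.
have := lerD (ip_norm2D h1 h2) (ip_norm2D h1' h2'); rewrite E.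
rewrite [in X in _ -> X]/cip.
set a1 := ip mu _ _; set a2 := ip mu _ _; set a3 := ip mu _ _.
set a4 := ip mu _ _; set a5 := ip mu _ _; set a6 := ip mu _ _.
move=> H; apply: (le_trans (le_trans _ H)); last by rewrite /cip -/a2 -/a3 -/a5 -/a6; lra.
rewrite /a1 /a4.
by apply: lerD; rewrite le_eqVlt; apply/orP; left; apply/eqP; apply: eq_Rintegral => x _;
   case: (f x - g x) (g x - h x) => ? ? [].
Qed.

Lemma cip0_ae f g : csqint f -> csqint g -> cip (fun x => f x - g x) = 0 ->
  {ae mu, forall x, f x = g x}.
Proof.
move=> sf sg; have [h1 h2] := csqintB sf sg.
move/eqP; rewrite paddr_eq0 ?ip_ge0// => /andP[/eqP e1 /eqP e2].
have ae0 (u : T -> R) : sqint mu u -> ip mu u u = 0 -> {ae mu, forall x, u x = 0}.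
  move=> su u0; have := ipE su; rewrite u0 => /esym u1.
  have [mu' _] := su; have := (ae_eq_integral_abs mu measurableT (measurable_sqr mu')).1.
  have E x : `|(u x ^+ 2)%:E|%E = (u x ^+ 2)%:E by rewrite gee0_abs// lee_fin sqr_ge0.
  under eq_integral do rewrite E.
  move=> /(_ u1); apply: filterS => x /(_ Logic.I) /= [] /eqP.
  by rewrite sqrf_eq0 => /eqP.
have := ae0 _ h1 e1; have := ae0 _ h2 e2.
apply: filterS2 => x; case: (f x) (g x) => x1 y1 [x2 y2] /= a1 a2.
by congr (_ +i* _)%C; apply/eqP; rewrite -subr_eq0; apply/eqP.
Qed.

Lemma ip_ae (u v : T -> R) : sqint mu u -> measurable_fun setT v ->
  {ae mu, forall x, u x = v x} -> sqint mu v /\ ip mu u u = ip mu v v.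
Proof.
move=> [mu' su] mv uv.
have E : (\int[mu]_x (u x ^+ 2)%:E = \int[mu]_x (v x ^+ 2)%:E)%E.
  apply: ae_eq_integral => //; [exact: measurable_sqr|exact: measurable_sqr|].
  by apply: filterS uv => x -> _.
have sv : sqint mu v by split => //; rewrite -E.
by split => //; apply: EFin_inj; rewrite !ipE.
Qed.

Lemma cip_ae f g : csqint f -> cmeasurable g -> {ae mu, forall x, f x = g x} ->
  csqint g /\ cip f = cip g.
Proof.
move=> [fr fi] [gr gi] fg.
have [h1 h2] : sqint mu (re g) /\ ip mu (re f) (re f) = ip mu (re g) (re g).
  by apply: ip_ae => //; apply: filterS fg => x ->.
have [h3 h4] : sqint mu (im g) /\ ip mu (im f) (im f) = ip mu (im g) (im g).
  by apply: ip_ae => //; apply: filterS fg => x ->.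
by split => //; rewrite /cip h2 h4.
Qed.

End complex_square_integrable.

Section measurable_real_functions.
Context d (T : measurableType d) (R : realType).
Variable (mu : {measure set T -> \bar R}).
Implicit Types (u v : T -> R).

Lemma measurable_fun_Mbool u (c : T -> bool) : measurable_fun setT u ->
  measurable_fun setT c -> measurable_fun setT (fun x => u x * (c x)%:R).
Proof.
move=> mu0 mc; rewrite (_ : (fun x => _) = fun x => if c x then u x else 0).
  by apply: measurable_fun_if => //; exact: measurable_funTS.
by apply/funext => x; case: ifP => _; rewrite ?mulr1 ?mulr0.
Qed.

Lemma ae_eq_Rintegral u v : measurable_fun setT u -> measurable_fun setT v ->
  {ae mu, forall x, u x = v x} -> \int[mu]_x u x = \int[mu]_x v x.
Proof.
move=> mu0 mv uv; congr fine; apply: ae_eq_integral => //; try exact/measurable_EFinP.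
by apply: filterS uv => x -> _.
Qed.

End measurable_real_functions.

(** * Truncation to bounded [X] *)

Section truncation.
Context d (T : measurableType d) (R : realType).
Variables (mu : {measure set T -> \bar R}) (X : T -> R).
Hypotheses (mX : measurable_fun setT X) (X0 : forall x, 0 <= X x).
Hypothesis iX : mu.-integrable setT (EFin \o expow X 1 0).

Definition truncation (u : T -> R) (n : nat) x : R := u x * (X x <= n%:R)%R%:R.

Lemma measurable_truncation u n : measurable_fun setT u ->
  measurable_fun setT (truncation u n).
Proof.
move=> mu0; apply: measurable_fun_Mbool => //.
by apply: measurable_fun_ler => //; exact: measurable_cst.
Qed.

Lemma sqint_truncation u n : sqint mu u -> sqint mu (truncation u n).
Proof.
move=> su; have [mu0 _] := su.
apply: integrable_sqint; first exact: measurable_truncation.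
apply: (le_integrable _ _ _ (sqint_integrable su)) => //.
  by apply/measurable_EFinP/measurable_funX; exact: measurable_truncation.
move=> x _; rewrite /= lee_fin /truncation; case: (X x <= n%:R)%R; first by rewrite mulr1.
by rewrite mulr0 expr0n /= normr0.
Qed.

Lemma integrable_truncation u n : sqint mu u ->
  mu.-integrable setT (EFin \o truncation u n).
Proof.
move=> su; have [mu0 _] := su.
(* On [X <= n] one has [|u| <= u^2 + 1] and [1 <= e^{n - X}]. *)
have iG : mu.-integrable setT
    (EFin \o (fun x => u x ^+ 2 + expR n%:R * expow X 1 0 x)).
  rewrite (_ : _ \o _ = (fun x => ((EFin \o (fun x => u x ^+ 2)%R) x +
      (expR n%:R)%:E * (EFin \o expow X 1 0) x)%E))//.
  apply: integrableD => //; first exact: sqint_integrable.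
  exact: integrableZl.
apply: (le_integrable _ _ _ iG) => //.
  by apply/measurable_EFinP; exact: measurable_truncation.
move=> x _; rewrite /= lee_fin /truncation /expow expr0 !mul1r -expRD.
rewrite [leRHS]ger0_norm ?addr_ge0 ?sqr_ge0 ?expR_ge0//.
have [Xn|_] := leP (X x) n%:R; last first.
  by rewrite mulr0 normr0 addr_ge0 ?sqr_ge0 ?expR_ge0.
rewrite mulr1 (@le_trans _ _ (u x ^+ 2 + 1))//; last first.
  by rewrite lerD2l -[leLHS]expR0 ler_expR subr_ge0.
rewrite -(real_normK (num_real (u x))).
by have := sqr_ge0 (`|u x| - 1); have := normr_ge0 (u x); move: `|u x| => v; nra.
Qed.

Lemma cvg_truncation u : sqint mu u ->
  (fun n => ip mu (fun x => truncation u n x - u x) (fun x => truncation u n x - u x))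
    @ \oo --> (0 : R).
Proof.
move=> su; have [mu0 _] := su.
have [||||_] := @Rintegral_dominated _ _ _ mu
   (fun n x => (truncation u n x - u x) * (truncation u n x - u x)) (fun=> 0) (fun x => u x ^+ 2).
- move=> n; apply: measurable_funM; apply: measurable_funB => //;
    exact: measurable_truncation.
- move=> x; apply: cvg_near_cst; near=> n.
  have -> : truncation u n x = u x.
    rewrite /truncation (_ : X x <= n%:R) ?mulr1//.
    by near: n; apply: nbhs_infty_ger.
  by rewrite subrr mul0r.
- exact: sqint_integrable.
- move=> n x; rewrite -expr2 ger0_norm ?sqr_ge0// /truncation; case: (X x <= n%:R)%R.
    by rewrite mulr1 subrr expr0n sqr_ge0.
  by rewrite mulr0 sub0r sqrrN.
by rewrite (_ : \int[mu]_x 0 = 0)// /Rintegral integral0.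
Unshelve. all: by end_near. Qed.

End truncation.

(** * The deformed Hankel transform *)

Section bessel_function.
Context {R : realType} (alpha : R).
Hypothesis alpha2 : - (1 / 2) <= alpha.

(** The powers of [t] cancel, which needs [t] nonzero: at [0] the convention for [powR] gives
    [bessel_j] the value [0] when [alpha] is nonzero, whereas the series has the value [1]. *)
Lemma bessel_jE t : 0 < t -> bessel_j alpha t = bessel_ser (alpha + 1) ((t / 2) ^+ 2).
Proof.
move=> t0; have al1 : -1 < alpha by apply: lt_le_trans alpha2; lra.
have b2 : 1 / 2 <= alpha + 1 by rewrite -lerBlDr; apply: le_trans alpha2; lra.
have b0 : 0 < alpha + 1 by apply: lt_le_trans b2.
have G0 : 0 < Gamma (alpha + 1) by exact: Gamma_gt0.
have t2 : 0 < t / 2 by rewrite divr_gt0.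
rewrite /bessel_j /bessel_J.
have -> : (fun m : nat => (-1) ^+ m / (m`!%:R * Gamma (m%:R + alpha + 1))
    * (t / 2) `^ (2 * m%:R + alpha)) =
  (fun m => ((t / 2) `^ alpha / Gamma (alpha + 1)) *
     (bessel_coef (alpha + 1) m * ((t / 2) ^+ 2) ^+ m)).
  apply/funext => m; have -> : m%:R + alpha + 1 = alpha + 1 + m%:R by ring.
  rewrite Gamma_poch// powRD; last by apply/implyP => _; rewrite gt_eqF.
  rewrite -exprM -natrM powR_mulrn ?(ltW t2)//.
  have p0 : poch (alpha + 1) m != 0 by rewrite gt_eqF// poch_gt0.
  have f0 : m`!%:R != 0 :> R by rewrite pnatr_eq0 -lt0n fact_gt0.
  rewrite /bessel_coef; move: (Gamma _) G0 (_ `^ _) (_ ^+ (2 * m)) ((-1) ^+ m) p0 f0.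
  move: (poch _ _) m`!%:R => p q G G0 x y z p0 q0.
  by field; rewrite p0 q0 gt_eqF.
set c := _ / Gamma _.
have cE : c * bessel_ser (alpha + 1) ((t / 2) ^+ 2) = limn (series
    (fun m => c * (bessel_coef (alpha + 1) m * ((t / 2) ^+ 2) ^+ m))).
  apply/esym/cvg_lim => //; rewrite (_ : series _ = fun n => c *
      pseries (bessel_coef (alpha + 1)) ((t / 2) ^+ 2) n).
    by apply: cvgMl_tmp; exact: cvg_bessel_ser.
  by apply/funext => n; rewrite /pseries /series/= mulr_sumr.
rewrite -cE mulrA /c powRN.
have -> : t `^ alpha = 2 `^ alpha * (t / 2) `^ alpha.
  by rewrite -powRM ?(ltW t2)// mulrC divfK.
have two0 : 2 `^ alpha != 0 :> R by rewrite powR_eq0 pnatr_eq0.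
have tp : (t / 2) `^ alpha != 0 by rewrite powR_eq0 gt_eqF.
move: (Gamma _) G0 (bessel_ser _ _) (_ `^ _) (_ `^ _) two0 tp => G G0 u v w w0 v0.
by field; rewrite v0 w0 gt_eqF.
Qed.

End bessel_function.

(** It transfers measurability from the Bessel series to [bessel_j], in spite of the conventional
    value of the latter at [0]. *)
Lemma measurable_off_point {R : realType} (u v : measurableTypeR R -> R) (p : R) :
  measurable_fun setT u -> (forall x, x != p -> v x = u x) -> measurable_fun setT v.
Proof.
move=> mu0 uv; rewrite (_ : v = fun x => u x + (v p - u p) * \1_[set p] x).
  apply: measurable_funD => //; apply: measurable_funM => //.
apply/funext => x; rewrite indicE; have [->|xp] := eqVneq x p.
  by rewrite mem_set// mulr1 addrC subrK.
by rewrite memNset ?mulr0 ?addr0 ?uv// => /eqP; rewrite (negPf xp).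
Qed.

(** * Specialization to [X r = r ^ a / a] *)

Section deformed_space.
Context {R : realType} (a alpha : R).
Hypotheses (a0 : 0 < a) (alpha2 : - (1 / 2) <= alpha).
Local Notation mu := (deformed_measure a alpha).
Local Notation A := (a `^ alpha).
Implicit Types (r s : measurableTypeR R) (h g u : measurableTypeR R -> R).

Definition deformed_var r : R := r `^ a / a.
Local Notation X := deformed_var.
Local Notation phi := (lag_fun X A alpha).

Let mX : measurable_fun setT X.
Proof. by apply: measurable_funM => //; exact: measurable_powR. Qed.

Let X0 r : 0 <= X r. Proof. by rewrite divr_ge0 ?powR_ge0 ?(ltW a0). Qed.

Let A0 : 0 < A. Proof. exact: powR_gt0. Qed.

Let moment k t : 0 < t ->
  (\int[mu]_x (X x ^+ k * expR (- (t * X x)))%:E =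
   (A * Gamma (alpha + 1 + k%:R) / t `^ (alpha + 1 + k%:R))%:E)%E.
Proof. by move=> t0; apply: deformed_moment => //; apply: lt_le_trans alpha2; lra. Qed.

Lemma ae_deformed_gt0 : {ae mu, forall r : measurableTypeR R, 0 < (r : R)}.
Proof.
exists `]-oo, (0 : R)]%classic; split.
- exact: measurable_itv.
- rewrite /= /deformed_measure (_ : _ `&` _ = set0) ?integral_set0//.
  by apply/seteqP; split => // x [] /=; rewrite !in_itv/= andbT => x0 /(le_lt_trans x0); rewrite ltxx.
- by move=> x /= /negP; rewrite -leNgt in_itv.
Qed.

Lemma laguerre_funE l r : laguerre_fun a alpha l r = phi l r.
Proof.
rewrite /laguerre_fun /lag_fun /lag_norm /deformed_var.
by rewrite (_ : 2 / a * r `^ a = 2 * (r `^ a / a)) //; ring.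
Qed.

(** Since [powR] is positive for every nonzero base, even a negative one, the two kernels can differ
    only where [r] or [s] is [0]. *)
Lemma bessel_kernelE r s : r != 0 -> s != 0 ->
  bessel_j alpha (2 / a * r `^ (a / 2) * s `^ (a / 2)) = hankel_kernel X alpha (X r) s.
Proof.
move=> r0 s0; have pos (x : R) p : x != 0 -> 0 < x `^ p.
  by move=> x0; rewrite lt0r powR_eq0 (negPf x0) powR_ge0.
rewrite bessel_jE//; last by rewrite !mulr_gt0 ?invr_gt0 ?pos.
congr (bessel_ser _ _).
have sq (x : R) : x `^ a = (x `^ (a / 2)) ^+ 2.
  by rewrite -powR_mulrn ?powR_ge0// -powRrM divfK.
rewrite /deformed_var !sq; move: (_ `^ _) (_ `^ _) => y z.
by field; rewrite gt_eqF.
Qed.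

Lemma htrans_reflection_ae h g : mu.-integrable setT (EFin \o h) -> sqint mu h ->
  is_reflection mu X A alpha h g ->
  {ae mu, forall r, htrans mu X A alpha h r = g r}.
Proof.
move=> ih sh hg.
have [iH H0 Hray] := htrans_reflection mX X0 A0 alpha2 moment ih sh hg.
set H := (fun x => _) in iH H0 Hray.
have mH : measurable_fun setT H by case/integrableP : iH => /measurable_EFinP.
have : {ae mu, forall x, H x = 0}.
  apply: (ae_eq0_ray iH H0) => c.
  have -> : \int[mu]_(x in `]c, +oo[) H x = \int[mu]_x (H x * (c < x)%R%:R).
    rewrite /Rintegral integral_mkcond; congr fine; apply: eq_integral => x _.
    rewrite patchE; case: ifPn; rewrite ?inE ?notin_setE/= in_itv/= andbT.
      by move=> ->; rewrite mulr1.
    by move=> /negP/negPf ->; rewrite mulr0.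
  have mHc : measurable_fun setT (fun x : measurableTypeR R => H x * (c < x)%R%:R).
    by apply: measurable_fun_Mbool => //; apply: measurable_fun_ltr.
  (* A ray from [c <= 0] has full measure and falls under the total integral. For [c > 0], [X] is
     increasing on the positive half-line, so the conditions [c < x] and [X c < X x] agree almost
     everywhere. *)
  have [c0|c0] := leP c 0.
    rewrite -H0; apply: ae_eq_Rintegral => //.
    by apply: filterS ae_deformed_gt0 => x x0; rewrite (le_lt_trans c0 x0) mulr1.
  have Xc : 0 < X c by rewrite divr_gt0// powR_gt0.
  rewrite -(Hray _ Xc); apply: ae_eq_Rintegral => //.
    by apply: measurable_fun_Mbool => //; apply: measurable_fun_ltr.
  apply: filterS ae_deformed_gt0 => x x0; congr (_ * _%:R).
  rewrite /deformed_var ltr_pM2r ?invr_gt0//.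
  have cn : c \in Num.nneg by rewrite nnegrE ltW.
  have xn : (x : R) \in Num.nneg by rewrite nnegrE ltW.
  have [cx|xc] := ltP c x; first by rewrite gt0_ltr_powR.
  by rewrite ltNge ge0_ler_powR// ltW.
apply: filterS => x /eqP; rewrite mulf_eq0 => /orP[|].
  by rewrite subr_eq0 => /eqP.
by rewrite /expow expr0 mul1r gt_eqF// expR_gt0.
Qed.

Local Notation re f := (fun x => complex.Re (f x)).
Local Notation im f := (fun x => complex.Im (f x)).
Local Open Scope complex_scope.

Lemma hankel_integralE (f : measurableTypeR R -> R[i]) r : cmeasurable f -> r != 0 ->
  hankel_integral a alpha f r =
  htrans mu X A alpha (re f) r +i* htrans mu X A alpha (im f) r.
Proof.
move=> [mr mi] r0.
have E (u : measurableTypeR R -> R) (j : measurableTypeR R -> R) :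
    measurable_fun setT u -> (forall s, s != 0 -> j s = u s * hankel_kernel X alpha (X r) s) ->
    \int[mu]_s j s = \int[mu]_s (u s * hankel_kernel X alpha (X r) s).
  move=> mu0 uj.
  have mK : measurable_fun setT (fun s => u s * hankel_kernel X alpha (X r) s).
    by apply: measurable_funM => //; exact: measurable_hankel_kernel.
  apply: ae_eq_Rintegral => //; first exact: measurable_off_point mK uj.
  by apply: filterS ae_deformed_gt0 => s s0; rewrite uj// gt_eqF.
have Mr (z : R[i]) (k : R) : complex.Re (z * k%:C) = complex.Re z * k.
  by case: z => x y /=; ring.
have Mi (z : R[i]) (k : R) : complex.Im (z * k%:C) = complex.Im z * k.
  by case: z => x y /=; ring.
rewrite /hankel_integral /cintegral.
set I1 := Rintegral _ _ _; set I2 := Rintegral _ _ _.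
have -> : I1 = \int[mu]_s (complex.Re (f s) * hankel_kernel X alpha (X r) s).
  by apply: E => // s s0; rewrite Mr bessel_kernelE.
have -> : I2 = \int[mu]_s (complex.Im (f s) * hankel_kernel X alpha (X r) s).
  by apply: E => // s s0; rewrite Mi bessel_kernelE.
by apply/eqP; rewrite eq_complex /= /htrans; apply/andP; split; apply/eqP; ring.
Qed.

Lemma measurable_hankel_integral (f : measurableTypeR R -> R[i]) : cLfun mu 1%:E f ->
  cmeasurable (hankel_integral a alpha f).
Proof.
move=> /[dup] -[mf _] /cLfun1P[ir ii].
have mir := measurable_htrans mX X0 alpha2 moment ir.
have mii := measurable_htrans mX X0 alpha2 moment ii.
split; [apply: (measurable_off_point mir (p := 0))|
        apply: (measurable_off_point mii (p := 0))];
  by move=> x x0; rewrite hankel_integralE.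
Qed.

Lemma truncation_dense (f : measurableTypeR R -> R[i]) (e : R) : csqint mu f -> 0 < e ->
  exists h : measurableTypeR R -> R[i],
    [/\ cLfun mu 1%:E h, cLfun mu 2%:E h &
        (cLnorm mu 2%:E (fun x => h x - f x)%R < e%:E)%E].
Proof.
move=> sf e0; have [sr si] := sf.
have iX : mu.-integrable setT (EFin \o expow X 1 0) by exact: (integrable_expow mX X0 moment).
pose h n : measurableTypeR R -> R[i] :=
  fun x => truncation X (re f) n x +i* truncation X (im f) n x.
have s2 n : csqint mu (h n) by split; exact: sqint_truncation.
have hc : (fun n => cip mu (fun x => h n x - f x)) @ \oo --> (0 + 0 : R).
  rewrite (_ : (fun n => _) = (fun n =>
    ip mu (fun x => truncation X (re f) n x - complex.Re (f x)) (fun x => truncation X (re f) n x - complex.Re (f x)) +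
    ip mu (fun x => truncation X (im f) n x - complex.Im (f x)) (fun x => truncation X (im f) n x - complex.Im (f x)))).
    by apply: cvgD; exact: cvg_truncation.
  by apply/funext => n; rewrite cipBE.
rewrite addr0 in hc.
have e20 : 0 < e ^+ 2 by rewrite exprn_gt0.
have [n _ /(_ n (leqnn n)) /= hn] := cvgr0_norm_lt _ hc _ e20.
exists (h n); split.
- by apply/cLfun1P; split; exact: integrable_truncation.
- exact/cLfun2P.
- rewrite cLnorm2_lt//; last exact: csqintB.
  by rewrite -(ger0_norm (cip_ge0 _ _)).
Qed.

Definition is_creflection (f g : measurableTypeR R -> R[i]) :=
  is_reflection mu X A alpha (re f) (re g) /\ is_reflection mu X A alpha (im f) (im g).

Lemma hankel_integral_creflection (f g : measurableTypeR R -> R[i]) :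
  cLfun mu 1%:E f -> csqint mu f ->
  is_creflection f g -> {ae mu, forall r, hankel_integral a alpha f r = g r}.
Proof.
move=> f1 [sr si] [gr gi]; have [mf _] := f1; have [ir ii] := (cLfun1P mu f).1 f1.
have hr := htrans_reflection_ae ir sr gr; have hi := htrans_reflection_ae ii si gi.
apply: filterS3 ae_deformed_gt0 hr hi => r r0 hr hi.
rewrite hankel_integralE ?gt_eqF// hr hi.
by case: (g r).
Qed.

Lemma csqint_reflected_sum (f : measurableTypeR R -> R[i]) n :
  csqint mu (fun r => reflected_sum mu X A alpha (re f) n r +i*
                      reflected_sum mu X A alpha (im f) n r).
Proof.
by split; apply: sqint_psum => l; exact: (@sqint_lag_fun _ _ _ mu X A alpha mX X0 moment).
Qed.

Lemma creflection_exists (f : measurableTypeR R -> R[i]) : csqint mu f ->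
  exists g : measurableTypeR R -> R[i], is_creflection f g.
Proof.
move=> [sr si].
have [gr hr] := reflection_exists mX X0 A0 alpha2 moment sr.
have [gi hi] := reflection_exists mX X0 A0 alpha2 moment si.
by exists (fun x => gr x +i* gi x).
Qed.

(** The integral formula only gives boundedness; square integrability is inherited from the
    reflection, to which the transform is equal almost everywhere. *)
Lemma csqint_hankel_integral (f : measurableTypeR R -> R[i]) :
  cLfun mu 1%:E f -> csqint mu f -> csqint mu (hankel_integral a alpha f).
Proof.
move=> f1 sf; have [g fg] := creflection_exists sf.
have [[sr _] [si _]] := fg.
have ae := hankel_integral_creflection f1 sf fg.
have sg : csqint mu g by split.
have [] := cip_ae sg (measurable_hankel_integral f1) => //.
by apply: filterS ae => x ->.
Qed.

(** On L^1 and L^2 the transform is the reflection, which is linear and bounded; the estimate for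
    [h - f] thus carries over to the images. *)
Lemma creflection_L2ext (f g : measurableTypeR R -> R[i]) :
  csqint mu f -> is_creflection f g -> L2ext mu (hankel_integral a alpha) f g.
Proof.
move=> sf [gr gi]; have sg : csqint mu g by have [[? _] [? _]] := (gr, gi).
split; first exact/cLfun2P.
(* With the constant [2] of [reflection_le] on squared norms, this gives
   [2 (e/2)^2 = e^2 / 2 < e^2]. *)
move=> e e0; exists (e / 2); first by rewrite divr_gt0.
move=> h h1 /cLfun2P sh; have [sfr sfi] := sf; have [shr shi] := sh.
have e20 : 0 < e / 2 by rewrite divr_gt0.
rewrite (cLnorm2_lt (csqintB sh sf) e20).
rewrite (cLnorm2_lt (csqintB (csqint_hankel_integral h1 sh) sg) e0) => hf.
have [k hk] := creflection_exists sh.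
have [kr ki] := hk.
have sk : csqint mu k by have [[? _] [? _]] := hk.
have ae := hankel_integral_creflection h1 sh hk.
have [_ <-] : csqint mu (fun x => hankel_integral a alpha h x - g x) /\
   cip mu (fun x => k x - g x) = cip mu (fun x => hankel_integral a alpha h x - g x).
  apply: cip_ae; first exact: csqintB.
    exact: (csqint_measurable (csqintB (csqint_hankel_integral h1 sh) sg)).
  by apply: filterS ae => x ->.
have le1 := reflection_le mX X0 A0 alpha2 moment (sqintB shr sfr)
  (reflectionB mX X0 moment shr sfr kr gr).
have le2 := reflection_le mX X0 A0 alpha2 moment (sqintB shi sfi)
  (reflectionB mX X0 moment shi sfi ki gi).
rewrite cipBE; rewrite cipBE in hf; apply: (le_lt_trans (lerD le1 le2)).
rewrite -mulrDr.
have := exprn_gt0 2 e0; move: hf; rewrite expr_div_n.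
by move: (e ^+ 2) (_ + _) => u v; lra.
Qed.

(** By [truncation_dense] there is always some [h] near [f], so the condition in [L2ext] is never
    vacuous, and [g1] and [g2] are both close to the transform of this [h]. *)
Lemma L2ext_unique (f g1 g2 : measurableTypeR R -> R[i]) : csqint mu f ->
  L2ext mu (hankel_integral a alpha) f g1 -> L2ext mu (hankel_integral a alpha) f g2 ->
  {ae mu, forall x, g1 x = g2 x}.
Proof.
move=> sf [/cLfun2P s1 e1] [/cLfun2P s2 e2].
apply: cip0_ae => //; apply/eqP; rewrite eq_le cip_ge0 andbT.
apply/ler_addgt0Pr => e e0; rewrite add0r.
(* Two squared distances below [e / 4], each doubled by [cip_triangle], add up to [e]. *)
have d0 : 0 < Num.sqrt (e / 4) by rewrite sqrtr_gt0 divr_gt0.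
have [d1 d10 h1] := e1 _ d0; have [d2 d20 h2] := e2 _ d0.
have d12 : 0 < Num.min d1 d2 by rewrite lt_min d10 d20.
have [h [hL1 hL2 hf]] := truncation_dense sf d12.
have sH := csqint_hankel_integral hL1 ((cLfun2P mu h).1 hL2).
have := h1 h hL1 hL2 (lt_le_trans hf _); rewrite lee_fin ge_min lexx => /(_ isT).
have := h2 h hL1 hL2 (lt_le_trans hf _); rewrite lee_fin ge_min lexx orbT => /(_ isT).
rewrite (cLnorm2_lt (csqintB sH s1) d0) (cLnorm2_lt (csqintB sH s2) d0).
rewrite sqr_sqrtr ?divr_ge0 ?(ltW e0)// => l2 l1.
apply: le_trans (cip_triangle s1 sH s2) _; rewrite cipC.
by move: l1 l2; move: (cip _ _) (cip _ _) => u v; lra.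
Qed.

End deformed_space.

(** * The semigroup at [z = pi i / 2] *)

Local Open Scope complex_scope.

Section L2_convergence.
Context d (T : measurableType d) (R : realType).
Variable mu : {measure set T -> \bar R}.
Implicit Types (f g h : T -> R[i]) (w : R[i]).
Local Notation re f := (fun x => complex.Re (f x)).
Local Notation im f := (fun x => complex.Im (f x)).

Lemma cLnorm2_cvg0 (v : nat -> T -> R[i]) : (forall n, csqint mu (v n)) ->
  (cLnorm mu 2%:E (v n) @[n --> \oo] --> 0%E) <-> (cip mu (v n) @[n --> \oo] --> (0 : R)).
Proof.
move=> sv.
rewrite (_ : (fun n => cLnorm mu 2%:E (v n)) = (fun n => (Num.sqrt (cip mu (v n)))%:E)).
  split.
    move=> /fine_cvg /= h.
    have -> : (fun n => cip mu (v n)) =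
        (fun n => Num.sqrt (cip mu (v n)) * Num.sqrt (cip mu (v n))).
      by apply/funext => n; rewrite -expr2 sqr_sqrtr// cip_ge0.
    by rewrite -[0](mulr0 0); exact: cvgM.
  move=> h; apply: cvg_EFin; first exact: nearW.
  rewrite -[X in _ --> X](@sqrtr0 R).
  exact: (continuous_cvg _ (@sqrt_continuous R 0) h).
by apply/funext => n; rewrite cLnorm2E.
Qed.

Lemma csqintZ w f : csqint mu f -> csqint mu (fun x => w * f x).
Proof.
case: w => x y [fr fi]; split.
  rewrite (_ : (fun t => _) = fun t => x * complex.Re (f t) - y * complex.Im (f t)).
    by apply: sqintB; exact: sqintZ.
  by apply/funext => t; case: (f t).
rewrite (_ : (fun t => _) = fun t => x * complex.Im (f t) + y * complex.Re (f t)).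
  by apply: sqintD; exact: sqintZ.
by apply/funext => t; case: (f t).
Qed.

Lemma cip_normE f : csqint mu f ->
  cip mu f = \int[mu]_x (complex.Re (f x) ^+ 2 + complex.Im (f x) ^+ 2).
Proof.
by move=> [sr si]; rewrite /cip /ip -RintegralD//; exact: sqint_mul.
Qed.

Lemma cipZ_unit w f : complex.Re w ^+ 2 + complex.Im w ^+ 2 = 1 -> csqint mu f ->
  cip mu (fun x => w * f x) = cip mu f.
Proof.
move=> w1 sf; rewrite !cip_normE//; last exact: csqintZ.
apply: eq_Rintegral => t _; case: w w1 (f t) => x y /= w1 [u v] /=.
transitivity ((x ^+ 2 + y ^+ 2) * (u ^+ 2 + v ^+ 2)); first by ring.
by rewrite w1 mul1r.
Qed.

End L2_convergence.

Section phase.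
Context {R : realType}.
Implicit Types (x y alpha : R).

Lemma cexp_imD x y : cexp (x *i) * cexp (y *i) = cexp ((x + y) *i).
Proof.
rewrite /cexp /= expR0 !mul1r cosD sinD; apply/eqP; rewrite eq_complex /=.
by apply/andP; split; apply/eqP; ring.
Qed.

Lemma cexp_im_norm x : complex.Re (cexp (x *i)) ^+ 2 + complex.Im (cexp (x *i)) ^+ 2 = 1.
Proof. by rewrite /= expR0 !mul1r cos2Dsin2. Qed.

Lemma cexp_im_neq0 x : cexp (x *i) != 0.
Proof.
apply/eqP => x0; have := cexp_im_norm x; rewrite x0 /= !expr0n addr0.
by move/esym/eqP; rewrite oner_eq0.
Qed.

Lemma cexp_nat_pi (l : nat) : cexp ((- (pi * l%:R)) *i) = ((-1) ^+ l)%:C :> R[i].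
Proof.
rewrite /cexp /= expR0 !mul1r cosN sinN.
have [-> ->] : cos (pi * l%:R) = (-1) ^+ l :> R /\ sin (pi * l%:R) = 0 :> R.
  elim: l => [|l [IHc IHs]]; first by rewrite mulr0 cos0 sin0 expr0.
  by rewrite -natr1 mulrDr mulr1 cosDpi sinDpi IHc IHs oppr0 exprS mulN1r.
by rewrite oppr0.
Qed.

Lemma cexp_phase alpha (l : nat) :
  cexp (((alpha + 1) * pi / 2) *i) * cexp (- ((pi / 2) *i) * (2 * l%:R + alpha + 1)%:C) =
  ((-1) ^+ l)%:C.
Proof.
have -> : - ((pi / 2) *i) * (2 * l%:R + alpha + 1)%:C = (- (pi / 2 * (2 * l%:R + alpha + 1))) *i :> R[i].
  by apply/eqP; rewrite eq_complex /=; apply/andP; split; apply/eqP; ring.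
rewrite cexp_imD -cexp_nat_pi; congr (cexp (_ *i)); by field.
Qed.

End phase.

Section laguerre_semigroup_limit.
Context {R : realType} (a alpha : R).
Hypotheses (a0 : 0 < a) (alpha2 : - (1 / 2) <= alpha).
Local Notation mu := (deformed_measure a alpha).
Local Notation A := (a `^ alpha).
Local Notation X := (deformed_var a).
Implicit Types (f g : measurableTypeR R -> R[i]) (r : measurableTypeR R).
Local Notation re f := (fun x => complex.Re (f x)).
Local Notation im f := (fun x => complex.Im (f x)).
Local Notation w := (cexp (((alpha + 1) * pi / 2) *i)).

Definition semigroup_sum f (n : nat) r : R[i] := \sum_(l < n)
  cexp (- ((pi / 2) *i) * (2 * l%:R + alpha + 1)%:C)
    * cdot mu f (fun s => (laguerre_fun a alpha l s)%:C) * (laguerre_fun a alpha l r)%:C.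

Lemma cdot_laguerre f l : cdot mu f (fun s => (laguerre_fun a alpha l s)%:C) =
  ip mu (re f) (lag_fun X A alpha l) +i* ip mu (im f) (lag_fun X A alpha l).
Proof.
rewrite /cdot /cintegral /ip; congr (_ +i* _); apply: eq_Rintegral => x _;
  by rewrite laguerre_funE; case: (f x) => u v /=; ring.
Qed.

Lemma semigroup_sumE f n r : w * semigroup_sum f n r =
  reflected_sum mu X A alpha (re f) n r +i* reflected_sum mu X A alpha (im f) n r.
Proof.
rewrite /semigroup_sum /reflected_sum /psum mulr_sumr.
elim: n => [|n IH]; first by rewrite !big_ord0.
rewrite !big_ord_recr /= IH cdot_laguerre laguerre_funE.
rewrite [w * _]mulrA [w * _]mulrA cexp_phase.
by apply/eqP; rewrite eq_complex /=; apply/andP; split; apply/eqP; ring.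
Qed.

Let w_neq0 : w != 0. Proof. exact: cexp_im_neq0. Qed.

Lemma csqint_semigroup_sum f n : csqint mu (semigroup_sum f n).
Proof.
have := csqintZ w^-1 (csqint_reflected_sum a0 alpha2 f n).
congr csqint; apply/funext => r.
by rewrite -semigroup_sumE mulKf.
Qed.

(** The factor [w] has modulus one, so multiplying by it preserves L^2 distances, and it turns the
    spectral sums into the reflected sums ([semigroup_sumE]). *)
Lemma L2lim_semigroup f g :
  L2lim mu (semigroup_sum f) g <-> is_creflection a alpha f (fun r => w * g r).
Proof.
have sg_iff : csqint mu g <-> csqint mu (fun r => w * g r).
  split => [|h]; first exact: csqintZ.
  have := csqintZ w^-1 h; congr csqint; apply/funext => r.
  by rewrite mulKf.
have E n : csqint mu g -> cip mu (fun r => semigroup_sum f n r - g r) =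
   ip mu (fun r => reflected_sum mu X A alpha (re f) n r - complex.Re (w * g r))
         (fun r => reflected_sum mu X A alpha (re f) n r - complex.Re (w * g r)) +
   ip mu (fun r => reflected_sum mu X A alpha (im f) n r - complex.Im (w * g r))
         (fun r => reflected_sum mu X A alpha (im f) n r - complex.Im (w * g r)).
  move=> sg; rewrite -(cipZ_unit (cexp_im_norm ((alpha + 1) * pi / 2))); last first.
    by apply: csqintB => //; exact: csqint_semigroup_sum.
  rewrite (_ : (fun r => w * _) = fun r => (reflected_sum mu X A alpha (re f) n r +i*
     reflected_sum mu X A alpha (im f) n r) - w * g r).
    by rewrite cipBE.
  by apply/funext => r; rewrite mulrBr semigroup_sumE.
split.
  move=> [/cLfun2P sg lim].
  have {lim} := (cLnorm2_cvg0 (fun n => csqintB (csqint_semigroup_sum f n) sg)).1 lim.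
  under eq_fun do rewrite E//.
  move=> lim; have [wr wi] := sg_iff.1 sg.
  by split; split => //; apply: (squeeze_cvgr _ (cvg_cst 0) lim);
    apply: nearW => n; rewrite ip_ge0/= (lerDl, lerDr) ip_ge0.
move=> [[wr hr] [wi hi]]; have sg : csqint mu g by apply/sg_iff.
split; first exact/cLfun2P.
apply/cLnorm2_cvg0; first by move=> n; apply: csqintB => //; exact: csqint_semigroup_sum.
under eq_fun do rewrite E//.
have h : (0 : R) + 0 = 0 by rewrite addr0.
by have := cvgD hr hi; rewrite h; apply.
Qed.

End laguerre_semigroup_limit.

Theorem theorem1p1 (R : realType) (a alpha : R) (f : measurableTypeR R -> R[i]) :
  0 < a -> - (1 / 2) <= alpha ->
  cLfun (deformed_measure a alpha) 2%:E f ->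
  L2eq (deformed_measure a alpha)
    (fun r => cexp (((alpha + 1) * pi / 2) *i)
              * laguerre_semigroup a alpha ((pi / 2) *i) f r)
    (hankel_transform a alpha f).
Proof.
move=> a0 alpha2 /cLfun2P sf.
pose w := cexp (((alpha + 1) * pi / 2) *i) : R[i].
have w0 : w != 0 by exact: cexp_im_neq0.
have [G hG] := creflection_exists a0 alpha2 sf.
have /(L2lim_semigroup a0 alpha2) lim :
    L2lim (deformed_measure a alpha) (semigroup_sum a alpha f)
      (laguerre_semigroup a alpha ((pi / 2) *i) f).
  (* [L2the] chooses some element of the set, so its membership follows from nonemptiness alone; the
     witness is the reflection of [f] with the phase removed. *)
  apply: xgetPex; exists (fun r => w^-1 * G r).
  apply/(L2lim_semigroup a0 alpha2).
  by rewrite (_ : (fun r => w * _) = G)//; apply/funext => r; rewrite mulVKf.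
(* The semigroup side, with its phase, is itself a reflection of [f], hence a value of the extension
   of [H] at [f]. It also proves that such values exist, and uniqueness identifies it with the
   chosen one. *)
have e1 := creflection_L2ext a0 alpha2 sf lim.
have e2 : L2ext (deformed_measure a alpha) (hankel_integral a alpha) f
    (hankel_transform a alpha f).
  by apply: xgetPex; eexists; exact: e1.
split; [by case: e1|by case: e2|].
by apply: filterS (L2ext_unique a0 alpha2 sf e1 e2) => r ->.
Qed.
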